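(* Let $W$ be the infinite dihedral group, with $S=\{s_1,s_2\}$ and $s_1s_2$ of infinite order, and let $L:W\to\mathbf Z$ be a weight function with $L(s_2)>L(s_1)>0$. Then $W,L$ is bounded and all of the properties P1, P2, …, P15 (listed in the context) hold for $(W,L)$.
   Context: The definitions below are for a Coxeter group $(W,S)$ ($S$ finite) with length function $l$ and a weight function $L:W\to\mathbf Z$, i.e. $L(ww')=L(w)+L(w')$ whenever $l(ww')=l(w)+l(w')$, with $L(s)>0$ for $s\in S$. $\mathcal A=\mathbf Z[v,v^{-1}]$. $\mathcal H$ is the $\mathcal A$-algebra with $1$ with generators $T_s$ ($s\in S$) and relations $(T_s-v^{L(s)})(T_s+v^{-L(s)})=0$ and $T_sT_{s'}T_s\cdots=T_{s'}T_sT_{s'}\cdots$ ($m_{s,s'}$ factors on each side, for $s\ne s'$ with $m_{s,s'}=\mathrm{ord}(ss')<\infty$); it has $\mathcal A$-basis $T_w=T_{s_1}\cdots T_{s_q}$ ($w=s_1\cdots s_q$ reduced). The bar involution is the ring involution of $\mathcal H$ with $\bar v=v^{-1}$, $\overline{T_s}=T_s^{-1}$. $c_w=\sum_y p_{y,w}T_y$ is the unique bar-invariant element with $p_{w,w}=1$ and $p_{y,w}\in v^{-1}\mathbf Z[v^{-1}]$ for $y\ne w$; the $c_w$ form an $\mathcal A$-basis. Write $T_xT_y=\sum_z f_{x,y,z}T_z$, $c_xc_y=\sum_z h_{x,y,z}c_z$. $W,L$ is bounded if there is $N\in\mathbf N$ with $v^{-N}f_{x,y,z}\in\mathbf Z[v^{-1}]$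 for all $x,y,z$. Then for $z\in W$, $\mathbf a(z)$ is the smallest integer $\ge 0$ with $h_{x,y,z}\in v^{\mathbf a(z)}\mathbf Z[v^{-1}]$ for all $x,y$, and $\gamma_{x,y,z^{-1}}\in\mathbf Z$ is the coefficient of $v^{\mathbf a(z)}$ in $h_{x,y,z}$. Define $\Delta(z)\ge 0$ and $n_z\in\mathbf Z\setminus\{0\}$ by $p_{1,z}=n_zv^{-\Delta(z)}+$ strictly smaller powers of $v$, and $\mathcal D=\{z\in W:\mathbf a(z)=\Delta(z)\}$. For $I\subset S$, $W_I$ is the subgroup generated by $I$. Preorders: $w\leftarrow_{\mathcal L}w'$ (resp. $w\leftarrow_{\mathcal R}w'$) if $c_w$ has nonzero coefficient in $c_sc_{w'}$ (resp. $c_{w'}c_s$) for some $s\in S$; $\le_{\mathcal L}$, $\le_{\mathcal R}$ are the preorders (reflexive transitive closures) generated by these and $\le_{\mathcal{LR}}$ is generated by both. $\sim_{\mathcal L},\sim_{\mathcal R},\sim_{\mathcal{LR}}$ are the associated equivalence relations; their classes are the left, right, two-sided cells. P1. $\mathbf a(z)\le\Delta(z)$ for all $z\in W$. P2. If $d\in\mathcal D$ and $\gamma_{x,y,d}\neq0$ then $x=y^{-1}$. P3. For $y\in W$ there is a unique $d\in\mathcal D$ with $\gamma_{y^{-1},y,d}\ne0$. P4. If $z'\le_{\mathcal{LR}}z$ then $\mathbf a(z')\ge\mathbf a(z)$; hence $\mathbf a(z')=\mathbf a(z)$ if $z'\sim_{\mathcal{LR}}z$. P5. If $d\in\mathcal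 D$, $y\in W$, $\gamma_{y^{-1},y,d}\ne0$ then $\gamma_{y^{-1},y,d}=n_d=\pm1$. P6. If $d\in\mathcal D$ then $d^2=1$. P7. $\gamma_{x,y,z}=\gamma_{y,z,x}$ for all $x,y,z$. P8. If $\gamma_{x,y,z}\ne0$ then $x\sim_{\mathcal L}y^{-1}$, $y\sim_{\mathcal L}z^{-1}$, $z\sim_{\mathcal L}x^{-1}$. P9. If $z'\le_{\mathcal L}z$ and $\mathbf a(z')=\mathbf a(z)$ then $z'\sim_{\mathcal L}z$. P10. If $z'\le_{\mathcal R}z$ and $\mathbf a(z')=\mathbf a(z)$ then $z'\sim_{\mathcal R}z$. P11. If $z'\le_{\mathcal{LR}}z$ and $\mathbf a(z')=\mathbf a(z)$ then $z'\sim_{\mathcal{LR}}z$. P12. For $I\subset S$ and $y\in W_I$, $\mathbf a(y)$ computed in $(W_I,L|_{W_I})$ equals $\mathbf a(y)$ computed in $(W,L)$. P13. Any left cell $\Gamma$ contains a unique $d\in\mathcal D$, and $\gamma_{x^{-1},x,d}\ne0$ for all $x\in\Gamma$. P14. $z\sim_{\mathcal{LR}}z^{-1}$ for all $z$. P15. Let $v'$ be a second indeterminate and $h'_{x,y,z}\in\mathbf Z[v',v'^{-1}]$ be obtained from $h_{x,y,z}$ by $v\mapsto v'$. If $x,x',y,w\in W$ satisfy $\mathbf a(w)=\mathbf a(y)$, then $\sum_{y'}h'_{w,x',y'}h_{x,y',y}=\sum_{y'}h_{x,w,y'}h'_{y',x',y}$. *)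

(* Defs.v *)
From HB Require Import structures.
From Stdlib Require Import Relation_Operators.
From mathcomp Require Import all_boot all_order all_algebra finmap.
From mathcomp Require Import all_classical.

Set Implicit Arguments.
Unset Strict Implicit.
Unset Printing Implicit Defensive.

Import Order.TTheory GRing.Theory Num.Theory.

Local Open Scope classical_set_scope.
Local Open Scope fset_scope.
Local Open Scope ring_scope.

(** * Laurent polynomials R[v, v^-1] *)

(* A Laurent polynomial is its finitely supported family of coefficients,
   indexed by the exponent; multiplication is convolution. *)
Record laurent (R : comNzRingType) :=
  Laurent { lcoef_fsfun : {fsfun int -> R with 0} }.

HB.instance Definition _ (R : comNzRingType) := [isNew for @lcoef_fsfun R].
HB.instance Definition _ (R : comNzRingType) := [Choice of laurent R by <:].

Definition lcoef (R : comNzRingType) (p : laurent R) (k : int) : R :=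
  lcoef_fsfun p k.

Section LaurentRing.
Variable R : comNzRingType.
Implicit Types p q r : laurent R.

Definition lsupp p : {fset int} := finsupp (lcoef_fsfun p).

Definition lzero : laurent R := Laurent [fsfun].
Definition lopp p : laurent R := Laurent [fsfun k in lsupp p => - lcoef p k].
Definition ladd p q : laurent R :=
  Laurent [fsfun k in lsupp p `|` lsupp q => lcoef p k + lcoef q k].
(* v ^ n *)
Definition lmono (n : int) : laurent R := Laurent [fsfun k in [fset n] => 1].
Definition lmul p q : laurent R :=
  Laurent [fsfun k in [fset i + j | i in lsupp p, j in lsupp q] =>
             \sum_(i <- lsupp p) lcoef p i * lcoef q (k - i)].

Lemma laurentP p q : lcoef p =1 lcoef q -> p = q.
Proof. by case: p q => [p] [q] h; congr Laurent; apply/fsfunP/h. Qed.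

Lemma lcoef_out p k : k \notin lsupp p -> lcoef p k = 0.
Proof. exact: fsfun_dflt. Qed.

Lemma lcoef0 k : lcoef lzero k = 0.
Proof. by rewrite /lcoef fsfun0E. Qed.

Lemma lcoefN p k : lcoef (lopp p) k = - lcoef p k.
Proof.
by rewrite {1}/lcoef fsfun_fun; case: ifPn => // /lcoef_out ->; rewrite oppr0.
Qed.

Lemma lcoefD p q k : lcoef (ladd p q) k = lcoef p k + lcoef q k.
Proof.
rewrite {1}/lcoef fsfun_fun; case: ifPn => //.
by rewrite in_fsetU negb_or => /andP[/lcoef_out -> /lcoef_out ->]; rewrite addr0.
Qed.

Lemma lcoef_mono n k : lcoef (lmono n) k = (k == n)%:R.
Proof. by rewrite /lcoef fsfun_fun in_fset1; case: eqP. Qed.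

Lemma lcoefM p q k :
  lcoef (lmul p q) k = \sum_(i <- lsupp p) lcoef p i * lcoef q (k - i).
Proof.
rewrite {1}/lcoef fsfun_fun; case: ifPn => // kN.
rewrite big_seq big1 // => i ip; rewrite [lcoef q _]lcoef_out ?mulr0 //.
apply: contra kN => kq; apply/imfset2P; exists i => //; exists (k - i) => //.
by rewrite addrC subrK.
Qed.

Lemma lcoefM_widen (D : {fset int}) p q k : lsupp p `<=` D ->
  lcoef (lmul p q) k = \sum_(i <- D) lcoef p i * lcoef q (k - i).
Proof.
move=> pD; rewrite lcoefM; apply: big_fset_incl => // i _ /lcoef_out ->.
by rewrite mul0r.
Qed.

Lemma laddA : associative ladd.
Proof. by move=> p q r; apply: laurentP => k; rewrite !lcoefD addrA. Qed.

Lemma laddC : commutative ladd.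
Proof. by move=> p q; apply: laurentP => k; rewrite !lcoefD addrC. Qed.

Lemma ladd0 : left_id lzero ladd.
Proof. by move=> p; apply: laurentP => k; rewrite lcoefD lcoef0 add0r. Qed.

Lemma laddN : left_inverse lzero lopp ladd.
Proof. by move=> p; apply: laurentP => k; rewrite lcoefD lcoefN lcoef0 addNr. Qed.

(* Reindexing of a convolution sum by a reflection or a translation. *)
Lemma lsum_reindex (f g : int -> int) (D E : {fset int}) (F : int -> R) :
  cancel f g -> cancel g f ->
  (forall i, i \notin D -> F i = 0) -> (forall i, i \notin E -> F (f i) = 0) ->
  \sum_(i <- D) F i = \sum_(i <- E) F (f i).
Proof.
move=> fK gK hD hE; pose E' := E `|` [fset g i | i in D].
have -> : \sum_(i <- E) F (f i) = \sum_(i <- E') F (f i).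
  by apply: big_fset_incl => [|i _ /hE //]; exact: fsubsetUl.
have <- : \sum_(i <- [fset f i | i in E']) F i = \sum_(i <- E') F (f i).
  by rewrite big_imfset //= => i j _ _ /(can_inj fK).
apply: big_fset_incl => [|i _ /hD //].
apply/fsubsetP => i iD; apply/imfsetP; exists (g i) => //=.
by rewrite in_fsetU; apply/orP; right; apply/imfsetP; exists i.
Qed.

Lemma lmulC : commutative lmul.
Proof.
move=> p q; apply: laurentP => k; rewrite !lcoefM.
rewrite (@lsum_reindex (fun i => k - i) (fun i => k - i) _ (lsupp q)).
- by apply: eq_bigr => i _; rewrite mulrC subKr.
- by move=> i; rewrite subKr.
- by move=> i; rewrite subKr.
- by move=> i /lcoef_out ->; rewrite mul0r.
- by move=> i /lcoef_out iq; rewrite subKr iq mulr0.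
Qed.

Lemma lmulA : associative lmul.
Proof.
move=> p q r; apply: laurentP => k; rewrite lcoefM.
rewrite (@lcoefM_widen [fset i + j | i in lsupp p, j in lsupp q]); last first.
  apply/fsubsetP => i; apply: contraLR => iN; rewrite mem_finsupp negbK.
  by rewrite /= fsfun_fun (negbTE iN).
under [RHS]eq_bigr => j _ do rewrite lcoefM mulr_suml.
rewrite exchange_big /= [LHS]big_seq [RHS]big_seq; apply: eq_bigr => i ip.
under eq_bigr => j _ do rewrite -mulrA.
rewrite -mulr_sumr; congr (_ * _); rewrite lcoefM.
rewrite [RHS](@lsum_reindex (fun j => i + j) (fun j => j - i) _ (lsupp q)).
- by apply: eq_bigr => j _; rewrite [i + j - i]addrC addKr opprD addrA.
- by move=> j; rewrite addrC addKr.
- by move=> j; rewrite addrC subrK.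
- move=> j jN; rewrite [lcoef q _]lcoef_out ?mul0r //; apply: contra jN => jq.
  by apply/imfset2P; exists i => //; exists (j - i) => //; rewrite addrC subrK.
- by move=> j /lcoef_out jq; rewrite [i + j - i]addrC addKr jq mul0r.
Qed.

Lemma lmul1 : left_id (lmono 0) lmul.
Proof.
move=> p; apply: laurentP => k; rewrite (@lcoefM_widen [fset 0]).
  by rewrite big_seq_fset1 lcoef_mono eqxx mul1r subr0.
apply/fsubsetP => i; rewrite mem_finsupp in_fset1; apply: contraR => i0.
by rewrite -/(lcoef _ _) lcoef_mono (negbTE i0).
Qed.

Lemma lmulDl : left_distributive lmul ladd.
Proof.
move=> p q r; apply: laurentP => k; rewrite lcoefD.
pose D := lsupp p `|` lsupp q.
rewrite !(@lcoefM_widen D) ?fsubsetUl ?fsubsetUr //; last first.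
  apply/fsubsetP => i; apply: contraLR => iN; rewrite mem_finsupp negbK.
  by rewrite /= fsfun_fun (negbTE iN).
by rewrite -big_split; apply: eq_bigr => i _; rewrite lcoefD mulrDl.
Qed.

Lemma lone_neq0 : lmono 0 != lzero.
Proof.
apply/eqP => /(congr1 (fun p => lcoef p 0)).
by rewrite lcoef_mono lcoef0 eqxx => /eqP; rewrite oner_eq0.
Qed.

HB.instance Definition _ :=
  GRing.isZmodule.Build (laurent R) laddA laddC ladd0 laddN.
HB.instance Definition _ :=
  GRing.Zmodule_isComNzRing.Build (laurent R)
    lmulA lmulC lmul1 lmulDl lone_neq0.

End LaurentRing.

Notation "''v^' n" := (@lmono _ n) (at level 1, n at level 1, format "''v^' n").

Notation Zv := (laurent int).

(* The involution v |-> v^-1 of R[v, v^-1]. *)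
Definition lbar (R : comNzRingType) (p : laurent R) : laurent R :=
  Laurent [fsfun k in [fset - i | i in lsupp p] => lcoef p (- k)].

Definition lconst (R : comNzRingType) (c : R) : laurent R :=
  Laurent [fsfun k in [fset (0 : int)] => c].

(* Apply [f], which should send 0 to 0, to all coefficients. *)
Definition lmap (R R' : comNzRingType) (f : R -> R') (p : laurent R) :
    laurent R' :=
  Laurent [fsfun k in lsupp p => f (lcoef p k)].

(* p \in Z[v^-1] *)
Definition in_Zvinv (p : Zv) : Prop := forall k : int, 0 < k -> lcoef p k = 0.

(** * Groups with a set of generators *)

(* The least element of [P], or 0 if [P] is empty. *)
Definition minnat (P : set nat) : nat :=
  xget 0%N [set n | P n /\ forall m, P m -> (n <= m)%N].

Section Groups.
Variable W : groupType.

Definition word_prod (S : set W) (q : seq S) : W := (\prod_(s <- q) val s)%g.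

Definition gen_subgroup (I : set W) : {pred W} :=
  fun w => `[< forall P : {pred W},
                 group_closed P -> (forall s, I s -> s \in P) -> w \in P >].

Lemma gen_subgroup_closed (I : set W) : group_closed (gen_subgroup I).
Proof.
split; first by apply/asboolP => P [].
move=> x y /asboolP hx /asboolP hy; apply/asboolP => P PG IP.
exact: (PG.2 _ _ (hx P PG IP) (hy P PG IP)).
Qed.

(* The order of [g] is the positive integer [m]. *)
Definition has_order (g : W) (m : nat) : Prop :=
  [/\ (0 < m)%N, (g ^+ m = 1)%g
    & forall k, (0 < k < m)%N -> (g ^+ k)%g <> 1%g].

Definition length (S : set W) (w : W) : nat :=
  minnat [set n | exists q : seq S, size q = n /\ word_prod q = w].

Definition reduced_word (S : set W) (w : W) : seq S :=
  xget [::] [set q : seq S | word_prod q = w /\ size q = length S w].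

Definition weight_function (S : set W) (L : W -> int) : Prop :=
  forall w w', length S (w * w')%g = (length S w + length S w')%N ->
    L (w * w')%g = L w + L w'.

(* W is the infinite dihedral group: two involutions generate it and their
   product has infinite order. *)
Definition infinite_dihedral (s1 s2 : W) : Prop :=
  [/\ (s1 * s1 = 1)%g, (s2 * s2 = 1)%g,
      forall w, w \in gen_subgroup [set s1; s2]
    & forall m, ~ has_order (s1 * s2)%g m].

End Groups.

(* The group W_I, and its set of generators I. *)
Record parabolic (W : groupType) (I : set W) := Parabolic {
  pval : W;
  pvalP : pval \in gen_subgroup I
}.

Section Parabolic.
Variables (W : groupType) (I : set W).
HB.instance Definition _ := [isSub for @pval W I].
HB.instance Definition _ := [Choice of parabolic I by <:].
HB.instance Definition _ :=
  SubChoice_isSubGroup.Build W (gen_subgroup I) (parabolic I)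
    (gen_subgroup_closed I).

Definition parabolic_gens : set (parabolic I) := [set x | I (val x)].
End Parabolic.
Arguments parabolic_gens {W} I.

(** * The Hecke algebra *)

(* x y x ... (m factors) *)
Definition alt_prod (B : nzRingType) (m : nat) (x y : B) : B :=
  \prod_(i < m) (if odd i then y else x).

Definition hecke_relations (W : groupType) (S : set W) (L : W -> int)
    (B : algType Zv) (t : S -> B) : Prop :=
  (forall s : S,
     (t s - ('v^(L (val s)))%:A) * (t s + ('v^(- L (val s)))%:A) = 0) /\
  (forall (s s' : S) (m : nat), s <> s' -> has_order (val s * val s')%g m ->
     alt_prod m (t s) (t s') = alt_prod m (t s') (t s)).

(* The Zv-algebra presented by generators T_s (s in S) and the relations above:
   the initial algebra endowed with a family satisfying them. *)
Record hecke_algebra (W : groupType) (S : set W) (L : W -> int) := HeckeAlgebra {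
  hecke_sort :> algType Zv;
  hecke_gen : S -> hecke_sort;
  hecke_gen_rel : hecke_relations L hecke_gen;
  hecke_lift : forall (B : algType Zv) (t : S -> B), hecke_relations L t ->
    exists f : {lrmorphism hecke_sort -> B}, forall s, f (hecke_gen s) = t s;
  hecke_lift_uniq : forall (B : algType Zv) (f g : {lrmorphism hecke_sort -> B}),
    (forall s, f (hecke_gen s) = g (hecke_gen s)) -> f =1 g
}.

(* The family of coefficients of [x] in the basis [b] (a junk value when no or
   several families exist, that is, only if [b] is not a basis). *)
Definition coords (W : choiceType) (R : comNzRingType) (H : lmodType R)
    (b : W -> H) (x : H) : {fsfun W -> R with 0} :=
  xget [fsfun] [set f : {fsfun W -> R with 0} |
                  x = \sum_(w <- finsupp f) f w *: b w].

Section Hecke.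
Variables (W : groupType) (S : set W) (L : W -> int) (H : hecke_algebra S L).

Definition Tb (w : W) : H := \prod_(s <- reduced_word S w) hecke_gen H s.

Definition is_bar (f : H -> H) : Prop :=
  [/\ {morph f : x y / x + y}, {morph f : x y / x * y}, f 1 = 1, involutive f
    & (forall (a : Zv) x, f (a *: x) = lbar a *: f x) /\
      (forall s : S, f (hecke_gen H s) * hecke_gen H s = 1 /\
                     hecke_gen H s * f (hecke_gen H s) = 1)].

Definition bar : H -> H := xget (id : H -> H) is_bar.

Definition cb (w : W) : H :=
  xget 0 [set x : H |
    [/\ bar x = x, coords Tb x w = 1
      & forall y, y <> w -> in_Zvinv ('v^1 * coords Tb x y)]].

Definition pcoef (y w : W) : Zv := coords Tb (cb w) y.
Definition fcoef (x y z : W) : Zv := coords Tb (Tb x * Tb y) z.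
Definition hcoef (x y z : W) : Zv := coords cb (cb x * cb y) z.

Definition bounded : Prop :=
  exists N : nat, forall x y z, in_Zvinv ('v^(- N%:Z) * fcoef x y z).

Definition afun (z : W) : nat :=
  minnat [set n : nat | forall x y, in_Zvinv ('v^(- n%:Z) * hcoef x y z)].

(* gamma_{x,y,z} is the coefficient of v^a(z^-1) in h_{x,y,z^-1}. *)
Definition gammac (x y z : W) : int :=
  lcoef (hcoef x y z^-1%g) (afun z^-1%g)%:Z.

(* p_{1,z} lies in Z[v^-1], and v^(-Delta) is its highest power of v. *)
Definition Delta (z : W) : nat :=
  minnat [set n : nat | lcoef (pcoef 1%g z) (- n%:Z) <> 0].
Definition ncoef (z : W) : int := lcoef (pcoef 1%g z) (- (Delta z)%:Z).
Definition Dset : set W := [set z | afun z = Delta z].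

Definition arrL (w w' : W) : Prop :=
  exists s : S, coords cb (cb (val s) * cb w') w <> 0.
Definition arrR (w w' : W) : Prop :=
  exists s : S, coords cb (cb w' * cb (val s)) w <> 0.
Definition leL : W -> W -> Prop := clos_refl_trans W arrL.
Definition leR : W -> W -> Prop := clos_refl_trans W arrR.
Definition leLR : W -> W -> Prop :=
  clos_refl_trans W (fun w w' => arrL w w' \/ arrR w w').
Definition simL (w w' : W) : Prop := leL w w' /\ leL w' w.
Definition simR (w w' : W) : Prop := leR w w' /\ leR w' w.
Definition simLR (w w' : W) : Prop := leLR w w' /\ leLR w' w.

Definition left_cell (G : set W) : Prop := exists w, G = [set x | simL x w].

Definition P1 : Prop := forall z, (afun z <= Delta z)%N.

Definition P2 : Prop :=
  forall d x y, Dset d -> gammac x y d <> 0 -> x = y^-1%g.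

Definition P3 : Prop :=
  forall y, exists! d, Dset d /\ gammac y^-1%g y d <> 0.

Definition P4 : Prop :=
  (forall z' z, leLR z' z -> (afun z <= afun z')%N) /\
  (forall z' z, simLR z' z -> afun z' = afun z).

Definition P5 : Prop :=
  forall d y, Dset d -> gammac y^-1%g y d <> 0 ->
    gammac y^-1%g y d = ncoef d /\ (ncoef d = 1 \/ ncoef d = -1).

Definition P6 : Prop := forall d, Dset d -> (d ^+ 2 = 1)%g.

Definition P7 : Prop := forall x y z, gammac x y z = gammac y z x.

Definition P8 : Prop :=
  forall x y z, gammac x y z <> 0 ->
    [/\ simL x y^-1%g, simL y z^-1%g & simL z x^-1%g].

Definition P9 : Prop := forall z' z, leL z' z -> afun z' = afun z -> simL z' z.

Definition P10 : Prop := forall z' z, leR z' z -> afun z' = afun z -> simR z' z.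

Definition P11 : Prop :=
  forall z' z, leLR z' z -> afun z' = afun z -> simLR z' z.

Definition P13 : Prop :=
  forall G, left_cell G ->
    exists d, [/\ G d /\ Dset d, forall d', G d' -> Dset d' -> d' = d
                & forall x, G x -> gammac x^-1%g x d <> 0].

Definition P14 : Prop := forall z, simLR z z^-1%g.

(* Both sides live in Z[v, v^-1][v', v'^-1]: [lconst] keeps an element of
   Z[v, v^-1], while [lmap lconst] replaces v by v' in it. *)
Definition P15 : Prop :=
  forall x x' y w, afun w = afun y ->
    \sum_(y' \in [set: W])
       lmap (@lconst int) (hcoef w x' y') * lconst (hcoef x y' y) =
    \sum_(y' \in [set: W])
       lconst (hcoef x w y') * lmap (@lconst int) (hcoef y' x' y)
    :> laurent Zv.

End Hecke.

Definition P12 (W : groupType) (S : set W) (L : W -> int)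
    (H : hecke_algebra S L) : Prop :=
  forall I : set W, (I `<=` S)%classic ->
  forall HI : hecke_algebra (parabolic_gens I) (fun y => L (val y)),
  forall y : parabolic I, afun HI y = afun H (val y).

(* Main.v *)
(* Put X = c_{s2} c_{s1} - zeta with zeta = v^(L(s2)-L(s1)) + v^(L(s1)-L(s2)),
   and let U_n be the Chebyshev polynomials (U_0 = 1, U_1 = X,
   X U_n = U_{n+1} + U_{n-1}).  Apart from c_1 and c_{s1}, the Kazhdan-Lusztig
   basis is c_{s1}^a U_n(X) c_{s2} c_{s1}^b with a, b in {0, 1}, and

     [a F b] [a' G b'] = [a (F G q_{b,a'}) b'],   [a F b] = c_{s1}^a F(X) c_{s2} c_{s1}^b,

   where q_{0,0} = v^L(s2) + v^-L(s2), q_{0,1} = q_{1,0} = X + zeta and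
   q_{1,1} = (v^L(s1) + v^-L(s1)) (X + zeta).  Only q_{0,0} and q_{1,1} reach the
   power v^L(s2), both with coefficient 1.  Hence a = L(s2) on these elements and
   the gamma's are the structure constants of the U_n (those of the
   representation ring of SL_2) with matching indices a, b; all the
   properties can be read off from this matrix-ring structure. *)

From HB Require Import structures.
From Stdlib Require Import Relation_Operators.
Require Import Defs.
From mathcomp Require Import all_boot all_order all_algebra finmap.
From mathcomp Require Import ring zify.
From mathcomp Require Import all_classical.

Set Implicit Arguments.
Unset Strict Implicit.
Unset Printing Implicit Defensive.

Import Order.TTheory GRing.Theory Num.Theory.

Local Open Scope classical_set_scope.
Local Open Scope ring_scope.

(** * Laurent polynomials *)

(** The Hecke algebra is given only by its universal property, so spanning, independence and the bar
    involution all have to be extracted from morphisms into suitable algebras. No braid relation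
    occurs, hence such a morphism only has to respect the quadratic relations. The family of the
    overview is shown to be a basis before the T_w are: a representation of rank six over the
    polynomials in X separates its members, and unitriangularity then carries the basis property
    over to the T_w. The obstacle is to get the transition coefficients into v^-1 Z[v^-1]:
    multiplying by c_{s1} on both sides can raise degrees by 2 L(s1), which may exceed L(s2), so a
    crude count fails. The elements c_{s2} T_w c_{s2} with w = s1 (s2 s1)^m serve as an intermediate
    family: their expansion in the T's is explicit, and their Chebyshev expansion has at most three
    terms. Delta needs an argument of its own, because p_{1,z} is not visible in the products of the
    c_w; so does P12, because the proper parabolic subgroups are not infinite dihedral. *)

Section Laurent.
Variable R : comNzRingType.
Implicit Types p q : laurent R.

Lemma lcoefDr p q k : lcoef (p + q) k = lcoef p k + lcoef q k.
Proof. exact: lcoefD. Qed.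

Lemma lcoefNr p k : lcoef (- p) k = - lcoef p k.
Proof. exact: lcoefN. Qed.

Lemma lcoef0r k : lcoef (0 : laurent R) k = 0.
Proof. exact: lcoef0. Qed.

Lemma lcoef1r k : lcoef (1 : laurent R) k = (k == 0)%:R.
Proof. exact: lcoef_mono. Qed.

Lemma lcoefMr p q k :
  lcoef (p * q) k = \sum_(i <- lsupp p) lcoef p i * lcoef q (k - i).
Proof. exact: lcoefM. Qed.

Lemma lcoef_monoM n p k : lcoef ('v^n * p) k = lcoef p (k - n).
Proof.
rewrite (@lcoefM_widen _ [fset n]%fset).
  by rewrite big_seq_fset1 lcoef_mono eqxx mul1r.
apply/fsubsetP => i; rewrite mem_finsupp in_fset1; apply: contraR => i0.
by rewrite -/(lcoef _ _) lcoef_mono (negbTE i0).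
Qed.

Lemma lmonoD m n : 'v^(m + n) = 'v^m * 'v^n :> laurent R.
Proof.
apply: laurentP => k; rewrite lcoef_monoM !lcoef_mono.
by rewrite subr_eq addrC.
Qed.

Lemma lmono0 : 'v^0 = 1 :> laurent R. Proof. by []. Qed.

Lemma lmonoX m n : 'v^m ^+ n = 'v^(m *+ n) :> laurent R.
Proof. by elim: n => // n IH; rewrite exprS IH mulrS lmonoD. Qed.

Lemma lmonoVr n : 'v^n * 'v^(- n) = 1 :> laurent R.
Proof. by rewrite -lmonoD subrr. Qed.

Lemma lcoef_const (c : R) k : lcoef (lconst c) k = if k == 0 then c else 0.
Proof. by rewrite /lcoef fsfun_fun in_fset1. Qed.

Lemma lcoef_constM (c : R) p k : lcoef (lconst c * p) k = c * lcoef p k.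
Proof.
rewrite (@lcoefM_widen _ [fset 0]%fset).
  by rewrite big_seq_fset1 lcoef_const eqxx subr0.
apply/fsubsetP => i; rewrite mem_finsupp in_fset1; apply: contraR => i0.
by rewrite -/(lcoef _ _) lcoef_const (negbTE i0).
Qed.

Lemma lconst_is_additive : {morph @lconst R : x y / x - y}.
Proof.
move=> x y; apply: laurentP => k; rewrite lcoefDr lcoefNr !lcoef_const.
by case: eqP => // _; rewrite subr0.
Qed.

Lemma lconst_is_monoid : GRing.monoid_morphism (@lconst R).
Proof.
split=> [|x y]; first by [].
by apply: laurentP => k; rewrite lcoef_constM !lcoef_const; case: eqP; rewrite ?mulr0.
Qed.

HB.instance Definition _ :=
  GRing.isZmodMorphism.Build R (laurent R) (@lconst R) lconst_is_additive.
HB.instance Definition _ :=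
  GRing.isMonoidMorphism.Build R (laurent R) (@lconst R) lconst_is_monoid.

Lemma lcoef_lbar p k : lcoef (lbar p) k = lcoef p (- k).
Proof.
rewrite {1}/lcoef fsfun_fun; case: ifPn => // kN.
rewrite lcoef_out //; apply: contra kN => kp.
by apply/imfsetP; exists (- k); rewrite ?opprK.
Qed.

Lemma lbarK : involutive (@lbar R).
Proof. by move=> p; apply: laurentP => k; rewrite !lcoef_lbar opprK. Qed.

Lemma lbar_mono n : lbar 'v^n = 'v^(- n) :> laurent R.
Proof. by apply: laurentP => k; rewrite lcoef_lbar !lcoef_mono eqr_oppLR. Qed.

Lemma lbar_is_additive : {morph @lbar R : x y / x - y}.
Proof.
by move=> x y; apply: laurentP => k; rewrite !(lcoef_lbar, lcoefDr, lcoefNr).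
Qed.

Lemma lbar_is_monoid : GRing.monoid_morphism (@lbar R).
Proof.
split=> [|p q]; apply: laurentP => k.
  by rewrite lcoef_lbar !lcoef1r oppr_eq0.
rewrite lcoef_lbar !lcoefMr.
rewrite (@lsum_reindex _ -%R -%R (lsupp p) (lsupp (lbar p))).
- by apply: eq_bigr => i _; rewrite !lcoef_lbar opprB opprK addrC.
- exact: opprK.
- exact: opprK.
- by move=> i /lcoef_out ->; rewrite mul0r.
- by move=> i /lcoef_out; rewrite lcoef_lbar => ->; rewrite mul0r.
Qed.

HB.instance Definition _ :=
  GRing.isZmodMorphism.Build (laurent R) (laurent R) (@lbar R) lbar_is_additive.
HB.instance Definition _ :=
  GRing.isMonoidMorphism.Build (laurent R) (laurent R) (@lbar R) lbar_is_monoid.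

End Laurent.

Section LaurentMap.
Variables (R R' : comNzRingType) (f : {rmorphism R -> R'}).

Lemma lcoef_lmap p k : lcoef (lmap f p) k = f (lcoef p k).
Proof.
rewrite {1}/lcoef fsfun_fun; case: ifPn => // /lcoef_out ->.
by rewrite rmorph0.
Qed.

Lemma lmap_is_additive : {morph lmap f : x y / x - y}.
Proof.
move=> x y; apply: laurentP => k.
by rewrite !(lcoef_lmap, lcoefDr, lcoefNr) rmorphB.
Qed.

Lemma lmap_is_monoid : GRing.monoid_morphism (lmap f).
Proof.
split=> [|p q]; apply: laurentP => k.
  by rewrite lcoef_lmap !lcoef1r rmorph_nat.
rewrite lcoef_lmap lcoefMr rmorph_sum [RHS](@lcoefM_widen _ (lsupp p)).
  by apply: eq_bigr => i _; rewrite rmorphM !lcoef_lmap.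
apply/fsubsetP => i; apply: contraLR => iN.
by rewrite mem_finsupp negbK -/(lcoef _ _) lcoef_lmap lcoef_out // rmorph0.
Qed.

HB.instance Definition _ := GRing.isZmodMorphism.Build
  (laurent R) (laurent R') (lmap f) lmap_is_additive.
HB.instance Definition _ := GRing.isMonoidMorphism.Build
  (laurent R) (laurent R') (lmap f) lmap_is_monoid.

End LaurentMap.

(** * Degree bounds and leading coefficients in Z[v, v^-1] *)

Definition ldeg_le (d : int) (p : Zv) := forall k, d < k -> lcoef p k = 0.

Lemma in_Zvinv_mono d p : in_Zvinv ('v^(- d) * p) <-> ldeg_le d p.
Proof.
split=> h k kd.
  by have := h (k - d); rewrite lcoef_monoM opprK subrK; apply; rewrite subr_gt0.
by rewrite lcoef_monoM opprK h //; rewrite ltrDr.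
Qed.

Lemma ldeg_le0 d : ldeg_le d 0.
Proof. by move=> k _; rewrite lcoef0r. Qed.

Lemma ldeg_leD d p q : ldeg_le d p -> ldeg_le d q -> ldeg_le d (p + q).
Proof. by move=> hp hq k kd; rewrite lcoefDr hp ?hq. Qed.

Lemma ldeg_leN d p : ldeg_le d p -> ldeg_le d (- p).
Proof. by move=> hp k kd; rewrite lcoefNr hp ?oppr0. Qed.

Lemma ldeg_le_trans d e p : d <= e -> ldeg_le d p -> ldeg_le e p.
Proof. by move=> de hp k /(le_lt_trans de); exact: hp. Qed.

Lemma ldeg_le_mono d n : n <= d -> ldeg_le d 'v^n.
Proof. by move=> nd k dk; rewrite lcoef_mono gt_eqF // (le_lt_trans nd). Qed.

Lemma ldeg_leM d e p q : ldeg_le d p -> ldeg_le e q -> ldeg_le (d + e) (p * q).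
Proof.
move=> hp hq k dek; rewrite lcoefMr big1 // => i _.
have [id|di] := leP i d; last by rewrite hp ?mul0r.
by rewrite hq ?mulr0 // ltrBrDr; apply: le_lt_trans dek; rewrite addrC lerD2r.
Qed.

(** In the convolution an exponent below [d] forces the other one above [e], so only the pair of [d]
    and [e] survives. *)
Lemma lcoefM_lead d e p q : ldeg_le d p -> ldeg_le e q ->
  lcoef (p * q) (d + e) = lcoef p d * lcoef q e.
Proof.
move=> hp hq; rewrite lcoefMr.
have [/lcoef_out p0|dp] := boolP (d \notin lsupp p).
  rewrite p0 mul0r big1 // => i _; have [id|di|->] := ltgtP i d.
  - by rewrite hq ?mulr0 //; lia.
  - by rewrite hp ?mul0r.
  - by rewrite p0 mul0r.
rewrite negbK in dp; rewrite (big_fsetD1 d) //= addrAC subrr add0r.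
rewrite big_seq big1 ?addr0 // => i; rewrite in_fsetD1 => /andP[id _].
have [id'|di|E] := ltgtP i d; last by rewrite E eqxx in id.
  by rewrite hq ?mulr0 //; lia.
by rewrite hp ?mul0r.
Qed.

Lemma ldeg_le_sum (I : eqType) (r : seq I) (P : pred I) (F : I -> Zv) d :
  (forall i, i \in r -> P i -> ldeg_le d (F i)) -> ldeg_le d (\sum_(i <- r | P i) F i).
Proof.
move=> h; rewrite big_seq_cond; apply: big_ind.
- exact: ldeg_le0.
- exact: ldeg_leD.
- by move=> i /andP[]; apply: h.
Qed.

Lemma lcoef_intr (z : int) k : lcoef (z%:~R : Zv) k = if k == 0 then z else 0.
Proof.
have <- : lconst z = z%:~R by rewrite -[in LHS](intz z) rmorph_int.
exact: lcoef_const.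
Qed.

Lemma ldeg_le_intr d (z : int) : 0 <= d -> ldeg_le d z%:~R.
Proof. by move=> d0 k dk; rewrite lcoef_intr gt_eqF // (le_lt_trans d0). Qed.

(** The heart of Kazhdan-Lusztig uniqueness: bar exchanges the coefficients of v^k and v^-k, and
    those with k >= 0 vanish. *)
Lemma bar_invariant_eq0 (p : Zv) : lbar p = p -> ldeg_le (-1) p -> p = 0.
Proof.
move=> pb hp; apply: laurentP => k; rewrite lcoef0.
have [k0|k0] := leP 0 k; first by rewrite hp //; lia.
by rewrite -pb lcoef_lbar hp //; lia.
Qed.

(** * Bases and their coordinates *)

Section Bases.
Variables (W : choiceType) (R : comNzRingType) (H : lmodType R).
Implicit Types (b : W -> H) (f g : {fsfun W -> R with 0}) (x y : H).

Definition lincomb b f : H := \sum_(w <- finsupp f) f w *: b w.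

Definition is_basis b :=
  (forall x, exists f, x = lincomb b f) /\
  (forall f, lincomb b f = 0 -> forall w, f w = 0).

Lemma lincomb_widen b f (D : {fset W}) : (finsupp f `<=` D)%fset ->
  lincomb b f = \sum_(w <- D) f w *: b w.
Proof.
by move=> fD; apply: big_fset_incl => // w _ /fsfun_dflt ->; rewrite scale0r.
Qed.

Lemma lincomb_fsfun b (D : {fset W}) (F : W -> R) :
  lincomb b [fsfun w in D => F w] = \sum_(w <- D) F w *: b w.
Proof.
rewrite (@lincomb_widen _ _ D); last first.
  apply/fsubsetP => w; apply: contraLR => wD.
  by rewrite mem_finsupp negbK fsfun_fun (negbTE wD).
by rewrite big_seq [RHS]big_seq; apply: eq_bigr => w wD; rewrite fsfun_fun wD.
Qed.

Lemma lincomb_linear b a f g : exists h, a *: lincomb b f + lincomb b g =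
  lincomb b h /\ forall w, h w = a * f w + g w.
Proof.
pose D := (finsupp f `|` finsupp g)%fset.
exists [fsfun w in D => a * f w + g w]; split; last first.
  move=> w; rewrite fsfun_fun; case: ifPn => //.
  rewrite in_fsetU negb_or => /andP[/fsfun_dflt -> /fsfun_dflt ->].
  by rewrite mulr0 addr0.
rewrite lincomb_fsfun !(@lincomb_widen _ _ D) ?fsubsetUl ?fsubsetUr //.
rewrite scaler_sumr -big_split; apply: eq_bigr => w _.
by rewrite scalerDl scalerA.
Qed.

Definition in_span b x := exists f, x = lincomb b f.

Lemma in_span_linear b a x y :
  in_span b x -> in_span b y -> in_span b (a *: x + y).
Proof. by move=> [f ->] [g ->]; have [h [-> _]] := lincomb_linear b a f g; exists h. Qed.

Lemma in_span0 b : in_span b 0.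
Proof. by exists [fsfun]; rewrite /lincomb finsupp0 big_seq_fset0. Qed.

Lemma in_spanZ b a x : in_span b x -> in_span b (a *: x).
Proof. by move=> hx; rewrite -[_ *: _]addr0; apply: in_span_linear => //; apply: in_span0. Qed.

Lemma in_spanD b x y : in_span b x -> in_span b y -> in_span b (x + y).
Proof. by move=> hx hy; rewrite -[x]scale1r; apply: in_span_linear. Qed.

Lemma in_span_sum b (I : eqType) (r : seq I) (F : I -> H) :
  (forall i, i \in r -> in_span b (F i)) -> in_span b (\sum_(i <- r) F i).
Proof.
move=> h; rewrite big_seq; apply: big_ind => //.
  exact: in_span0.
exact: in_spanD.
Qed.

Lemma in_span_base b w : in_span b (b w).
Proof.
exists [fsfun u in [fset w]%fset => 1].
by rewrite lincomb_fsfun big_seq_fset1 scale1r.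
Qed.

Section Coords.
Variables (b : W -> H) (bP : is_basis b).

Lemma coordsE x : x = lincomb b (coords b x).
Proof. by rewrite /coords; case: xgetP => [f -> //|] h; have [f hf] := bP.1 x; case: (h f). Qed.

Lemma coords_lincomb f : coords b (lincomb b f) = f.
Proof.
apply/fsfunP => w; apply/eqP; rewrite -subr_eq0 addrC -mulN1r.
have [h [hl hw]] := lincomb_linear b (-1) f (coords b (lincomb b f)).
rewrite mulN1r addrC -mulN1r addrC -hw (bP.2 h) // -hl.
by rewrite -coordsE scaleN1r addNr.
Qed.

Lemma coords_linear a x y w :
  coords b (a *: x + y) w = a * coords b x w + coords b y w.
Proof.
rewrite {1}(coordsE x) {1}(coordsE y).
have [h [-> <-]] := lincomb_linear b a (coords b x) (coords b y).
by rewrite coords_lincomb.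
Qed.

Lemma coords0 w : coords b 0 w = 0.
Proof.
by have := coords_linear 1 0 0 w; rewrite scale1r addr0 mul1r -{1}[coords b 0 w]addr0 => /addrI.
Qed.

Lemma coordsZ a x w : coords b (a *: x) w = a * coords b x w.
Proof. by have := coords_linear a x 0 w; rewrite coords0 !addr0. Qed.

Lemma coordsD x y w : coords b (x + y) w = coords b x w + coords b y w.
Proof. by have := coords_linear 1 x y w; rewrite scale1r mul1r. Qed.

Lemma coordsN x w : coords b (- x) w = - coords b x w.
Proof. by rewrite -scaleN1r coordsZ mulN1r. Qed.

Lemma coords_sum (I : Type) (r : seq I) (P : pred I) (F : I -> H) w :
  coords b (\sum_(i <- r | P i) F i) w = \sum_(i <- r | P i) coords b (F i) w.
Proof.
by apply: (big_morph (fun x => coords b x w)) => [p q|]; rewrite ?coordsD ?coords0.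
Qed.

Lemma coords_base u w : coords b (b u) w = (w == u)%:R.
Proof.
have -> : b u = lincomb b [fsfun z in [fset u]%fset => 1].
  by rewrite lincomb_fsfun big_seq_fset1 scale1r.
by rewrite coords_lincomb fsfun_fun in_fset1; case: eqP.
Qed.

Lemma coords_eq0 x : (forall w, coords b x w = 0) -> x = 0.
Proof.
move=> h; rewrite (coordsE x) /lincomb big1 // => w _.
by rewrite h scale0r.
Qed.

End Coords.

Lemma fsfun_max_supp (ell : W -> nat) f : (exists w, f w <> 0) ->
  exists w, f w <> 0 /\ forall u, f u <> 0 -> (ell u <= ell w)%N.
Proof.
case=> w0 /eqP fw0; pose N := \max_(w <- finsupp f) ell w.
have ex : exists n, has (fun w => ell w == n) (finsupp f).
  by exists (ell w0); apply/hasP; exists w0; rewrite // mem_finsupp.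
have ub n : has (fun w => ell w == n) (finsupp f) -> (n <= N)%N.
  by case/hasP => w wf /eqP <-; apply: leq_bigmax_seq.
case: (ex_maxnP ex ub) => n /hasP[w wf /eqP wn] nmax; exists w; split.
  by apply/eqP; rewrite -mem_finsupp.
move=> u /eqP fu; rewrite wn; apply: nmax; apply/hasP; exists u => //.
by rewrite mem_finsupp.
Qed.

(** Applying [phi w] to a vanishing combination isolates its coefficient at [w]. Independence thus
    reduces to exhibiting linear forms, which the universal property of the Hecke algebra can
    supply. *)
Lemma dual_is_basis b (phi : W -> H -> R) :
  (forall w a x y, phi w (a *: x + y) = a * phi w x + phi w y) ->
  (forall x, in_span b x) -> (forall w u, phi w (b u) = (w == u)%:R) ->
  is_basis b.
Proof.
move=> phiP bspan bdual; split=> // f f0 w.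
have phiD x y : phi w (x + y) = phi w x + phi w y.
  by have := phiP w 1 x y; rewrite scale1r mul1r.
have phi0 : phi w 0 = 0 by apply: (@addrI _ (phi w 0)); rewrite -phiD !addr0.
have phiZ a x : phi w (a *: x) = a * phi w x by rewrite -[_ *: _]addr0 phiP phi0 addr0.
have := congr1 (phi w) f0; rewrite phi0 (big_morph _ phiD phi0).
have [wf|wf _] := boolP (w \in finsupp f); last exact: fsfun_dflt.
rewrite (big_fsetD1 w) //= phiZ bdual eqxx mulr1 big_seq big1 ?addr0 // => u.
by rewrite in_fsetD1 => /andP[uw _]; rewrite phiZ bdual eq_sym (negbTE uw) mulr0.
Qed.

End Bases.

(** * Restriction of scalars, subalgebras and the bar involution *)

(** It has two uses. Along [lbar], a linear morphism into the restricted algebra is a bar-semilinear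
    one into the original. Along [polyC], matrices over polynomials become an algebra over
    Z[v, v^-1]. *)
Definition restr_scalars (R R' : comNzRingType) (phi : {rmorphism R -> R'})
  (B : algType R') : Type := B.

Section RestrictScalars.
Variables (R R' : comNzRingType) (phi : {rmorphism R -> R'}) (B : algType R').
Local Notation B' := (restr_scalars phi B).

HB.instance Definition _ := GRing.NzRing.on B'.

Let scale (a : R) (x : B') : B' := phi a *: (x : B).

Fact restr_scaleA a c x : scale a (scale c x) = scale (a * c) x.
Proof. by rewrite /scale scalerA rmorphM. Qed.

Fact restr_scale1 : left_id 1 scale.
Proof. by move=> x; rewrite /scale rmorph1 scale1r. Qed.

Fact restr_scaleDr : right_distributive scale +%R.
Proof. by move=> a x y; rewrite /scale scalerDr. Qed.

Fact restr_scaleDl x : {morph scale^~ x : a c / a + c}.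
Proof. by move=> a c; rewrite /scale rmorphD scalerDl. Qed.

HB.instance Definition _ := GRing.Zmodule_isLmodule.Build R B'
  restr_scaleA restr_scale1 restr_scaleDr restr_scaleDl.

Lemma restr_scalarsE a (x : B') : a *: x = (phi a *: (x : B) : B').
Proof. by []. Qed.

Fact restr_scaleAl (a : R) (x y : B') : a *: (x * y) = a *: x * y.
Proof. by rewrite !restr_scalarsE; apply: (@scalerAl _ B). Qed.

HB.instance Definition _ := GRing.Lmodule_isLalgebra.Build R B' restr_scaleAl.

Fact restr_scaleAr (a : R) (x y : B') : a *: (x * y) = x * (a *: y).
Proof. by rewrite !restr_scalarsE; apply: (@scalerAr _ B). Qed.

HB.instance Definition _ := GRing.Lalgebra_isAlgebra.Build R B' restr_scaleAr.

End RestrictScalars.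

Lemma lrmorphism_of (R : comNzRingType) (A B : algType R) (f : A -> B) :
  (forall x y, f (x + y) = f x + f y) -> (forall x y, f (x * y) = f x * f y) ->
  f 1 = 1 -> (forall a x, f (a *: x) = a *: f x) ->
  exists g : {lrmorphism A -> B}, g =1 f.
Proof.
move=> fD fM f1 fZ.
have flin : linear f by move=> a x y; rewrite fD fZ.
pose l := GRing.isLinear.Build R A B *:%R f flin.
pose m := GRing.isMonoidMorphism.Build A B f (conj f1 fM).
pose g : {lrmorphism A -> B} := HB.pack f l m.
by exists g.
Qed.

Section SubAlgebra.
Variables (R : comNzRingType) (H : algType R) (P : {pred H}).

Record subalgebra (Palg : subalg_closed P) :=
  SubAlgebra { subalg_val : H; _ : subalg_val \in P }.

Variable Palg : subalg_closed P.
HB.instance Definition _ := [isSub for @subalg_val Palg].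
HB.instance Definition _ := [Choice of subalgebra Palg by <:].
HB.instance Definition _ :=
  GRing.SubChoice_isSubAlgebra.Build R H P (subalgebra Palg) Palg.

End SubAlgebra.

Section HeckeGeneral.
Variables (W : groupType) (S : set W) (L : W -> int) (H : hecke_algebra S L).
Local Notation T := (hecke_gen H).

(** The generators lift to the subalgebra cut out by [P]. Followed by the inclusion, this lift fixes
    every generator, so it is the identity by the uniqueness clause and the subalgebra is
    everything. *)
Lemma hecke_ind (P : H -> Prop) :
  P 1 -> (forall a x y, P x -> P y -> P (a *: x + y)) ->
  (forall x y, P x -> P y -> P (x * y)) -> (forall s, P (T s)) ->
  forall x, P x.
Proof.
move=> P1 PD PM PT x; pose Q : {pred H} := fun x => `[< P x >].
have Qalg : subalg_closed Q.
  split; first exact/asboolP.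
    by move=> a y z /asboolP ? /asboolP ?; apply/asboolP/PD.
  by move=> y z /asboolP ? /asboolP ?; apply/asboolP/PM.
have QT s : T s \in Q by apply/asboolP.
pose t s : subalgebra Qalg := SubAlgebra Qalg (QT s).
have val_prod n s s' : val (alt_prod n (t s) (t s')) = alt_prod n (T s) (T s').
  by rewrite /alt_prod rmorph_prod; apply: eq_bigr => i _; case: ifP.
have trel : hecke_relations L t.
  have [T1 T2] := hecke_gen_rel H; split=> [s|s s' m ss' om]; apply: val_inj.
    rewrite rmorphM !rmorphD rmorphN /= !linearZ /=.
    by rewrite scalerN; apply: T1.
  by apply: etrans (val_prod m s s') _; rewrite T2 // val_prod.
have [f fT] := hecke_lift H trel.
have [||||g gE] := @lrmorphism_of _ H H (fun x => val (f x)).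
- by move=> y z; rewrite !rmorphD.
- by move=> y z; rewrite !rmorphM.
- by rewrite !rmorph1.
- by move=> a y; rewrite !linearZ.
have gid : g =1 idfun by apply: hecke_lift_uniq => s; rewrite gE fT.
by rewrite -[x]gid gE; apply/asboolP/(valP (f x)).
Qed.

(** Under this condition every braid relation is vacuous. It holds for the infinite dihedral group
    and in rank at most one. *)
Definition no_braid := forall (s s' : S) m, s <> s' ->
  ~ has_order (val s * val s')%g m.

Hypothesis noB : no_braid.

Lemma hecke_quadratic s :
  T s * T s = 1 + ('v^(L (val s)) - 'v^(- L (val s))) *: T s.
Proof.
have := (hecke_gen_rel H).1 s; rewrite mulrBl !mulrDr.
rewrite -!scalerAl -!scalerAr !mul1r !mulr1 scalerA lmonoVr scale1r => E.
apply/eqP; rewrite -subr_eq0 -E scalerBl opprD opprB !opprD.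
by rewrite !addrA (addrAC _ (- 1)) (addrAC _ (- 1)).
Qed.

Let Tinv (s : S) : H := T s - ('v^(L (val s)) - 'v^(- L (val s)))%:A.

Lemma Tinv_left s : Tinv s * T s = 1.
Proof. by rewrite mulrBl hecke_quadratic -scalerAl mul1r addrK. Qed.

Lemma Tinv_right s : T s * Tinv s = 1.
Proof. by rewrite mulrBr hecke_quadratic -scalerAr mulr1 addrK. Qed.

Local Notation Hbar := (restr_scalars (@lbar int) H).

(** With scalars twisted by bar, each factor of the quadratic relation for T_s^-1 is the
    corresponding factor of the relation for T_s. *)
Lemma Tinv_rel : @hecke_relations W S L Hbar Tinv.
Proof.
split=> [s|s s' m /noB h /h //].
rewrite !restr_scalarsE /= !lbar_mono opprK.
rewrite /Tinv scalerBl opprB; have := (hecke_gen_rel H).1 s.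
set x := _%:A; set y := _%:A => E.
have -> : T s + (y - x) - y = T s - x by rewrite addrA addrAC addrK.
by have -> : T s + (y - x) + x = T s + y by rewrite -addrA subrK.
Qed.

(** Lifting [Tinv] to the twisted algebra gives a semilinear ring morphism. Its square is linear and
    fixes the generators, hence is the identity. *)
Lemma bar_exists : exists f : H -> H, is_bar f.
Proof.
have [f fT] := hecke_lift H Tinv_rel.
have fZ a x : f (a *: x) = lbar a *: (f x : H) by rewrite linearZ.
have fD x y : f (x + y) = f x + f y :> H by rewrite rmorphD.
have fM x y : f (x * y) = f x * f y :> H by rewrite rmorphM.
have f1 : f 1 = 1 :> H by rewrite rmorph1.
have fTinv s : f (Tinv s) = T s.
  rewrite fD fT -scaleNr fZ f1 rmorphN rmorphB /= !lbar_mono opprK /Tinv opprB.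
  by rewrite -addrA -opprB scaleNr addNr addr0.
have [||||g gE] := @lrmorphism_of _ H H (fun x => f (f x) : H).
- by move=> x y; rewrite !fD.
- by move=> x y; rewrite !fM.
- by rewrite !f1.
- by move=> a x; rewrite !fZ lbarK.
have gid : g =1 idfun by apply: hecke_lift_uniq => s; rewrite gE fT fTinv.
exists f; split=> //; first by move=> x; rewrite -gE gid.
by split=> // s; rewrite fT Tinv_left Tinv_right.
Qed.

Lemma barP : @is_bar W S L H (@bar W S L H).
Proof. by rewrite /bar; case: xgetP => // h; have [f hf] := bar_exists; case: (h f). Qed.

Lemma bar_gen s : @bar W S L H (T s) = T s - ('v^(L (val s)) - 'v^(- L (val s)))%:A.
Proof.
have [_ _ _ _ [_ /(_ s)[bT _]]] := barP.
by rewrite -[LHS]mulr1 -{1}(Tinv_right s) mulrA bT mul1r.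
Qed.

End HeckeGeneral.

(** * Unitriangular families and uniqueness of the Kazhdan-Lusztig basis *)

Lemma in_Zvinv_v p : in_Zvinv ('v^1 * p) <-> ldeg_le (-1) p.
Proof.
have -> : 'v^1 = 'v^(- -1) :> Zv by rewrite opprK.
exact: in_Zvinv_mono.
Qed.

Section Triangular.
Variables (W : choiceType) (H : lmodType Zv) (ell : W -> nat).
Implicit Types (b c : W -> H) (d e : int) (n m : nat) (x y : H).

(** The combination is a list with possible repetitions rather than a coordinate family: it has to
    make sense for the T_w before they are known to form a basis. *)
Definition tri b d n x := exists2 s : seq (Zv * W),
  forall i, i \in s -> ldeg_le d i.1 /\ (ell i.2 < n)%N &
  x = \sum_(i <- s) i.1 *: b i.2.

Lemma tri0 b d n : tri b d n 0.
Proof. by exists [::]; rewrite ?big_nil. Qed.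

Lemma triD b d n x y : tri b d n x -> tri b d n y -> tri b d n (x + y).
Proof.
move=> [s hs ->] [t ht ->]; exists (s ++ t); last by rewrite big_cat.
by move=> i; rewrite mem_cat => /orP[/hs|/ht].
Qed.

Lemma triZ b d e n a x : ldeg_le e a -> tri b d n x -> tri b (e + d) n (a *: x).
Proof.
move=> ha [s hs ->]; exists [seq (a * i.1, i.2) | i <- s].
  by move=> _ /mapP[i /hs[hd hn] ->]; split=> //; apply: ldeg_leM.
by rewrite big_map scaler_sumr; apply: eq_bigr => i _; rewrite scalerA.
Qed.

Lemma triN b d n x : tri b d n x -> tri b d n (- x).
Proof.
move=> hx; rewrite -scaleN1r -[d]add0r; apply: triZ => //.
by apply: ldeg_leN; apply: ldeg_le_mono.
Qed.

Lemma tri_base b n w : (ell w < n)%N -> tri b 0 n (b w).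
Proof.
move=> hw; exists [:: (1, w)]; last by rewrite big_seq1 scale1r.
by move=> i; rewrite inE => /eqP ->; split=> //; apply: ldeg_le_mono.
Qed.

Lemma tri_weaken b d e n m x : d <= e -> (n <= m)%N -> tri b d n x -> tri b e m x.
Proof.
move=> de nm [s hs ->]; exists s => // i /hs[hd hn]; split.
  exact: ldeg_le_trans hd.
exact: leq_trans nm.
Qed.

Lemma tri_term b d n a w : ldeg_le d a -> (ell w < n)%N -> tri b d n (a *: b w).
Proof. by move=> ha hw; rewrite -[d]addr0; apply/triZ/tri_base. Qed.

Lemma tri_comp b c d n x :
  (forall w, (ell w < n)%N -> tri c 0 (ell w).+1 (b w)) ->
  tri b d n x -> tri c d n x.
Proof.
move=> bc [s hs ->]; rewrite big_seq; apply: big_ind.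
- exact: tri0.
- exact: triD.
- move=> i /hs[hd hn]; rewrite -[d]addr0; apply: triZ => //.
  exact: tri_weaken (bc _ hn).
Qed.

(** Inversion of a unitriangular matrix by induction on length: each [b u] occurring in [c w - b w]
    is [c u] plus a shorter remainder, and multiplying by a coefficient of degree at most -1 keeps
    that bound. *)
Lemma tri_invert b c : (forall w, tri b (-1) (ell w) (c w - b w)) ->
  forall w, tri c (-1) (ell w) (b w - c w).
Proof.
move=> bc w; elim: {w}(ell w) {-2}w (leqnn (ell w)) => [|n IH] w wn.
  have [s hs E] := bc w; rewrite -opprB E big_seq big1 ?oppr0; first exact: tri0.
  by move=> i /hs[_ ]; move: wn; case: (ell w).
rewrite -opprB; apply: triN; apply: tri_comp (bc w) => u uw.
rewrite -[b u](subrK (c u)); apply: triD; last exact: tri_base.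
apply: tri_weaken (IH u _) => //; by rewrite -ltnS (leq_trans uw).
Qed.

Lemma coords_tri b d n x w : is_basis b -> tri b d n x ->
  ldeg_le d (coords b x w) /\ ((n <= ell w)%N -> coords b x w = 0).
Proof.
move=> bP [s hs ->]; rewrite coords_sum //; split.
  apply: ldeg_le_sum => i /hs[hd _] _; rewrite coordsZ // coords_base //.
  case: eqP => _; rewrite ?mulr1 ?mulr0 //; exact: ldeg_le0.
move=> nw; rewrite big_seq big1 // => i /hs[_ hn]; rewrite coordsZ // coords_base //.
case: eqP => [E|]; rewrite ?mulr0 //.
by move: hn; rewrite -E ltnNge nw.
Qed.

Lemma tri_in_span b d n x : tri b d n x -> in_span b x.
Proof.
by move=> [s _ ->]; apply: in_span_sum => i _; apply/in_spanZ/in_span_base.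
Qed.

Lemma tri_coords b d x : is_basis b -> (forall w, ldeg_le d (coords b x w)) ->
  exists n, tri b d n x.
Proof.
move=> bP hx; exists (\max_(w <- finsupp (coords b x)) ell w).+1.
exists [seq (coords b x w, w) | w <- finsupp (coords b x)].
  by move=> _ /mapP[w wf ->]; split=> //=; rewrite ltnS; apply: leq_bigmax_seq.
by rewrite big_map [LHS](coordsE bP).
Qed.

Lemma coords_unitri b c u w : is_basis b ->
  (forall w, tri b (-1) (ell w) (c w - b w)) -> (ell w <= ell u)%N ->
  coords b (c w) u = (u == w)%:R.
Proof.
move=> bP bc wu; rewrite -[c w](subrK (b w)) coordsD // coords_base //.
by rewrite (coords_tri u bP (bc w)).2 ?add0r.
Qed.

Lemma coords_unitri_deg b c u w : is_basis b ->
  (forall w, tri b (-1) (ell w) (c w - b w)) -> u <> w ->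
  ldeg_le (-1) (coords b (c w) u).
Proof.
move=> bP bc /eqP uw; rewrite -[c w](subrK (b w)) coordsD // coords_base //.
by rewrite (negbTE uw) addr0; have [] := coords_tri u bP (bc w).
Qed.

(** For independence, take an element of maximal length in the support: no other term contributes to
    its [c]-coordinate. *)
Lemma tri_is_basis b c : (forall w, tri b (-1) (ell w) (c w - b w)) ->
  is_basis c -> is_basis b.
Proof.
move=> bc cP; split=> [x|f f0 w].
  rewrite (coordsE cP x); apply: in_span_sum => w _; apply: in_spanZ.
  rewrite -[c w](subrK (b w)); apply: in_spanD; last exact: in_span_base.
  exact: tri_in_span (bc w).
have [//|/eqP fw0] := eqVneq (f w) 0.
have [u [fu umax]] := fsfun_max_supp ell (ex_intro _ w fw0).
have uf : u \in finsupp f by rewrite mem_finsupp; apply/eqP.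
case: fu; have := congr1 (fun x => coords c x u) f0.
have cb := tri_invert bc.
rewrite coords0 // coords_sum // (big_fsetD1 u) //= coordsZ //.
rewrite (coords_unitri cP cb) // eqxx mulr1 big_seq big1 ?addr0 // => z.
rewrite in_fsetD1 mem_finsupp => /andP[zu /eqP /umax zle].
by rewrite coordsZ // (coords_unitri cP cb) // eq_sym (negbTE zu) mulr0.
Qed.

End Triangular.

Section KazhdanLusztigBasis.
Variables (W : groupType) (S : set W) (L : W -> int) (H : hecke_algebra S L).
Variables (ell : W -> nat) (c : W -> H).
Hypothesis noB : no_braid S.
Hypothesis cP : is_basis c.
Hypothesis cbar : forall w, bar (c w) = c w.
Hypothesis ctri : forall w, tri ell (@Tb _ _ _ H) (-1) (ell w) (c w - Tb H w).

Lemma Tb_is_basis : is_basis (@Tb _ _ _ H).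
Proof. exact: tri_is_basis ctri cP. Qed.

Lemma coords_bar x w : coords c (bar x) w = lbar (coords c x w).
Proof.
have [fD _ _ _ [fZ _]] := barP H noB.
have bar0 : bar (0 : H) = 0.
  by apply: (@addrI _ (bar (0 : H))); rewrite -fD !addr0.
rewrite {1}(coordsE cP x) (big_morph (@bar _ _ _ H) fD bar0).
rewrite coords_sum //.
under eq_bigr => u _ do rewrite fZ cbar coordsZ // coords_base //.
have [wf|wf] := boolP (w \in finsupp (coords c x)); last first.
  rewrite [coords c x w]fsfun_dflt // rmorph0 big_seq big1 // => u uf.
  case: eqP => [E|_]; last by rewrite mulr0.
  by rewrite -E (negbTE wf) in uf.
rewrite (big_fsetD1 w) //= eqxx mulr1 big_seq big1 ?addr0 // => u.
by rewrite in_fsetD1 eq_sym => /andP[/negbTE -> _]; rewrite mulr0.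
Qed.

(** Passing from the T_w to [c] keeps all coordinates in v^-1 Z[v^-1], and in the basis [c] bar acts
    coordinatewise, so each coordinate vanishes by [bar_invariant_eq0]. *)
Lemma bar_invariant_lower x : bar x = x ->
  (forall w, ldeg_le (-1) (coords (@Tb _ _ _ H) x w)) -> x = 0.
Proof.
move=> xb hx; have [n hn] := tri_coords ell Tb_is_basis hx.
have {}hn : tri ell c (-1) n x.
  apply: tri_comp hn => w _; rewrite -[Tb H w](subrK (c w)).
  apply: triD; last exact: tri_base.
  exact: tri_weaken (tri_invert ctri w).
apply: (coords_eq0 cP) => w; apply: bar_invariant_eq0.
  by rewrite -coords_bar xb.
by have [] := coords_tri w cP hn.
Qed.

(** [c w] satisfies the defining conditions, so the choice in [cb] is never the default; any other
    solution differs from [c w] by an element excluded by [bar_invariant_lower]. *)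
Lemma cbE : @cb _ _ _ H = c.
Proof.
have TP := Tb_is_basis.
apply/funext => w; rewrite /cb; case: xgetP => [x -> [xb xw hx]|h]; last first.
  case: (h (c w)); split=> [//||y yw].
    by rewrite (coords_unitri TP ctri) ?eqxx.
  by apply/in_Zvinv_v; apply: coords_unitri_deg TP ctri _.
apply/eqP; rewrite -subr_eq0; apply/eqP; apply: bar_invariant_lower.
  have [fD _ _ _ [fZ _]] := barP H noB.
  rewrite fD -scaleN1r fZ cbar xb; congr (_ + _ *: _).
  by rewrite rmorphN rmorph1.
move=> u; rewrite coordsD // coordsN //.
have [->|/eqP uw] := eqVneq u w.
  by rewrite xw (coords_unitri TP ctri) // eqxx subrr; apply: ldeg_le0.
apply: ldeg_leD; first by apply/in_Zvinv_v; apply: hx.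
by apply: ldeg_leN; apply: coords_unitri_deg TP ctri _.
Qed.

(* Both transition matrices have entries in Z[v^-1], so degree bounds transfer. *)
Lemma bounded_of_hcoef (N : nat) :
  (forall x y z, ldeg_le N (hcoef H x y z)) -> bounded H.
Proof.
have TP := Tb_is_basis.
move=> hN; exists N => x y z; apply/in_Zvinv_mono; rewrite /fcoef.
have cT w : tri ell (@Tb _ _ _ H) 0 (ell w).+1 (c w).
  rewrite -[c w](subrK (Tb H w)); apply: triD; last exact: tri_base.
  exact: tri_weaken (ctri w).
have Tc w : tri ell c 0 (ell w).+1 (Tb H w).
  rewrite -[Tb H w](subrK (c w)); apply: triD; last exact: tri_base.
  exact: tri_weaken (tri_invert ctri w).
have cc u w : exists n, tri ell c N n (c u * c w).
  by apply: tri_coords => // t; have := hN u w t; rewrite /hcoef cbE.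
have [s hs ->] := Tc x; have [t ht ->] := Tc y.
rewrite mulr_suml coords_sum //; apply: ldeg_le_sum => i /hs[hi _] _.
rewrite mulr_sumr coords_sum //; apply: ldeg_le_sum => j /ht[hj _] _.
rewrite -scalerAl -scalerAr !coordsZ //.
have [n hn] := cc i.2 j.2.
rewrite -[N%:Z]add0r -[0 + N%:Z]add0r; do 2![apply: ldeg_leM => //].
have {}hn : tri ell (@Tb _ _ _ H) N n (c i.2 * c j.2) by apply: tri_comp hn.
by have [] := coords_tri z TP hn.
Qed.

End KazhdanLusztigBasis.

(** * Chebyshev polynomials *)

Section Chebyshev.
Variable R : comNzRingType.
Implicit Types (p q : {poly R}) (k m n : nat).

Fixpoint cheb_pair n : {poly R} * {poly R} :=
  if n is n'.+1 then let: (p, q) := cheb_pair n' in (q, 'X * q - p) else (1, 'X).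
Definition cheb n := (cheb_pair n).1.

Lemma cheb0 : cheb 0 = 1. Proof. by []. Qed.
Lemma cheb1 : cheb 1 = 'X. Proof. by []. Qed.

Lemma chebSS n : cheb n.+2 = 'X * cheb n.+1 - cheb n.
Proof. by rewrite /cheb /=; case: (cheb_pair n). Qed.

Definition cheb_pred n := if n is n'.+1 then cheb n' else 0.

Lemma mulX_cheb n : 'X * cheb n = cheb n.+1 + cheb_pred n.
Proof.
by case: n => [|n]; rewrite /= ?cheb0 ?mulr1 ?addr0 // chebSS subrK.
Qed.

(* [ucoef k p] is the coefficient of [p] on [cheb k] in the basis of the Chebyshev
   polynomials, and [ballot i k] that of ['X^i]. *)
Fixpoint ballot (i k : nat) : nat :=
  if i is i'.+1 then ballot i' k.+1 + (if k is k'.+1 then ballot i' k' else 0)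
  else (k == 0%N).

Definition ucoef k p : R := \sum_(i < size p) p`_i *+ ballot i k.

Lemma ucoef_widen N k p : (size p <= N)%N ->
  ucoef k p = \sum_(i < N) p`_i *+ ballot i k.
Proof.
move=> pN; rewrite /ucoef (big_ord_widen N (fun i => p`_i *+ ballot i k)) //.
rewrite big_mkcond; apply: eq_bigr => i _; case: ltnP => // pi.
by rewrite nth_default ?mul0rn.
Qed.

Lemma ucoef_is_linear k : linear_for *%R (ucoef k).
Proof.
move=> a p q; pose N := maxn (size (a *: p + q)) (maxn (size p) (size q)).
rewrite !(@ucoef_widen N) ?leq_max ?leqnn ?orbT //.
rewrite mulr_sumr -big_split; apply: eq_bigr => i _.
by rewrite coefD coefZ mulrnDl mulrnAr.
Qed.

HB.instance Definition _ k :=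
  GRing.isLinear.Build R {poly R} R *%R (ucoef k) (ucoef_is_linear k).

Lemma ucoefXM k p :
  ucoef k ('X * p) = ucoef k.+1 p + (if k is k'.+1 then ucoef k' p else 0).
Proof.
rewrite (@ucoef_widen (size p).+1); last first.
  by rewrite mulrC; have [->|p0] := eqVneq p 0; rewrite ?mul0r ?size_poly0 ?size_mulX.
rewrite big_ord_recl coefXM mul0rn add0r.
case: k => [|k]; rewrite ?addr0 /ucoef -?big_split; apply: eq_bigr => i _.
  by rewrite coefXM /= addn0.
by rewrite coefXM /= mulrnDr.
Qed.

Lemma ucoef_cheb k n : ucoef k (cheb n) = (k == n)%:R.
Proof.
elim: n {-2}n (leqnn n) k => [|N IH] n nN k.
  move: nN; rewrite leqn0 => /eqP ->.
  by rewrite /ucoef size_polyC oner_eq0 big_ord_recl big_ord0 coefC /= addr0.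
case: n nN => [|[|n]] nN; first exact: IH.
  by rewrite cheb1 -['X]mulr1 ucoefXM -cheb0 !IH //; case: k => [|k]; rewrite ?IH //= add0r.
rewrite chebSS linearB /= ucoefXM !IH //; last by rewrite ltnW.
case: k => [|k]; rewrite ?IH // !eqSS.
  by case: n nN => [|n] _; rewrite ?addr0 ?subrr ?subr0.
by rewrite addrAC subrr add0r.
Qed.

(** The induction runs over all products [p * cheb n] at once, so that a factor X of [p] can be
    passed on to [cheb n]. *)
Lemma cheb_ind (P : {poly R} -> Prop) : P 0 ->
  (forall a p q, P p -> P q -> P (a *: p + q)) -> (forall n, P (cheb n)) ->
  forall p, P p.
Proof.
move=> P0 PD PU p; rewrite -[p]mulr1 -cheb0; move: 0%N.
elim/poly_ind: p => [n|p c IH n]; first by rewrite mul0r.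
rewrite mulrDl -mulrA mulX_cheb mul_polyC addrC; apply: (PD) => //.
rewrite mulrDr -[p * _]scale1r; apply: (PD) => //.
by case: n => [|n] //=; rewrite mulr0.
Qed.

Lemma cheb_expansion p :
  exists N, forall M, (N <= M)%N -> p = \sum_(k < M) ucoef k p *: cheb k.
Proof.
elim/cheb_ind: p => [|a p q [N hN] [N' hN']|n].
- by exists 0%N => M _; rewrite big1 // => k _; rewrite linear0 scale0r.
- exists (maxn N N') => M; rewrite geq_max => /andP[/hN {1}-> /hN' {1}->].
  rewrite scaler_sumr -big_split; apply: eq_bigr => k _.
  by rewrite linearP /= scalerDl scalerA.
- exists n.+1 => M nM; rewrite (bigD1 (Ordinal nM)) //= ucoef_cheb eqxx scale1r.
  rewrite big1 ?addr0 // => k; rewrite -val_eqE /= => /negbTE kn.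
  by rewrite ucoef_cheb kn scale0r.
Qed.

(* The form (p, q) |-> ucoef 0 (p * q) makes the Chebyshev polynomials orthonormal. *)
Lemma ucoefE k p : ucoef k p = ucoef 0 (p * cheb k).
Proof.
elim: k {-2}k (leqnn k) p => [|K IH] k kK p.
  by move: kK; rewrite leqn0 => /eqP ->; rewrite cheb0 mulr1.
case: k kK => [|[|k]] kK; first exact: IH.
  by rewrite cheb1 mulrC ucoefXM addr0.
rewrite chebSS mulrBr linearB /= mulrA -!IH //; last by rewrite ltnW.
by rewrite mulrC ucoefXM addrK.
Qed.

Definition cheb_mult m n k : R := ucoef k (cheb m * cheb n).

(** By [ucoefE] both sides are [ucoef 0] of the product of the three Chebyshev polynomials. *)
Lemma cheb_mult_rot m n k : cheb_mult m n k = cheb_mult n k m.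
Proof. by rewrite /cheb_mult ucoefE [RHS]ucoefE; congr ucoef; ring. Qed.

Lemma cheb_mult0 m n : cheb_mult m n 0 = (m == n)%:R.
Proof. by rewrite -cheb_mult_rot /cheb_mult cheb0 mul1r ucoef_cheb eq_sym. Qed.

End Chebyshev.

Section ChebyshevMap.
Variables (R R' : comNzRingType) (f : {rmorphism R -> R'}).

(** The recursion has integer coefficients. This makes the structure constants integers over every
    ring and, for P15, lets v and v' share one Chebyshev basis. *)
Lemma map_cheb n : map_poly f (cheb R n) = cheb R' n.
Proof.
elim: n {-2}n (leqnn n) => [|N IH] [|[|n]] nN //; rewrite ?rmorph1 ?map_polyX //.
by rewrite !chebSS rmorphB rmorphM /= map_polyX !IH // ltnW.
Qed.

Lemma ucoef_map k (p : {poly R}) : ucoef k (map_poly f p) = f (ucoef k p).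
Proof.
rewrite (@ucoef_widen _ (size p)) ?size_poly // rmorph_sum.
by apply: eq_bigr => i _; rewrite coef_map rmorphMn.
Qed.

Lemma cheb_mult_map m n k : cheb_mult R' m n k = f (cheb_mult R m n k).
Proof. by rewrite /cheb_mult -!map_cheb -rmorphM ucoef_map. Qed.

End ChebyshevMap.

(** * Length and reduced words; the infinite dihedral group *)

Lemma minnatE (P : set nat) n : P n -> (forall m, P m -> (n <= m)%N) -> minnat P = n.
Proof.
move=> Pn nmin; rewrite /minnat; case: xgetP => [m -> [Pm mmin]|h].
  by apply/eqP; rewrite eqn_leq mmin //= nmin.
by case: (h n).
Qed.

Section LengthFunction.
Variables (W : groupType) (S : set W) (ell : W -> nat).
Hypothesis ell1 : ell 1%g = 0%N.
Hypothesis ellM : forall (s : S) w, (ell (val s * w)%g <= (ell w).+1)%N.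
Hypothesis ellV : forall w, w <> 1%g ->
  exists (s : S) (w' : W), w = (val s * w')%g /\ ell w = (ell w').+1.

Lemma ell_word (q : seq S) : (ell (word_prod q) <= size q)%N.
Proof.
elim: q => [|s q IH]; rewrite /word_prod ?big_nil ?ell1 // big_cons.
exact: leq_trans (ellM s _) _.
Qed.

Lemma ell_attained w : exists q : seq S, size q = ell w /\ word_prod q = w.
Proof.
elim: {w}(ell w) {-2}w (erefl (ell w)) => [|n IH] w wn.
  exists [::]; rewrite wn; split=> //; rewrite /word_prod big_nil.
  have [->//|/eqP w1] := eqVneq w 1%g.
  by have [s [w' [_]]] := ellV w1; rewrite wn.
have [s [w' [wE]]] : exists (s : S) w', w = (val s * w')%g /\ ell w = (ell w').+1.
  by apply: ellV => w1; rewrite w1 ell1 in wn.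
rewrite wn => -[w'n]; have [q [qn qE]] := IH w' (esym w'n).
exists (s :: q); split; first by rewrite /= qn w'n.
by rewrite /word_prod big_cons wE -qE.
Qed.

Lemma lengthE w : length S w = ell w.
Proof.
by apply: minnatE => [|m [q [<- <-]]]; [exact: ell_attained | exact: ell_word].
Qed.

Lemma reduced_wordP w :
  word_prod (reduced_word S w) = w /\ size (reduced_word S w) = ell w.
Proof.
rewrite /reduced_word; case: xgetP => [q -> []|h]; first by rewrite lengthE.
by have [q [qn qE]] := ell_attained w; case: (h q); rewrite /= lengthE.
Qed.

(** Every suffix of a reduced word is reduced, so the product rule applies letter by letter,
    whichever reduced word was chosen in [Tb]. *)
Lemma Tb_charact (L : W -> int) (H : hecke_algebra S L) (T' : W -> H) :
  T' 1%g = 1 ->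
  (forall (s : S) w, ell (val s * w)%g = (ell w).+1 ->
     T' (val s * w)%g = hecke_gen H s * T' w) ->
  @Tb _ _ _ H = T'.
Proof.
move=> T1 TM; apply/funext => w; rewrite /Tb.
have [] := reduced_wordP w; move: (reduced_word S w) => q wE.
rewrite -{w}wE; elim: q => [|s q IH].
  by rewrite /word_prod !big_nil T1.
rewrite /word_prod !big_cons /= -/(word_prod q) => qn.
have E : size q = ell (word_prod q).
  apply/eqP; rewrite eqn_leq ell_word andbT -ltnS qn.
  exact: ellM.
by rewrite TM -?qn ?E // IH.
Qed.

End LengthFunction.

(** [Mid a n b] stands for s1^a (s2 s1)^n s2 s1^b, the normal form of the elements other than 1 and
    s1. *)
Inductive dihedral_index := One | Sgl | Mid of bool & nat & bool.

Definition idx_code i : option (option (bool * nat * bool)) :=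
  match i with One => None | Sgl => Some None | Mid a n b => Some (Some (a, n, b)) end.
Definition idx_decode (x : option (option (bool * nat * bool))) :=
  match x with None => One | Some None => Sgl | Some (Some (a, n, b)) => Mid a n b end.
Lemma idx_codeK : cancel idx_code idx_decode. Proof. by case. Qed.
HB.instance Definition _ := Equality.copy dihedral_index (can_type idx_codeK).
HB.instance Definition _ := Choice.copy dihedral_index (can_type idx_codeK).

Definition idx_len i : nat :=
  match i with One => 0 | Sgl => 1 | Mid a n b => a + n.*2.+1 + b end.

Definition idx_inv i :=
  match i with Mid a n b => Mid b n a | _ => i end.

(* Left multiplication by [s1] ([false]) or [s2] ([true]). *)
Definition idx_mul (g : bool) i :=
  match g, i with
  | false, One => Sgl
  | false, Sgl => One
  | false, Mid a n b => Mid (~~ a) n b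
  | true, One => Mid false 0 false
  | true, Sgl => Mid false 0 true
  | true, Mid true n b => Mid false n.+1 b
  | true, Mid false n.+1 b => Mid true n b
  | true, Mid false 0 b => if b then Sgl else One
  end.

Lemma idx_mulK g : involutive (idx_mul g).
Proof. by case: g => -[||[] [|n] []]. Qed.

Lemma idx_len_mul g i : idx_len (idx_mul g i) = (idx_len i).+1 \/
  idx_len i = (idx_len (idx_mul g i)).+1.
Proof. by case: g; case: i => [||[] [|n] []] /=; (left; lia) || (right; lia). Qed.

Lemma idx_descent i : i != One ->
  exists g, idx_len i = (idx_len (idx_mul g i)).+1.
Proof.
case: i => [||[] [|m] b] // _; do ?[by exists false => /=; lia].
  by exists true; case: b => /=; lia.
by exists true => /=; lia.
Qed.

Section DihedralGroup.
Variables (W : groupType) (s1 s2 : W) (S : set W).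
Hypothesis hS : S = [set s1; s2].
Hypothesis hW : infinite_dihedral s1 s2.
Local Open Scope group_scope.

Let s11 : s1 * s1 = 1. Proof. by case: hW. Qed.
Let s22 : s2 * s2 = 1. Proof. by case: hW. Qed.

Definition sgen (g : bool) : W := if g then s2 else s1.

Definition idx_val i : W :=
  match i with
  | One => 1
  | Sgl => s1
  | Mid a n b => s1 ^+ a * ((s2 * s1) ^+ n * (s2 * s1 ^+ b))
  end.

Lemma idx_val_mul g i : idx_val (idx_mul g i) = sgen g * idx_val i.
Proof.
case: g; case: i => [||a n b] //=; rewrite /sgen ?expgb ?expg0 ?mul1g ?mulg1 //.
- case: a; case: n => [|n]; rewrite ?expgb ?expg0 ?mul1g ?expgS ?mulgA ?s22 ?mul1g //.
  + by rewrite /= !expgb mul1g expg1 !mulgA.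
  + by rewrite /= !expgb mul1g !expgS !mulgA.
  + by case: b; rewrite /= ?mulg1.
  + by rewrite /= !expgb !mulgA.
- by case: a; rewrite /= ?mul1g // [RHS]mulgA s11 mul1g.
Qed.

Lemma order_s12 k : (s1 * s2) ^+ k = 1 -> k = 0%N.
Proof.
have [_ _ _ hr] := hW; case: k => // k rk; exfalso.
have ex : exists m, (0 < m)%N && ((s1 * s2) ^+ m == 1).
  by exists k.+1; rewrite rk eqxx.
have [m /andP[m0 /eqP rm] mmin] := ex_minnP ex.
apply: (hr m); split=> // j /andP[j0 jm] rj.
by have := mmin j; rewrite j0 rj eqxx leqNgt jm => /(_ isT).
Qed.

Lemma order_s21 k : (s2 * s1) ^+ k = 1 -> k = 0%N.
Proof.
have -> : s2 * s1 = (s1 * s2)^-1.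
  by apply/esym/mulg1_eq; rewrite mulgA -(mulgA s1) s22 mulg1 s11.
by rewrite expVgn => /eqP; rewrite invg_eq1 => /eqP /order_s12.
Qed.

(** Conjugation by s1 reduces the equation to (s2 s1)^n s2 s1^c = 1. For c = 1 this is a power of s2
    s1; for c = 0 it makes s2 commute with s2 s1, whose square is then 1. *)
Lemma idx_val_eq1 i : idx_val i = 1 -> i = One.
Proof.
case: i => [||a n b] //= h.
  have := @order_s12 2; rewrite h mul1g expgS expg1 s22 => /(_ erefl).
  by [].
have {}h : (s2 * s1) ^+ n * (s2 * s1 ^+ (a (+) b)) = 1.
  move: h; rewrite !expgb; case: a; case: b; rewrite /= ?mul1g ?mulg1 //.
    move=> h; have := congr1 (fun x => s1 * x * s1) h.
    by rewrite /= mulg1 s11 !mulgA s11 mul1g -!mulgA s11 mulg1.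
  move=> h; have := congr1 (fun x => s1 * x * s1) h.
  by rewrite /= mulg1 s11 !mulgA s11 mul1g -!mulgA.
move: h; rewrite expgb; case: (a (+) b) => /=.
  by rewrite -expgSr => /order_s21.
rewrite mulg1 => h; set u := s2 * s1 in h.
have E2 : s2 = (u ^+ n)^-1 by apply/esym/mulg1_eq.
have cu : u * s2 = s2 * u.
  by rewrite E2; apply/commuteV/commuteX/commute_refl.
have := @order_s21 2; rewrite expgS expg1 -/u {1}/u -mulgA.
have e1 : s2 * s1 * s2 = s1 by rewrite -/u cu /u mulgA s22 mul1g.
have -> : s1 * u = s2.
  by rewrite -{1}e1 /u -!mulgA (mulgA s2 s2) s22 mul1g s11 mulg1.
by rewrite s22 => /(_ erefl).
Qed.

Lemma idx_val_inj : injective idx_val.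
Proof.
move=> i; elim: {i}(idx_len i) {-2}i (leqnn (idx_len i)) => [|n IH] i ilen j E.
  by case: i ilen E => [||[] ? []] // _ /esym/idx_val_eq1.
have [i1|] := eqVneq i One; first by move: E; rewrite i1 => /esym/idx_val_eq1.
move=> /idx_descent[g ig].
rewrite -(idx_mulK g i) -(idx_mulK g j); congr idx_mul; apply: IH.
  by rewrite -ltnS -ig.
by rewrite !idx_val_mul E.
Qed.

Lemma idx_val_inv i : idx_val (idx_inv i) = (idx_val i)^-1.
Proof.
have s1V : s1^-1 = s1 by apply: mulg1_eq.
have s2V : s2^-1 = s2 by apply: mulg1_eq.
case: i => [||a n b] /=; rewrite ?invg1 //.
rewrite !expgb !invgM -!expVgn !invgM s1V s2V.
have -> : (if b then s1 else 1)^-1 = (if b then s1 else 1) by case: b; rewrite ?invg1.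
have -> : (if a then s1 else 1)^-1 = (if a then s1 else 1) by case: a; rewrite ?invg1.
rewrite -!mulgA; congr (_ * _); rewrite !mulgA; congr (_ * _).
elim: n => [|n IH]; first by rewrite !expg0 mul1g mulg1.
by rewrite expgS -mulgA IH expgS !mulgA.
Qed.

Lemma idx_val_surj w : exists i, idx_val i = w.
Proof.
have [_ _ gW _] := hW; pose P : {pred W} := fun w => `[< exists i, idx_val i = w >].
have PM g w' : w' \in P -> sgen g * w' \in P.
  by move=> /asboolP[i <-]; apply/asboolP; exists (idx_mul g i); rewrite idx_val_mul.
have PMi i w' : w' \in P -> idx_val i * w' \in P.
  move=> Pw'; elim: {i}(idx_len i) {-2}i (leqnn (idx_len i)) => [|n IH] i ilen.
    by case: i ilen => [||[] ? []]; rewrite //= mul1g.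
  have [->|/idx_descent[g ig]] := eqVneq i One; first by rewrite mul1g.
  rewrite -(idx_mulK g i) idx_val_mul -mulgA; apply/PM/IH.
  by rewrite -ltnS -ig.
have Pgrp : group_closed P.
  split; first by apply/asboolP; exists One.
  move=> x y /asboolP[i <-] /asboolP[j <-].
  by rewrite -idx_val_inv; apply: PMi; apply/asboolP; exists (idx_inv j).
have /asboolP := gW w; move=> /(_ P Pgrp) h; apply/asboolP; apply: h.
by move=> s [->|->]; apply/asboolP; [exists Sgl | exists (Mid false 0 false)];
  rewrite /= ?mul1g ?mulg1.
Qed.

Definition idx_of (w : W) : dihedral_index := xget One [set i | idx_val i = w].

Lemma idx_ofK w : idx_val (idx_of w) = w.
Proof. by rewrite /idx_of; case: xgetP => [i -> //|h]; have [i /h] := idx_val_surj w. Qed.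

Lemma idx_valK i : idx_of (idx_val i) = i.
Proof. exact/idx_val_inj/idx_ofK. Qed.


Lemma sgenP g : S (sgen g).
Proof. by rewrite hS; case: g; [right|left]. Qed.

Definition gen_of g : S := SigSub (mem_set (sgenP g)).

Lemma val_gen_of g : val (gen_of g) = sgen g. Proof. by []. Qed.

Lemma gen_ofP (s : S) : exists g, s = gen_of g.
Proof.
have [sE|sE] : [set s1; s2]%classic (val s).
  by have := set_mem (valP s); rewrite [X in X _ -> _]hS.
  by exists false; apply: val_inj.
by exists true; apply: val_inj.
Qed.

Lemma idx_of_mul g w : idx_of (sgen g * w) = idx_mul g (idx_of w).
Proof. by rewrite -[in LHS](idx_ofK w) -idx_val_mul idx_valK. Qed.

Lemma idx_of1 : idx_of 1 = One. Proof. exact: (idx_valK One). Qed.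

Lemma idx_of_inv w : idx_of w^-1 = idx_inv (idx_of w).
Proof. by rewrite -[in LHS](idx_ofK w) -idx_val_inv idx_valK. Qed.

Definition dih_len w := idx_len (idx_of w).

Lemma dih_len1 : dih_len 1 = 0%N. Proof. by rewrite /dih_len idx_of1. Qed.

Lemma dih_lenM (s : S) w : (dih_len (val s * w) <= (dih_len w).+1)%N.
Proof.
have [g ->] := gen_ofP s; rewrite /dih_len idx_of_mul.
by case: (idx_len_mul g (idx_of w)) => ->; lia.
Qed.

Lemma dih_lenV w : w <> 1 ->
  exists (s : S) (w' : W), w = val s * w' /\ dih_len w = (dih_len w').+1.
Proof.
move=> w1; have /idx_descent[g ig] : idx_of w != One.
  by apply/eqP => E; case: w1; rewrite -(idx_ofK w) E.
exists (gen_of g), (sgen g * w); rewrite /dih_len idx_of_mul; split=> //.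
by rewrite -{1}(idx_ofK w) -(idx_mulK g (idx_of w)) idx_val_mul idx_val_mul idx_ofK.
Qed.

Lemma dihedral_no_braid : no_braid S.
Proof.
move=> s s' m; have [g ->] := gen_ofP s; have [g' ->] := gen_ofP s'.
rewrite !val_gen_of; case: g; case: g' => // _ [m0 rm _].
  by rewrite (order_s21 rm) in m0.
by rewrite (order_s12 rm) in m0.
Qed.

End DihedralGroup.

(** * The Kazhdan-Lusztig basis of the infinite dihedral group *)

Fact lock_key : unit. Proof. by []. Qed.

Section DihedralHecke.
Variables (W : groupType) (s1 s2 : W) (S : set W) (L : W -> int).
Hypothesis hS : S = [set s1; s2].
Hypothesis hW : infinite_dihedral s1 s2.
Variable H : hecke_algebra S L.

Local Notation sg := (sgen s1 s2).
Local Notation idx := (idx_of s1 s2).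
Local Notation gS := (gen_of hS).

Definition xi g : Zv := 'v^(L (sg g)) + 'v^(- L (sg g)).
(** In c_{s2} c_{s1} c_{s2}, the summand v^-L(s1) of c_{s1} yields v^-L(s1) (v^L(s2) + v^-L(s2))
    c_{s2}; [zeta] is the bar-invariant element that removes the positive power v^(L(s2)-L(s1)) from
    it. *)
Definition zeta : Zv := 'v^(L s2 - L s1) + 'v^(L s1 - L s2).

Definition Cgen g : H :=
  locked_with lock_key (hecke_gen H (gS g) + ('v^(- L (sg g)))%:A).

Lemma CgenE g : Cgen g = hecke_gen H (gS g) + ('v^(- L (sg g)))%:A.
Proof. by rewrite /Cgen unlock. Qed.

Local Notation C1 := (Cgen false).
Local Notation C2 := (Cgen true).


Lemma Tgen_sqr g : hecke_gen H (gS g) * hecke_gen H (gS g) =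
  1 + ('v^(L (sg g)) - 'v^(- L (sg g))) *: hecke_gen H (gS g).
Proof. exact: hecke_quadratic. Qed.

Lemma Tgen_mul_Cgen g : hecke_gen H (gS g) * Cgen g = 'v^(L (sg g)) *: Cgen g.
Proof.
have /eqP := (hecke_gen_rel H).1 (gS g); rewrite val_gen_of mulrBl subr_eq0.
by rewrite CgenE => /eqP ->; rewrite -scalerAl mul1r.
Qed.

Lemma Cgen_sqr g : Cgen g * Cgen g = xi g *: Cgen g.
Proof.
rewrite {1}CgenE mulrDl Tgen_mul_Cgen -scalerAl mul1r.
by rewrite -scalerDl.
Qed.

Definition theta : {rmorphism {poly Zv} -> H} :=
  locked_with lock_key (horner_alg (C2 * C1 - zeta%:A) : {rmorphism {poly Zv} -> H}).

Lemma thetaC k : theta k%:P = k%:A.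
Proof. by rewrite /theta unlock; apply: horner_algC. Qed.

Lemma thetaX : theta 'X = C2 * C1 - zeta%:A.
Proof. by rewrite /theta unlock; apply: horner_algX. Qed.

Lemma thetaZ k F : theta (k *: F) = k *: theta F.
Proof. by rewrite -mul_polyC rmorphM /= thetaC -scalerAl mul1r. Qed.

Definition cheb_shift : {poly Zv} := 'X + zeta%:P.
Local Notation Y := cheb_shift.

Lemma theta_shift : theta Y = C2 * C1.
Proof. by rewrite rmorphD /= thetaC thetaX subrK. Qed.

Lemma theta_shiftM F x : C2 * (C1 * (theta F * x)) = theta (Y * F) * x.
Proof. by rewrite rmorphM /= theta_shift !mulrA. Qed.

(** A positive power of c_{s2} c_{s1} begins with c_{s2}, and so does the final factor; on such
    products c_{s2} acts by its eigenvalue. Trading X for [Y] minus [zeta] brings [F] into this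
    form. *)
Lemma C2_theta F : C2 * (theta F * C2) = xi true *: (theta F * C2).
Proof.
elim/poly_ind: F => [|F c IH]; first by rewrite rmorph0 mul0r mulr0 scaler0.
have -> : F * 'X + c%:P = Y * F + (c%:P - zeta%:P * F).
  by rewrite /cheb_shift; ring.
rewrite rmorphD /= mulrDl mulrDr scalerDr; congr (_ + _).
  by rewrite -theta_shiftM mulrA Cgen_sqr -scalerAl.
rewrite rmorphB /= mulrBl mulrBr scalerBr !mul_polyC.
rewrite thetaC !thetaZ -!scalerAl -!scalerAr mul1r.
by rewrite Cgen_sqr IH !scalerA; congr (_ - _ *: _); rewrite mulrC.
Qed.

(* [mid a F b] stands for c_{s1}^a F(X) c_{s2} c_{s1}^b with
   X = c_{s2} c_{s1} - zeta; the Kazhdan-Lusztig elements of W other than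
   c_1 and c_{s1} are the [mid a (cheb n) b]. *)
Definition mid (a : bool) F (b : bool) : H := C1 ^+ a * (theta F * C2) * C1 ^+ b.

Lemma mid_linear a b k F G :
  mid a (k *: F + G) b = k *: mid a F b + mid a G b.
Proof.
rewrite /mid rmorphD /= thetaZ mulrDl mulrDr mulrDl.
by rewrite -!scalerAl -scalerAr -scalerAl.
Qed.

Lemma midD a b F G : mid a (F + G) b = mid a F b + mid a G b.
Proof. by have := mid_linear a b 1 F G; rewrite !scale1r. Qed.

Lemma mid0 a b : mid a 0 b = 0.
Proof. by rewrite /mid rmorph0 mul0r mulr0 mul0r. Qed.

Lemma midZ a b k F : mid a (k *: F) b = k *: mid a F b.
Proof. by have := mid_linear a b k F 0; rewrite mid0 !addr0. Qed.

Definition xi1_pow (a : bool) : Zv := if a then xi false else 1.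

Lemma C1_mid a F b : C1 * mid a F b = xi1_pow a *: mid true F b.
Proof.
rewrite /mid /xi1_pow !mulrA; case: a; rewrite /= ?expr1 ?expr0 ?mulr1 ?scale1r //.
by rewrite Cgen_sqr -!scalerAl.
Qed.

Lemma mid_C1 a F b : mid a F b * C1 = xi1_pow b *: mid a F true.
Proof.
rewrite /mid /xi1_pow -!mulrA; case: b; rewrite /= ?expr1 ?expr0 ?mul1r ?scale1r //.
by rewrite Cgen_sqr -!scalerAr.
Qed.

Lemma C2_mid a F b :
  C2 * mid a F b = mid false ((if a then Y else (xi true)%:P) * F) b.
Proof.
rewrite /mid; case: a; rewrite /= ?expr1 ?expr0 ?mul1r !mulrA.
  by rewrite -!mulrA -theta_shiftM !mulrA.
by rewrite -[C2 * theta F * C2]mulrA C2_theta mul_polyC thetaZ -!scalerAl.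
Qed.

Definition sandwich (b a' : bool) : {poly Zv} :=
  match b, a' with
  | false, false => (xi true)%:P
  | true, true => xi false *: Y
  | _, _ => Y
  end.

Lemma theta_mid (a : bool) F G b : C1 ^+ a * (theta F * mid false G b) = mid a (F * G) b.
Proof. by rewrite /mid expr0 mul1r rmorphM !mulrA. Qed.

Lemma midM a F b a' G b' :
  mid a F b * mid a' G b' = mid a (F * G * sandwich b a') b'.
Proof.
rewrite {1}/mid -[C1 ^+ a * _ * _ * _]mulrA.
(* The adjacent powers of c_{s1} merge into at most one, with a factor [xi false] when both are
   present. *)
have -> : C1 ^+ b * mid a' G b' =
    (if b && a' then xi false else 1) *: mid (b || a') G b'.
  case: b; rewrite /= ?expr1 ?expr0 ?mul1r ?scale1r // C1_mid /xi1_pow.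
  by case: a'.
rewrite -scalerAr -[C1 ^+ a * _ * _]mulrA -[theta F * C2 * _]mulrA C2_mid.
rewrite theta_mid -midZ; congr mid.
by rewrite /sandwich -!mul_polyC; case: b; case: a' => /=; ring.
Qed.

Lemma mid_in_ind (P : H -> Prop) : P 0 ->
  (forall k x y, P x -> P y -> P (k *: x + y)) ->
  (forall a n b, P (mid a (cheb Zv n) b)) -> forall a F b, P (mid a F b).
Proof.
move=> P0 PD PU a F b; elim/cheb_ind: F => [|k F G PF PG|n] //.
  by rewrite mid0.
by rewrite mid_linear; apply: PD.
Qed.

Definition cidx i : H :=
  match i with One => 1 | Sgl => C1 | Mid a n b => mid a (cheb Zv n) b end.

Definition cdih (w : W) : H := cidx (idx w).

Lemma cdih_val i : cdih (idx_val s1 s2 i) = cidx i.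
Proof. by rewrite /cdih (idx_valK hW). Qed.

Lemma cidx_in_span i : in_span cdih (cidx i).
Proof. by rewrite -cdih_val; apply: in_span_base. Qed.

Lemma mid_in_span a F b : in_span cdih (mid a F b).
Proof.
apply: mid_in_ind => [|k x y hx hy|a' n b']; first exact: in_span0.
  exact: in_span_linear.
exact: (cidx_in_span (Mid a' n b')).
Qed.

Lemma C2_mid1 : C2 = mid false 1 false.
Proof. by rewrite /mid !expr0 rmorph1 mul1r mulr1 mul1r. Qed.

(** The span contains 1 and is stable under left multiplication by c_{s1} and c_{s2}, hence by the
    whole algebra. *)
Lemma cdih_span x : in_span cdih x.
Proof.
suff h : forall y, in_span cdih y -> in_span cdih (x * y).
  by rewrite -[x]mulr1; apply: h; apply: (cidx_in_span One).
elim/hecke_ind: x => [|a x x' hx hx'|x x' hx hx'|s] y hy.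
- by rewrite mul1r.
- by rewrite mulrDl -scalerAl; apply: in_span_linear; [apply: hx|apply: hx'].
- by rewrite -mulrA; apply/hx/hx'.
have [g ->] := gen_ofP hS s.
have -> : hecke_gen H (gS g) = Cgen g - ('v^(- L (sg g)))%:A by rewrite CgenE addrK.
rewrite mulrBl addrC -scalerAl mul1r -scaleNr; apply: in_span_linear => //.
have [f ->] := hy; rewrite mulr_sumr; apply: in_span_sum => w _.
rewrite -scalerAr; apply: in_spanZ; rewrite /cdih.
case: (idx w) => [||a n b]; case: g; rewrite ?mulr1.
- by rewrite C2_mid1; apply: mid_in_span.
- exact: (cidx_in_span Sgl).
- have -> : C2 * C1 = mid false 1 true by rewrite /mid expr0 expr1 rmorph1 !mul1r.
  exact: mid_in_span.
- by rewrite Cgen_sqr; apply/in_spanZ/(cidx_in_span Sgl).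
- by rewrite C2_mid; apply: mid_in_span.
- by rewrite C1_mid; apply/in_spanZ/mid_in_span.
Qed.

End DihedralHecke.

(** It allows a representation to be prescribed by the images of the c_s: lowering such an image by
    v^-L(s) gives a solution of the quadratic relation. *)
Lemma shifted_quadratic (R : comNzRingType) (A : algType R) (p q : R) (x : A) :
  x * x = (q + p) *: x -> (x - p%:A - q%:A) * (x - p%:A + p%:A) = 0.
Proof.
move=> xx; rewrite subrK !mulrBl -!scalerAl !mul1r xx -!scalerBl.
by rewrite addrK subrr scale0r.
Qed.

(** * Linear independence by a representation of rank six *)

Section DihedralBasis.
Variables (W : groupType) (s1 s2 : W) (S : set W) (L : W -> int).
Hypothesis hS : S = [set s1; s2].
Hypothesis hW : infinite_dihedral s1 s2.
Variable H : hecke_algebra S L.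

Local Notation sg := (sgen s1 s2).
Local Notation idx := (idx_of s1 s2).
Local Notation gS := (gen_of hS).
Local Notation xi := (xi s1 s2 L).
Local Notation Y := (cheb_shift s1 s2 L).
Local Notation Cgen := (Cgen hS H).
Local Notation C1 := (Cgen false).
Local Notation C2 := (Cgen true).
Local Notation theta := (theta hS H).
Local Notation mid := (mid hS H).
Local Notation cdih := (cdih hS H).
Local Notation cidx := (cidx hS H).

Let noB : no_braid S := dihedral_no_braid hS hW.

(* The left regular representation in the basis of Kazhdan-Lusztig elements,
   the six coordinates standing for 1, c_{s1} and the four families [mid a _ b]. *)
Definition rep_entry (g : bool) (i j : nat) : {poly Zv} :=
  match g, i, j with
  | false, 1, 0 | false, 3, 2 | false, 5, 4 => 1%R
  | false, 1, 1 | false, 3, 3 | false, 5, 5 => ((xi false)%:P)%R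
  | true, 2, 0 | true, 4, 1 => 1%R
  | true, 2, 2 | true, 4, 4 => ((xi true)%:P)%R
  | true, 2, 3 | true, 4, 5 => Y
  | _, _, _ => 0%R
  end%N.

Definition rep_mx g : 'M[{poly Zv}]_6 := \matrix_(i, j) rep_entry g i j.

Lemma rep_mx_sqr g : rep_mx g * rep_mx g = (xi g)%:P *: rep_mx g.
Proof.
apply/matrixP => i j; rewrite !mxE !big_ord_recl big_ord0 !mxE.
case: g; case: i => [[|[|[|[|[|[|i]]]]]] hi] //;
  case: j => [[|[|[|[|[|[|j]]]]]] hj] //; rewrite /rep_entry /=; ring.
Qed.

Local Notation B := (restr_scalars (@polyC Zv) 'M[{poly Zv}]_6).

Definition rep_gen (s : S) : B :=
  (rep_mx (val s == s2) : B) - ('v^(- L (val s)))%:A.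

Lemma rep_gen_of g : rep_gen (gS g) = (rep_mx g : B) - ('v^(- L (sg g)))%:A.
Proof.
rewrite /rep_gen val_gen_of; congr (rep_mx _ - _); case: g; first exact: eqxx.
apply/eqP => E; have [s11 _ _ _] := hW.
by have := @order_s12 _ _ _ hW 1; rewrite expg1 -E s11 => /(_ erefl).
Qed.

Lemma rep_gen_rel : hecke_relations L rep_gen.
Proof.
split; last first.
  move=> s s' m ss' om.
  by case: (noB ss' om).
move=> s.
have [g ->] := gen_ofP hS s; rewrite rep_gen_of val_gen_of.
by apply: shifted_quadratic; apply: rep_mx_sqr.
Qed.

(** Let x act on the basis vector standing for 1: the resulting first column lists the polynomials
    in front of the six families. The dual forms pick an entry of it and then a Chebyshev
    coefficient of that entry. *)
Lemma cdih_is_basis : is_basis cdih.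
Proof.
have [f fT] := hecke_lift H rep_gen_rel.
have fC g : f (Cgen g) = rep_mx g.
  rewrite CgenE rmorphD /= fT rep_gen_of rmorph_alg.
  exact: subrK.
pose ev x (i : nat) : {poly Zv} := (f x : 'M[{poly Zv}]_6) (inord i) 0.
have evP k x y i : ev (k *: x + y) i = k *: ev x i + ev y i.
  by rewrite /ev linearP mxE; congr (_ + _); rewrite mxE mul_polyC.
have evM g x i : (i < 6)%N ->
    ev (Cgen g * x) i = \sum_(j < 6) rep_entry g i j * ev x j.
  move=> i6; rewrite /ev rmorphM /= fC mxE; apply: eq_bigr => j _.
  by rewrite mxE inord_val inordK.
have ev1 i : (i < 6)%N -> ev 1 i = (i == 0)%N%:R.
  by move=> i6; rewrite /ev rmorph1 mxE -val_eqE /= inordK.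
have evC1 x : [/\ ev (C1 * x) 0 = 0, ev (C1 * x) 1 = ev x 0 + (xi false)%:P * ev x 1,
    ev (C1 * x) 2 = 0 & ev (C1 * x) 4 = 0] /\
    ev (C1 * x) 3 = ev x 2 + (xi false)%:P * ev x 3 /\
    ev (C1 * x) 5 = ev x 4 + (xi false)%:P * ev x 5.
  by do ![split]; rewrite evM // !big_ord_recl big_ord0 /rep_entry /=; ring.
have evC2 x : [/\ ev (C2 * x) 0 = 0, ev (C2 * x) 1 = 0, ev (C2 * x) 3 = 0
      & ev (C2 * x) 5 = 0] /\
    ev (C2 * x) 2 = ev x 0 + (xi true)%:P * ev x 2 + Y * ev x 3 /\
    ev (C2 * x) 4 = ev x 1 + (xi true)%:P * ev x 4 + Y * ev x 5.
  by do ![split]; rewrite evM // !big_ord_recl big_ord0 /rep_entry /=; ring.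
(* Such a column lives in the rows of [mid false _ false] and [mid false _ true]. There c_{s2}
   c_{s1} acts as multiplication by [Y], so [theta F] acts as multiplication by [F]. *)
pose Z x := [/\ ev x 0 = 0, ev x 1 = 0, ev x 3 = 0 & ev x 5 = 0].
have evtheta F x : Z x -> forall i, (i < 6)%N -> ev (theta F * x) i = F * ev x i.
  elim/poly_ind: F x => [|F c IH] x Zx i i6.
    by rewrite rmorph0 !mul0r -[0]addr0 -[X in X + 0](scale0r 0) evP scale0r add0r /ev rmorph0 mxE.
  have thE : theta (F * 'X + c%:P) * x =
      1 *: (theta F * (C2 * (C1 * x) - zeta s1 s2 L *: x)) + (c *: x + 0).
    rewrite rmorphD rmorphM /= thetaX thetaC mulrDl -mulrA mulrBl -[C2 * C1 * x]mulrA.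
    by rewrite -!scalerAl !mul1r scale1r addr0.
  have ev0 : ev 0 i = 0 by rewrite /ev rmorph0 mxE.
  have evX j : (j < 6)%N -> ev (C2 * (C1 * x) - zeta s1 s2 L *: x) j = 'X * ev x j.
    move=> j6; rewrite addrC -scaleNr evP.
    have [[x0 x1 x3 x5] [[d0 d1 d3 d5] [d2 d4]]] := (Zx, evC2 (C1 * x)).
    have [[c0 c1 c2 c4] [c3 c5]] := evC1 x.
    case: j j6 => [|[|[|[|[|[|j]]]]]] // _; rewrite ?x0 ?x1 ?x3 ?x5 ?d0 ?d1 ?d3 ?d5
      ?scaler0 ?mulr0 ?addr0 // ?d2 ?d4 ?c0 ?c1 ?c2 ?c4 ?c3 ?c5 ?x0 ?x1 ?x3 ?x5;
      rewrite /cheb_shift -mul_polyC polyCN; ring.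
  rewrite thE evP IH //.
    by rewrite evP ev0 evX // scale1r addr0 -mul_polyC; ring.
  by case: Zx => x0 x1 x3 x5; split; rewrite evX // ?x0 ?x1 ?x3 ?x5 mulr0.
have evC2C1b (b : bool) : Z (C2 * C1 ^+ b) /\ ev (C2 * C1 ^+ b) 2 = (~~ b)%:R
    /\ ev (C2 * C1 ^+ b) 4 = b%:R.
  have [[d0 d1 d3 d5] [d2 d4]] := evC2 (C1 ^+ b).
  split; first by split.
  rewrite d2 d4; case: b {d0 d1 d3 d5 d2 d4}; rewrite ?expr0 ?expr1.
    have [[c0 c1 c2 c4] [c3 c5]] := evC1 1.
    by rewrite -[C1]mulr1 c0 c1 c2 c3 c4 c5 !ev1 //=; split; ring.
  by rewrite !ev1 //=; split; ring.
have evmid (a : bool) F (b : bool) i : (i < 6)%N ->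
    ev (mid a F b) i = if i == (a + b.*2).+2 then F else 0.
  rewrite /mid -!mulrA; have [[x0 x1 x3 x5] [x2 x4]] := evC2C1b b.
  set x := C2 * _ in x0 x1 x3 x5 x2 x4 *.
  have eF : forall i, (i < 6)%N -> ev (theta F * x) i = F * ev x i by apply: evtheta; split.
  have [[c0 c1 c2 c4] [c3 c5]] := evC1 (theta F * x).
  case: i => [|[|[|[|[|[|i]]]]]] // _; case: a; rewrite ?expr0 ?expr1 ?mul1r
    ?c0 ?c1 ?c2 ?c4 ?c3 ?c5 ?eF // ?x0 ?x1 ?x3 ?x5 ?x2 ?x4;
  by case: (b); rewrite /= ?mulr0 ?mulr1 ?addr0.
pose phi w x := match idx w with
  | One => ucoef 0 (ev x 0) | Sgl => ucoef 0 (ev x 1)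
  | Mid a n b => ucoef n (ev x (a + b.*2).+2) end.
apply: (@dual_is_basis _ _ _ _ phi) => [w k x y|x|w u].
- by rewrite /phi; case: (idx w) => [||a n b]; rewrite evP linearP.
- exact: cdih_span.
have -> : (w == u) = (idx w == idx u).
  by apply/eqP/eqP => [->//|E]; rewrite -(idx_ofK hW w) E idx_ofK.
have evC1_1 i : (i < 6)%N -> ev C1 i = (i == 1)%N%:R.
  have [[c0 c1 c2 c4] [c3 c5]] := evC1 1.
  by rewrite -[C1]mulr1; case: i => [|[|[|[|[|[|i]]]]]] // _;
    rewrite ?c0 ?c1 ?c2 ?c4 ?c3 ?c5 ?ev1 //=; ring.
have u01 k : ucoef k (1 : {poly Zv}) = (k == 0)%N%:R by rewrite -cheb0 ucoef_cheb.
rewrite /phi /cdih; case: (idx w) => [||a n b]; case: (idx u) => [||a' n' b'] /=;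
  rewrite ?ev1 ?evC1_1 ?evmid ?linear0 ?u01 //; do ?[by case: a; case: b].
case: eqP => [E|E]; last first.
  by rewrite linear0; case: eqP => // -[E1 _ E2]; case: E; rewrite E1 E2.
rewrite ucoef_cheb; congr (nat_of_bool _)%:R; apply/eqP/eqP => [->|[_ -> _] //].
by congr Mid; move: E; case: (a); case: (a'); case: (b); case: (b').
Qed.

End DihedralBasis.

(** * Unitriangularity of the Kazhdan-Lusztig elements over the T_w *)

Ltac low_side := first
  [ by rewrite /=; lia
  | by rewrite /= -?lmonoD -?lmonoD; apply: ldeg_le_mono; lia
  | by rewrite -lmono0; apply: ldeg_le_mono; lia ].

Section DihedralTriangular.
Variables (W : groupType) (s1 s2 : W) (S : set W) (L : W -> int).
Hypothesis hS : S = [set s1; s2].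
Hypothesis hW : infinite_dihedral s1 s2.
Hypothesis hL1 : 0 < L s1.
Hypothesis hL12 : L s1 < L s2.
Variable H : hecke_algebra S L.

Local Notation idx := (idx_of s1 s2).
Local Notation gS := (gen_of hS).
Local Notation xi := (xi s1 s2 L).
Local Notation Cgen := (Cgen hS H).
Local Notation C1 := (Cgen false).
Local Notation C2 := (Cgen true).
Local Notation theta := (theta hS H).
Local Notation mid := (mid hS H).
Local Notation cdih := (cdih hS H).
Local Notation cidx := (cidx hS H).
Local Notation T1 := (hecke_gen H (gS false)).
Local Notation T2 := (hecke_gen H (gS true)).
Local Notation Tb := (@Tb _ _ _ H).
Local Notation p1 := ('v^(- L s1) : Zv).
Local Notation q1 := ('v^(L s1) : Zv).
Local Notation p2 := ('v^(- L s2) : Zv).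
Local Notation q2 := ('v^(L s2) : Zv).

Let noB : no_braid S := dihedral_no_braid hS hW.
Local Notation ell := (dih_len s1 s2).

Definition Tidx i : H :=
  match i with
  | One => 1
  | Sgl => T1
  | Mid a n b => T1 ^+ a * ((T2 * T1) ^+ n * (T2 * T1 ^+ b))
  end.

Lemma Tidx_mul g i : idx_len (idx_mul g i) = (idx_len i).+1 ->
  Tidx (idx_mul g i) = hecke_gen H (gS g) * Tidx i.
Proof.
case: g; case: i => [||[] [|n] b] /= h; try lia;
  rewrite ?expr0 ?expr1 ?mul1r ?mulr1 //.
- by rewrite !mulrA.
- by rewrite exprS !mulrA.
by case: b h => /=; lia.
Qed.

Lemma TbE w : Tb w = Tidx (idx w).
Proof.
rewrite (@Tb_charact _ _ ell (dih_len1 hW) (dih_lenM hS hW) (dih_lenV hS hW)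
  L H (fun w => Tidx (idx w))) //.
  by rewrite (idx_of1 hW).
move=> s x; have [g ->] := gen_ofP hS s; rewrite /dih_len !(idx_of_mul hW).
exact: Tidx_mul.
Qed.

Lemma Tb_val i : Tb (idx_val s1 s2 i) = Tidx i.
Proof. by rewrite TbE (idx_valK hW). Qed.

Local Notation low := (tri ell Tb).

Lemma low_term d n k i : ldeg_le d k -> (idx_len i < n)%N -> low d n (k *: Tidx i).
Proof. by move=> hk hi; rewrite -Tb_val; apply: tri_term; rewrite // /dih_len (idx_valK hW). Qed.

Ltac low_sum := repeat apply: triD;
  solve [ apply: (@low_term _ _ _ Sgl); low_side
        | apply: (@low_term _ _ _ One); low_side
        | apply: low_term; low_side ].

Lemma T1_sqr : T1 * T1 = 1 + (q1 - p1) *: T1.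
Proof. exact: (Tgen_sqr hS H false). Qed.

Lemma C1E : C1 = T1 + p1 *: 1. Proof. exact: CgenE. Qed.
Lemma C2E : C2 = T2 + p2 *: 1. Proof. exact: CgenE. Qed.
Lemma T1_C1 : T1 * C1 = q1 *: C1. Proof. exact: Tgen_mul_Cgen. Qed.
Lemma C1_T1 : C1 * T1 = q1 *: C1.
Proof.
rewrite -T1_C1 C1E mulrDl mulrDr -scalerAl -scalerAr.
by rewrite mulr1 mul1r.
Qed.
Lemma C2_T2 : C2 * T2 = q2 *: C2.
Proof.
rewrite -(Tgen_mul_Cgen hS H true) C2E mulrDl mulrDr -scalerAl -scalerAr.
by rewrite mulr1 mul1r.
Qed.

Lemma C1_Tidx0 n b :
  C1 * Tidx (Mid false n b) = Tidx (Mid true n b) + p1 *: Tidx (Mid false n b).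
Proof. by rewrite C1E mulrDl -scalerAl mul1r /= expr0 expr1 mul1r. Qed.

Lemma C1_Tidx1 n b :
  C1 * Tidx (Mid true n b) = Tidx (Mid false n b) + q1 *: Tidx (Mid true n b).
Proof.
rewrite /= expr1 expr0 mul1r mulrA C1_T1 -scalerAl C1E mulrDl -scalerAl mul1r.
by rewrite scalerDr scalerA lmonoVr scale1r addrC.
Qed.

Lemma Tidx0_C1 a n :
  Tidx (Mid a n false) * C1 = Tidx (Mid a n true) + p1 *: Tidx (Mid a n false).
Proof. by rewrite C1E mulrDr -scalerAr mulr1 /= expr0 expr1 mulr1 !mulrA. Qed.

Lemma Tidx1_C1 a n :
  Tidx (Mid a n true) * C1 = Tidx (Mid a n false) + q1 *: Tidx (Mid a n true).
Proof.
rewrite /= expr1 expr0 mulr1 -!mulrA T1_C1 -!scalerAr C1E !mulrDr -!scalerAr mulr1.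
by rewrite scalerDr scalerA lmonoVr scale1r addrC.
Qed.

(** c_{s1} T_w is T_{s1 w} plus a multiple of T_w, by v^L(s1) if s1 w is shorter than w and by
    v^-L(s1) otherwise. *)
Lemma low_C1 d n x : low d n x -> low (d + L s1) n.+1 (C1 * x).
Proof.
move=> [s hs ->]; rewrite mulr_sumr big_seq; apply: big_ind.
- exact: tri0.
- exact: triD.
move=> i /hs[hd hn]; rewrite -scalerAr; apply: triZ => //.
rewrite TbE; have := hn; rewrite /dih_len; case: (idx i.2) => [||[] k b] /= hk.
- rewrite mulr1 C1E; apply: triD; last by apply: (@low_term _ _ _ One); low_side.
  by rewrite -[T1]scale1r; apply: (@low_term _ _ _ Sgl); low_side.
- rewrite C1_T1 C1E scalerDr scalerA lmonoVr; apply: triD.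
    by apply: (@low_term _ _ _ Sgl); low_side.
  by apply: (@low_term _ _ _ One); low_side.
- rewrite C1_Tidx1; apply: triD; last by apply: low_term; low_side.
  by rewrite -[Tidx _]scale1r; apply: low_term; low_side.
- rewrite C1_Tidx0; apply: triD; last by apply: low_term; low_side.
  by rewrite -[Tidx _]scale1r; apply: low_term; low_side.
Qed.

Lemma low_mul_C1 d n x : low d n x -> low (d + L s1) n.+1 (x * C1).
Proof.
move=> [s hs ->]; rewrite mulr_suml big_seq; apply: big_ind.
- exact: tri0.
- exact: triD.
move=> i /hs[hd hn]; rewrite -scalerAl; apply: triZ => //.
rewrite TbE; have := hn; rewrite /dih_len; case: (idx i.2) => [||a k []] hk; rewrite /= in hk.
- rewrite mul1r C1E; apply: triD; last by apply: (@low_term _ _ _ One); low_side.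
  by rewrite -[T1]scale1r; apply: (@low_term _ _ _ Sgl); low_side.
- rewrite T1_C1 C1E scalerDr scalerA lmonoVr; apply: triD.
    by apply: (@low_term _ _ _ Sgl); low_side.
  by apply: (@low_term _ _ _ One); low_side.
- rewrite Tidx1_C1; apply: triD; last by apply: low_term; low_side.
  by rewrite -[Tidx _]scale1r; apply: low_term; low_side.
- rewrite Tidx0_C1; apply: triD; last by apply: low_term; low_side.
  by rewrite -[Tidx _]scale1r; apply: low_term; low_side.
Qed.

(* [Talt m] is T_w for w = s1 (s2 s1)^m, and [Dbase] is a basis, triangular
   with respect to the T_w, of the span of the [mid false _ false]. *)
Definition Talt m : H := T1 * (T2 * T1) ^+ m.
Definition Dbase m : H := if m is m'.+1 then C2 * Talt m' * C2 else C2.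

Lemma Talt_idx m : Talt m = Tidx (if m is m'.+1 then Mid true m' true else Sgl).
Proof.
by case: m => [|m]; rewrite /Talt ?expr0 ?mulr1 //= !expr1 exprSr.
Qed.

Lemma TaltS m : Talt m.+1 = T1 * T2 * Talt m.
Proof. by rewrite /Talt exprS !mulrA. Qed.

Lemma T1_Talt m : T1 * Talt m = (T2 * T1) ^+ m + (q1 - p1) *: Talt m.
Proof. by rewrite /Talt mulrA T1_sqr mulrDl mul1r -scalerAl. Qed.

(** With both factors c_{s2} expanded as T_{s2} + v^-L(s2), each of the four products of T's is
    already reduced, so no quadratic relation intervenes. *)
Lemma DbaseS m : Dbase m.+1 = Tidx (Mid false m.+1 false) +
  (p2 *: Tidx (Mid true m false) + p2 *: Tidx (Mid false m true) +
   'v^(- L s2 - L s2) *: Talt m).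
Proof.
have -> : Tidx (Mid false m.+1 false) = T2 * Talt m * T2.
  by rewrite /= !expr0 mulr1 mul1r /Talt exprS !mulrA.
have -> : Tidx (Mid true m false) = Talt m * T2.
  by rewrite /= expr0 mulr1 expr1 mulrA.
have -> : Tidx (Mid false m true) = T2 * Talt m.
  by rewrite /= expr0 mul1r expr1 -exprSr exprS /Talt !mulrA.
rewrite lmonoD /= C2E mulrDr !mulrDl -!scalerAl -!scalerAr !mul1r !mulr1.
by rewrite !scalerA -!addrA.
Qed.

Definition delta : Zv := p2 * q1 - p1 * p2.

(** The generating series is that of the Chebyshev polynomials times (1 + v^(L(s1)-L(s2)) x)(1 -
    v^(-L(s1)-L(s2)) x). Since L(s1) < L(s2), all coefficients but the leading one have negative
    degree. *)
Definition Dpoly m : {poly Zv} :=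
  match m with
  | 0%N => 1
  | 1%N => cheb Zv 1 + delta *: cheb Zv 0
  | m'.+2 => cheb Zv m'.+2 + delta *: cheb Zv m'.+1 - (p2 * p2) *: cheb Zv m'
  end.

Lemma zetaE : zeta s1 s2 L = p2 * (q1 - p1) + p1 * xi true.
Proof. by rewrite /zeta /xi /sgen !lmonoD; ring. Qed.

(** [Dbase m.+1] arises twice on expanding: with coefficient v^-L(s2) (v^L(s1) - v^-L(s1)) from the
    square of T_{s1}, and with v^-L(s1) [xi true] from the square of c_{s2}. The sum is [zeta]. *)
Lemma Dbase_step m : C2 * (C1 * Dbase m.+1) =
  Dbase m.+2 + p2 *: (C2 * (T2 * T1) ^+ m * C2) + zeta s1 s2 L *: Dbase m.+1.
Proof.
have E x : C2 * (C1 * (C2 * x)) =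
    C2 * (T1 * T2 * x) + p2 *: (C2 * (T1 * x)) + (p1 * xi true) *: (C2 * x).
  rewrite C1E mulrDl mulrDr -scalerAl mul1r -scalerAr [C2 * (C2 * x)]mulrA Cgen_sqr.
  rewrite -scalerAl scalerA; congr (_ + _).
  by rewrite {2}C2E mulrDl -scalerAl mul1r mulrDr mulrDr -!scalerAr !mulrA.
rewrite -[Dbase m.+1]/(C2 * Talt m * C2) -[C2 * Talt m * C2]mulrA E.
rewrite [T1 * (Talt m * C2)]mulrA T1_Talt mulrDl mulrDr -scalerAl -scalerAr.
rewrite zetaE [(_ + p1 * _) *: _]scalerDl [p2 *: (_ + _)]scalerDr scalerA -!addrA; congr (_ + _).
by rewrite /= TaltS !mulrA.
by rewrite !mulrA.
Qed.

(** By [Dbase_step], passing to the next index is multiplication by X minus v^-L(s2) c_{s2} (T_{s2}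
    T_{s1})^k c_{s2}. For k > 0 this correction is [Dbase k], as c_{s2} T_{s2} = v^L(s2) c_{s2}, and
    the Chebyshev recursion results. For k = 0 it is (1 + v^(-2 L(s2))) c_{s2}, the source of the
    third term of [Dpoly]. *)
Lemma DbaseE m : Dbase m = theta (Dpoly m) * C2.
Proof.
have D0 : Dbase 0 = theta (Dpoly 0) * C2 by rewrite rmorph1 mul1r.
have X_theta F : theta ('X * F) * C2 =
    C2 * (C1 * (theta F * C2)) - zeta s1 s2 L *: (theta F * C2).
  by rewrite rmorphM /= thetaX mulrBl mulrBl -scalerAl -scalerAl mul1r !mulrA.
have D1 : Dbase 1 = theta (Dpoly 1) * C2.
  rewrite /Dpoly cheb1 cheb0 rmorphD mulrDl thetaZ rmorph1 -scalerAl mul1r.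
  rewrite -['X]mulr1 X_theta rmorph1 mul1r /= /Talt expr0 mulr1.
  rewrite C1E mulrDl mulrDr -scalerAl mul1r -scalerAr Cgen_sqr scalerA.
  rewrite !mulrA -!addrA -[LHS]addr0; congr (_ + _).
  rewrite -scaleNr -!scalerDl -[LHS](scale0r C2); congr (_ *: _).
  by rewrite zetaE /delta; ring.
have step k : Dbase k.+1 = theta (Dpoly k.+1) * C2 -> Dbase k.+2 =
    theta ('X * Dpoly k.+1) * C2 - p2 *: (C2 * (T2 * T1) ^+ k * C2).
  by move=> IH; rewrite X_theta -IH Dbase_step !addrK.
have D2 : Dbase 2 = theta (Dpoly 2) * C2.
  rewrite step // expr0 mulr1 Cgen_sqr scalerA -scaleNr.
  rewrite -[X in _ + _ *: X]mul1r scalerAl -(thetaC hS H) -mulrDl -rmorphD.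
  congr (theta _ * _); rewrite /Dpoly chebSS cheb1 cheb0 -!mul_polyC polyCN.
  have -> : p2 * xi true = 1 + p2 * p2 by rewrite mulrDr -lmonoD addNr.
  by rewrite polyCD polyCM; ring.
suff h k : Dbase k.+1 = theta (Dpoly k.+1) * C2 /\ Dbase k.+2 = theta (Dpoly k.+2) * C2.
  by case: m => [//|m]; have [] := h m.
elim: k => [//|k [IH1 IH2]]; split=> //.
rewrite step // exprS !mulrA C2_T2 -!scalerAl scalerA.
rewrite -lmonoD addNr lmono0 scale1r -[C2 * T1 * _ * C2]/(_ : H).
have -> : C2 * T1 * (T2 * T1) ^+ k * C2 = Dbase k.+1 by rewrite /= /Talt !mulrA.
rewrite IH1 -mulrBl -rmorphB; congr (theta _ * _).
case: k {IH1 IH2} => [|k]; rewrite /Dpoly.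
  by rewrite !chebSS cheb1 cheb0 -!mul_polyC; ring.
by rewrite (chebSS Zv k.+2) (chebSS Zv k.+1) (chebSS Zv k) -!mul_polyC; ring.
Qed.

Lemma low_Dbase a m b : low (-1) (idx_len (Mid a m b))
  (C1 ^+ a * Dbase m * C1 ^+ b - Tidx (Mid a m b)).
Proof.
suff [r hr ->] : exists2 r, low (-1) (idx_len (Mid a m b)) r &
    C1 ^+ a * Dbase m * C1 ^+ b = Tidx (Mid a m b) + r by rewrite addrC addKr.
have E0 : Tidx (Mid false 0 false) = T2 by rewrite /= !expr0 !mul1r mulr1.
case: m => [|m].
  rewrite /Dbase [X in C1 ^+ a * X](_ : _ = Tidx (Mid false 0 false) + p2 *: Tidx One); last first.
    by rewrite E0 C2E.
  case: a; case: b; rewrite ?expr0 ?expr1 ?mul1r ?mulr1 ?mulrDr ?C1_Tidx0.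
  - exists (p1 *: Tidx (Mid true 0 false) + p1 *: Tidx (Mid false 0 false) * C1 +
      (p2 * xi false) *: C1).
      rewrite -scalerAl Tidx0_C1 C1E !scalerDr !scalerA /xi mulrDr !mulrDl !scalerDl.
      low_sum.
    rewrite !mulrDl Tidx0_C1 -scalerAr [C1 * Tidx One]mulr1 -[p2 *: C1 * C1]scalerAl.
    by rewrite Cgen_sqr scalerA -!addrA.
  - exists (p1 *: Tidx (Mid false 0 false) + p2 *: C1).
      rewrite C1E scalerDr scalerA; low_sum.
    by rewrite -scalerAr [C1 * Tidx One]mulr1 addrA.
  - exists (p1 *: Tidx (Mid false 0 false) + p2 *: C1).
      rewrite C1E scalerDr scalerA; low_sum.
    by rewrite mulrDl Tidx0_C1 -scalerAl [Tidx One * C1]mul1r addrA.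
  - by exists (p2 *: Tidx One) => //; low_sum.
rewrite DbaseS.
have lowt : low (- L s2 - L s2) m.*2.+2 ('v^(- L s2 - L s2) *: Talt m).
  by rewrite Talt_idx; case: m => [|m]; apply: low_term; low_side.
have low1 : low (- L s2) m.*2.+3 (p2 *: Tidx (Mid true m false)).
  by apply: low_term; low_side.
have low2 : low (- L s2) m.*2.+3 (p2 *: Tidx (Mid false m true)).
  by apply: low_term; low_side.
set r1 := p2 *: Tidx (Mid true m false); set r2 := p2 *: Tidx (Mid false m true).
move: (_ *: Talt m) lowt => r3 lowt.
have lowR : low (- L s2) m.*2.+3 (r1 + r2 + r3).
  by do ![apply: triD => //]; apply: tri_weaken lowt; lia.
case: a; case: b; rewrite ?expr0 ?expr1 ?mul1r ?mulr1.
(* Two uses of the general bound would give degree 2 L(s1) - L(s2) for [r1] and [r2]. Each of them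
   starts or ends in s1, but not both, so only one of the two factors c_{s1} raises the degree, and
   the explicit expansion shows it. The term [r3], of degree -2 L(s2), can afford both. *)
- exists (p1 *: Tidx (Mid true m.+1 false) + p1 *: Tidx (Mid false m.+1 false) * C1 +
    (C1 * r1 * C1 + C1 * r2 * C1 + C1 * r3 * C1)).
    rewrite -scalerAl Tidx0_C1 scalerDr scalerA.
    rewrite /r1 /r2 -!scalerAr -!scalerAl C1_Tidx0 C1_Tidx1 !mulrDl -!scalerAl.
    rewrite !Tidx0_C1 !Tidx1_C1 !scalerDr !scalerA.
    apply: triD; first low_sum; apply: triD; first low_sum.
    have := low_mul_C1 (low_C1 lowt); apply: tri_weaken => /=; lia.
  rewrite mulrDr mulrDl C1_Tidx0 mulrDl Tidx0_C1 !mulrDr !mulrDl -!addrA.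
  by [].
- exists (p1 *: Tidx (Mid false m.+1 false) + C1 * (r1 + r2 + r3)).
    apply: triD; first by apply: low_term; low_side.
    by have := low_C1 lowR; apply: tri_weaken => /=; lia.
  by rewrite mulrDr C1_Tidx0 addrA.
- exists (p1 *: Tidx (Mid false m.+1 false) + (r1 + r2 + r3) * C1).
    apply: triD; first by apply: low_term; low_side.
    by have := low_mul_C1 lowR; apply: tri_weaken => /=; lia.
  by rewrite mulrDl Tidx0_C1 addrA.
- by exists (r1 + r2 + r3) => //; apply: tri_weaken lowR => /=; lia.
Qed.

Lemma mid_Dpoly a m b : mid a (Dpoly m) b = C1 ^+ a * Dbase m * C1 ^+ b.
Proof. by rewrite DbaseE. Qed.

Lemma mid_cheb1 a b : mid a (cheb Zv 1) b =
  mid a (Dpoly 1) b - delta *: mid a (cheb Zv 0) b.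
Proof. by rewrite /Dpoly midD midZ addrK. Qed.

Lemma mid_chebSS a n b : mid a (cheb Zv n.+2) b =
  mid a (Dpoly n.+2) b - delta *: mid a (cheb Zv n.+1) b
  + (p2 * p2) *: mid a (cheb Zv n) b.
Proof. by rewrite /Dpoly !midD -scaleNr !midZ scaleNr addrAC subrK addrK. Qed.

Lemma ldeg_delta : ldeg_le (-1) delta.
Proof.
by rewrite /delta -!lmonoD; apply: ldeg_leD; [|apply: ldeg_leN];
  apply: ldeg_le_mono; lia.
Qed.

(** Solving the three-term relation for the Chebyshev polynomial U_n leaves the corresponding
    [Dpoly] and multiples of U_{n-1} and U_{n-2} with coefficients of negative degree, to which
    induction applies. *)
Lemma cidx_low i : low (-1) (idx_len i) (cidx i - Tidx i).
Proof.
case: i => [||a n b].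
- by rewrite subrr; apply: tri0.
- by rewrite /= C1E addrC addKr; apply: (@low_term _ _ _ One); low_side.
have lowD k : low (-1) (idx_len (Mid a k b)) (mid a (Dpoly k) b - Tidx (Mid a k b)).
  by rewrite mid_Dpoly; apply: low_Dbase.
have lowZ e k m (c : Zv) : ldeg_le e c -> e <= -1 -> (k < m)%N ->
    low (-1) (idx_len (Mid a k b)) (mid a (cheb Zv k) b - Tidx (Mid a k b)) ->
    low (-1) (idx_len (Mid a m b)) (c *: mid a (cheb Zv k) b).
  move=> hc e1 km hk; have {}hc : ldeg_le (-1) c by apply: ldeg_le_trans hc.
  rewrite -[mid _ _ _](subrK (Tidx (Mid a k b))) scalerDr; apply: triD.
    apply: (tri_weaken _ _ (triZ hc hk)) => /=; lia.
  by apply: low_term => //=; lia.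
elim: n {-2}n (leqnn n) => [|N IH] n nN.
  by move: nN; rewrite leqn0 => /eqP ->; apply: lowD.
case: n nN => [|[|n]] nN; first exact: IH.
  rewrite /= mid_cheb1 addrAC; apply: triD; first exact: lowD.
  by apply: triN; apply: (lowZ (-1)) => //; [apply: ldeg_delta | apply: IH].
rewrite /= mid_chebSS addrAC; apply: triD.
  rewrite addrAC; apply: triD; first exact: lowD.
  by apply: triN; apply: (lowZ (-1)) => //; [apply: ldeg_delta | apply: IH].
apply: (lowZ (- L s2 - L s2)); rewrite -?lmonoD //; last by apply: IH; lia.
  exact: ldeg_le_mono.
lia.
Qed.

Lemma cdih_tri w : low (-1) (ell w) (cdih w - Tb w).
Proof. by rewrite TbE; apply: cidx_low. Qed.

Lemma Cgen_bar g : bar (Cgen g) = Cgen g.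
Proof.
have [fD _ f1 _ [fZ _]] := barP H noB.
rewrite CgenE fD fZ f1 bar_gen // val_gen_of lbar_mono opprK scalerBl opprB.
by rewrite -addrA subrK.
Qed.

(** X is bar-invariant because c_{s1}, c_{s2} and [zeta] are, and the Chebyshev recursion has
    integer coefficients. *)
Lemma bar_theta_cheb n : bar (theta (cheb Zv n)) = theta (cheb Zv n).
Proof.
have [fD fM f1 _ [fZ _]] := barP H noB.
have fN x : bar (- x : H) = - bar x by rewrite -scaleN1r fZ rmorphN rmorph1 scaleN1r.
have fX : bar (theta 'X) = theta 'X.
  rewrite thetaX fD fN fZ f1 fM !Cgen_bar /zeta rmorphD /= !lbar_mono !opprB.
  by rewrite [X in X *: _]addrC.
elim: n {-2}n (leqnn n) => [|N IH] [|[|n]] nN; rewrite ?cheb0 ?rmorph1 ?cheb1 //.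
by rewrite chebSS rmorphB rmorphM /= fD fN fM fX !IH // ltnW.
Qed.

Lemma cdih_bar w : bar (cdih w) = cdih w.
Proof.
have [_ fM f1 _ _] := barP H noB.
have fX (b : bool) : bar (C1 ^+ b) = C1 ^+ b.
  by case: b; rewrite ?expr0 ?expr1 ?Cgen_bar ?f1.
rewrite /cdih; case: (idx w) => [||a n b] /=; rewrite ?f1 ?Cgen_bar //.
by rewrite /mid !fM !fX bar_theta_cheb Cgen_bar.
Qed.

Lemma cb_dihedral : @cb _ _ _ H = cdih.
Proof. exact: cbE noB (cdih_is_basis hS hW H) cdih_bar cdih_tri. Qed.

Lemma Tb_basis_dihedral : is_basis Tb.
Proof. exact: Tb_is_basis (cdih_is_basis hS hW H) cdih_tri. Qed.

End DihedralTriangular.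

(** * The function Delta *)

Section DihedralDelta.
Variables (W : groupType) (s1 s2 : W) (S : set W) (L : W -> int).
Hypothesis hS : S = [set s1; s2].
Hypothesis hW : infinite_dihedral s1 s2.
Hypothesis hL1 : 0 < L s1.
Hypothesis hL12 : L s1 < L s2.
Variable H : hecke_algebra S L.

Local Notation idx := (idx_of s1 s2).
Local Notation gS := (gen_of hS).
Local Notation xi := (xi s1 s2 L).
Local Notation Cgen := (Cgen hS H).
Local Notation C1 := (Cgen false).
Local Notation theta := (theta hS H).
Local Notation mid := (mid hS H).
Local Notation cdih := (cdih hS H).
Local Notation cidx := (cidx hS H).
Local Notation T1 := (hecke_gen H (gS false)).
Local Notation Tb := (@Tb _ _ _ H).
Local Notation p1 := ('v^(- L s1) : Zv).
Local Notation q1 := ('v^(L s1) : Zv).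
Local Notation p2 := ('v^(- L s2) : Zv).


Local Notation Tidx := (Tidx hS H).
Local Notation Dbase := (Dbase hS H).
Local Notation Talt := (Talt hS H).
Local Notation delta := (delta s1 s2 L).
Local Notation Dpoly := (Dpoly s1 s2 L).


Let TP : is_basis Tb := Tb_basis_dihedral hS hW hL1 hL12 H.

(** Multiplication by s1 on either side preserves the set of 1 and s1. Hence the effect of c_{s1} on
    the coordinate at 1 is known once the coordinate at s1 is followed along with it. *)
Definition tau (x : H) : Zv := coords Tb x 1%g.
Definition sigma (x : H) : Zv := coords Tb x s1.

Lemma tau_Tidx i : tau (Tidx i) = (i == One)%:R.
Proof.
rewrite /tau -(Tb_val hS hW hL1 hL12 H) coords_base // -[1%g]/(idx_val s1 s2 One).
by rewrite (inj_eq (idx_val_inj hW)) eq_sym.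
Qed.

Lemma sigma_Tidx i : sigma (Tidx i) = (i == Sgl)%:R.
Proof.
rewrite /sigma -(Tb_val hS hW hL1 hL12 H) coords_base // -[X in X == _]/(idx_val s1 s2 Sgl).
by rewrite (inj_eq (idx_val_inj hW)) eq_sym.
Qed.

Lemma tauD x y : tau (x + y) = tau x + tau y. Proof. exact: coordsD. Qed.
Lemma tauZ k x : tau (k *: x) = k * tau x. Proof. exact: coordsZ. Qed.
Lemma sigmaD x y : sigma (x + y) = sigma x + sigma y. Proof. exact: coordsD. Qed.
Lemma sigmaZ k x : sigma (k *: x) = k * sigma x. Proof. exact: coordsZ. Qed.

Lemma tau_sigma_C1 x :
  tau (C1 * x) = p1 * tau x + sigma x /\ sigma (C1 * x) = tau x + q1 * sigma x.
Proof.
rewrite [x](coordsE TP) mulr_sumr /tau /sigma !coords_sum // !mulr_sumr -!big_split.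
suff h w : tau (C1 * Tb w) = p1 * tau (Tb w) + sigma (Tb w) /\
    sigma (C1 * Tb w) = tau (Tb w) + q1 * sigma (Tb w).
  split; apply: eq_bigr => w _; rewrite -scalerAr !coordsZ //.
    by have := (h w).1; rewrite /tau /sigma => -> /=; ring.
  by have := (h w).2; rewrite /tau /sigma => -> /=; ring.
rewrite (TbE hS hW hL1 hL12 H); case: (idx w) => [||[] n b].
- by rewrite mulr1 C1E !(tauD, sigmaD, tauZ, sigmaZ) -[T1]/(Tidx Sgl) -[1]/(Tidx One) !(tau_Tidx, sigma_Tidx) /=; split; ring.
- rewrite [Tidx Sgl]/(T1) C1_T1 C1E !(tauD, sigmaD, tauZ, sigmaZ) -[T1]/(Tidx Sgl) -[1 : H]/(Tidx One).
  by rewrite !(tau_Tidx, sigma_Tidx) /=; split; rewrite !(mulr0, mulr1, add0r, addr0) ?lmonoVr.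
- by rewrite C1_Tidx1 !(tauD, sigmaD, tauZ, sigmaZ) !(tau_Tidx, sigma_Tidx) /=; split; ring.
- by rewrite C1_Tidx0 !(tauD, sigmaD, tauZ, sigmaZ) !(tau_Tidx, sigma_Tidx) /=; split; ring.
Qed.

Lemma tau_sigma_mul_C1 x :
  tau (x * C1) = p1 * tau x + sigma x /\ sigma (x * C1) = tau x + q1 * sigma x.
Proof.
rewrite [x](coordsE TP) mulr_suml /tau /sigma !coords_sum // !mulr_sumr -!big_split.
suff h w : tau (Tb w * C1) = p1 * tau (Tb w) + sigma (Tb w) /\
    sigma (Tb w * C1) = tau (Tb w) + q1 * sigma (Tb w).
  split; apply: eq_bigr => w _; rewrite -scalerAl !coordsZ //.
    by have := (h w).1; rewrite /tau /sigma => -> /=; ring.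
  by have := (h w).2; rewrite /tau /sigma => -> /=; ring.
rewrite (TbE hS hW hL1 hL12 H); case: (idx w) => [||a n []].
- have := tau_sigma_C1 1; rewrite mulr1 => -[h1 h2].
  by rewrite [Tidx One * C1]mul1r h1 h2.
- have := tau_sigma_C1 T1; rewrite C1_T1 -(T1_C1 hS) => -[h1 h2].
  by rewrite [Tidx Sgl * C1]/(T1 * C1) h1 h2.
- by rewrite Tidx1_C1 !(tauD, sigmaD, tauZ, sigmaZ) !(tau_Tidx, sigma_Tidx) /=; split; ring.
- by rewrite Tidx0_C1 !(tauD, sigmaD, tauZ, sigmaZ) !(tau_Tidx, sigma_Tidx) /=; split; ring.
Qed.

Local Notation t n := (tau (mid false (cheb Zv n) false)).
Local Notation s n := (sigma (mid false (cheb Zv n) false)).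

Let q1p1 : q1 * p1 = 1. Proof. exact: lmonoVr. Qed.

Lemma mid_DpolyE n : mid false (Dpoly n) false = Dbase n.
Proof. by rewrite mid_Dpoly expr0 mul1r mulr1. Qed.

Lemma tau_sigma0 : t 0 = p2 /\ s 0 = 0.
Proof.
have -> : mid false (cheb Zv 0) false = Tidx (Mid false 0 false) + p2 *: Tidx One.
  by rewrite -C2_mid1 C2E /= !expr0 !mul1r mulr1.
by rewrite tauD sigmaD tauZ sigmaZ !tau_Tidx !sigma_Tidx /=; split; ring.
Qed.

Lemma tau_sigma1 : t 1 = - delta * p2 /\ s 1 = p2 * p2.
Proof.
rewrite mid_cheb1 -scaleNr !tauD !sigmaD tauZ sigmaZ.
have [-> ->] := tau_sigma0.
rewrite mid_DpolyE DbaseS (Talt_idx _ _ 0) !(tauD, sigmaD, tauZ, sigmaZ).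
by rewrite !tau_Tidx !sigma_Tidx lmonoD /=; split; ring.
Qed.

(** From index 2 on, [Dbase] involves neither T_1 nor T_{s1}, so the recursion is homogeneous. *)
Lemma tau_sigmaSS n : t n.+2 = - delta * t n.+1 + p2 * p2 * t n /\
  s n.+2 = - delta * s n.+1 + p2 * p2 * s n.
Proof.
rewrite mid_chebSS mid_DpolyE -scaleNr !(tauD, sigmaD, tauZ, sigmaZ).
rewrite DbaseS (Talt_idx _ _ n.+1) !(tauD, sigmaD, tauZ, sigmaZ).
by rewrite !tau_Tidx !sigma_Tidx /=; split; ring.
Qed.

(* The generating series of the [t n] is p2 / ((1 + p x)(1 - q x)) with
   p = v^(L s1 - L s2) and q = v^(- L s1 - L s2). *)
Lemma tau_sigma_geom n : t n + q1 * s n = p2 * (p1 * p2) ^+ n.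
Proof.
suff h : t n + q1 * s n = p2 * (p1 * p2) ^+ n /\
    t n.+1 + q1 * s n.+1 = p2 * (p1 * p2) ^+ n.+1 by case: h.
elim: n => [|n [IH1 IH2]].
  have [-> ->] := tau_sigma0; have [-> ->] := tau_sigma1.
  by rewrite expr0 expr1 /delta; split; ring.
split=> //; have [-> ->] := tau_sigmaSS n.
transitivity (- delta * (t n.+1 + q1 * s n.+1) + p2 * p2 * (t n + q1 * s n)); first by ring.
rewrite IH1 IH2 !exprS -{1}[p2 * p2]mulr1 -q1p1 /delta; ring.
Qed.

(** The characteristic roots of the recursion are v^(-L(s1)-L(s2)) and -v^(L(s1)-L(s2)); subtracting
    the first root times the preceding term leaves a geometric sequence in the second. *)
Lemma tau_recursion n : t n.+1 = p1 * p2 * t n + p2 * (- (p2 * q1)) ^+ n.+1.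
Proof.
elim: n => [|n IH].
  by have [-> _] := tau_sigma0; have [-> _] := tau_sigma1; rewrite expr1 /delta; ring.
have [-> _] := tau_sigmaSS n.
have -> : p2 * p2 * t n = p2 * q1 * (p1 * p2 * t n).
  by rewrite -[in LHS](mul1r (p2 * p2)) -q1p1; ring.
have -> : p1 * p2 * t n = t n.+1 - p2 * (- (p2 * q1)) ^+ n.+1 by rewrite IH addrK.
by rewrite [_ ^+ n.+2]exprS /delta; ring.
Qed.

(** The root -v^(L(s1)-L(s2)) has the larger degree and dominates; it is also the source of the
    sign. *)
Lemma tau_lead n : let d := - L s2 + (L s1 - L s2) *+ n in
  ldeg_le d (t n) /\ lcoef (t n) d = (-1) ^+ n.
Proof.
elim: n => [|n [IH1 IH2]] /=.
  have [-> _] := tau_sigma0; rewrite mulr0n addr0 expr0; split; first exact: ldeg_le_mono.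
  by rewrite lcoef_mono eqxx.
set d := _ + _ *+ n.+1; set e := _ + _ *+ n in IH1 IH2.
have -> : t n.+1 = 'v^(- L s1 - L s2) * t n + 'v^d * ((-1) ^+ n.+1 : int)%:~R.
  have -> : 'v^d = p2 * 'v^(L s1 - L s2) ^+ n.+1.
    by rewrite (lmonoX _ (L s1 - L s2) n.+1) -(lmonoD _ (- L s2)).
  rewrite tau_recursion [(- (p2 * q1)) ^+ _]exprNn rmorphXn rmorphN1.
  rewrite (lmonoD _ (- L s1)) (lmonoD _ (L s1)) [q1 * p2]mulrC -[p2 * _ ^+ _ * _]mulrA.
  by rewrite [(p2 * q1) ^+ _ * _]mulrC.
have low1 : ldeg_le (- L s1 - L s2 + e) ('v^(- L s1 - L s2) * t n).
  by apply: ldeg_leM => //; apply: ldeg_le_mono.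
have ed : - L s1 - L s2 + e < d by rewrite /e /d mulrS; lia.
split.
  apply: ldeg_leD; first by apply: ldeg_le_trans low1; lia.
  by rewrite -[d]addr0; apply: ldeg_leM; [apply: ldeg_le_mono; lia | apply: ldeg_le_intr].
by rewrite lcoefDr low1 // add0r lcoef_monoM subrr lcoef_intr eqxx.
Qed.

Definition idx_delta i : int :=
  match i with
  | One => 0
  | Sgl => L s1
  | Mid a n b =>
    if a (+) b then (L s1 + L s2) *+ n.+1
    else if a then L s2 + (L s1 + L s2) *+ n else L s2 + (L s2 - L s1) *+ n
  end.

Definition idx_sign i : int :=
  if i is Mid false n false then (-1) ^+ n else 1.

(** An outer c_{s1} brings in the combination [t n + q1 * s n], which is a pure power of v. Only the
    family without outer c_{s1} sees the other root, hence its sign and the slower growth of its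
    Delta. *)
Lemma tau_cidx_lead i : ldeg_le (- idx_delta i) (tau (cidx i)) /\
  lcoef (tau (cidx i)) (- idx_delta i) = idx_sign i.
Proof.
have mono (d : int) : ldeg_le d ('v^d : Zv) /\ lcoef ('v^d : Zv) d = 1.
  by split; [exact: ldeg_le_mono | rewrite lcoef_mono eqxx].
have tauC n : tau (mid true (cheb Zv n) false) = 'v^(- (L s1 + L s2) *+ n.+1).
  have -> : mid true (cheb Zv n) false = C1 * mid false (cheb Zv n) false.
    by rewrite C1_mid scale1r.
  rewrite (tau_sigma_C1 _).1 -[s n]mul1r -q1p1 [q1 * p1]mulrC -mulrA -mulrDr tau_sigma_geom.
  by rewrite mulrA -exprS -lmonoD -opprD lmonoX.
case: i => [||a n b].
- by rewrite /= -[1]/(Tidx One) tau_Tidx oppr0; apply: (mono 0).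
- rewrite /= C1E tauD tauZ -[T1]/(Tidx Sgl) -[1 : H]/(Tidx One) !tau_Tidx add0r mulr1.
  exact: mono.
case: a; case: b => /=.
- have -> : mid true (cheb Zv n) true = mid true (cheb Zv n) false * C1.
    by rewrite mid_C1 scale1r.
  have -> : mid true (cheb Zv n) false = C1 * mid false (cheb Zv n) false.
    by rewrite C1_mid scale1r.
  have [-> _] := tau_sigma_mul_C1 (C1 * mid false (cheb Zv n) false).
  have [-> ->] := tau_sigma_C1 (mid false (cheb Zv n) false).
  have -> : p1 * (p1 * t n + s n) + (t n + q1 * s n) =
      'v^(- (L s2 + (L s1 + L s2) *+ n)) + 'v^(- (L s2 + (L s1 + L s2) *+ n) - L s1 - L s1).
    have -> : p1 * t n + s n = p1 * (t n + q1 * s n).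
      by rewrite mulrDr mulrA [p1 * q1]mulrC q1p1 mul1r.
    rewrite tau_sigma_geom -!lmonoD lmonoX -!lmonoD addrC.
    by congr ('v^_ + 'v^_); rewrite -opprD mulNrn; lia.
  split; first by apply: ldeg_leD; apply: ldeg_le_mono; lia.
  by rewrite lcoefDr !lcoef_mono eqxx; case: eqP => //; lia.
- by rewrite tauC mulNrn; apply: mono.
- have -> : mid false (cheb Zv n) true = mid false (cheb Zv n) false * C1.
    by rewrite mid_C1 scale1r.
  have [-> _] := tau_sigma_mul_C1 (mid false (cheb Zv n) false).
  have <- := (tau_sigma_C1 (mid false (cheb Zv n) false)).1.
  by rewrite C1_mid scale1r tauC mulNrn; apply: mono.
- have [] := tau_lead n; have -> // : - L s2 + (L s1 - L s2) *+ n = - (L s2 + (L s2 - L s1) *+ n).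
  by rewrite opprD -mulNrn opprB.
Qed.

Lemma pcoefE w : pcoef H 1%g w = tau (cidx (idx w)).
Proof. by rewrite /pcoef (cb_dihedral hS hW hL1 hL12 H). Qed.

Lemma idx_delta_ge0 i : 0 <= idx_delta i.
Proof.
case: i => [||a n b] //=; first exact: ltW.
have h1 : 0 <= (L s1 + L s2) *+ n by rewrite mulrn_wge0 //; lia.
have h2 : 0 <= (L s2 - L s1) *+ n by rewrite mulrn_wge0 //; lia.
by rewrite mulrS; case: a; case: b => /=; lia.
Qed.

Lemma DeltaE w : (Delta H w)%:Z = idx_delta (idx w).
Proof.
have [hd hc] := tau_cidx_lead (idx w); have d0 := idx_delta_ge0 (idx w).
have dE : (`|idx_delta (idx w)|%N)%:Z = idx_delta (idx w) by rewrite gez0_abs.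
rewrite -[RHS]dE; congr Posz; apply: minnatE => /=.
  rewrite pcoefE dE hc /idx_sign; case: (idx w) => [||[] n []] //.
  by apply/eqP; rewrite signr_eq0.
move=> m; rewrite pcoefE => hm; rewrite leqNgt; apply/negP => mlt; case: hm.
by apply: hd; lia.
Qed.

Lemma ncoefE w : ncoef H w = idx_sign (idx w).
Proof.
by have [_ <-] := tau_cidx_lead (idx w); rewrite /ncoef pcoefE DeltaE.
Qed.

End DihedralDelta.

(** * The a-function and the constants gamma *)

Section DihedralAFunction.
Variables (W : groupType) (s1 s2 : W) (S : set W) (L : W -> int).
Hypothesis hS : S = [set s1; s2].
Hypothesis hW : infinite_dihedral s1 s2.
Hypothesis hL1 : 0 < L s1.
Hypothesis hL12 : L s1 < L s2.
Variable H : hecke_algebra S L.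

Local Notation sg := (sgen s1 s2).
Local Notation idx := (idx_of s1 s2).
Local Notation gS := (gen_of hS).
Local Notation xi := (xi s1 s2 L).
Local Notation Y := (cheb_shift s1 s2 L).
Local Notation Cgen := (Cgen hS H).
Local Notation theta := (theta hS H).
Local Notation mid := (mid hS H).
Local Notation cdih := (cdih hS H).
Local Notation cidx := (cidx hS H).
Local Notation Tb := (@Tb _ _ _ H).



Local Notation xi1_pow := (xi1_pow s1 s2 L).
Local Notation sandwich := (sandwich s1 s2 L).

Let cP : is_basis cdih := cdih_is_basis hS hW H.

Definition idx_a i : int :=
  match i with One => 0 | Sgl => L s1 | Mid _ _ _ => L s2 end.

Definition idx_h i j k : Zv :=
  match i, j with
  | One, _ => (k == j)%:R
  | _, One => (k == i)%:R
  | Sgl, Sgl => xi false * (k == Sgl)%:R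
  | Sgl, Mid a n b => xi1_pow a * (k == Mid true n b)%:R
  | Mid a n b, Sgl => xi1_pow b * (k == Mid a n true)%:R
  | Mid a m b, Mid a' n b' =>
    if k is Mid c l d then
      if (c == a) && (d == b') then ucoef l (cheb Zv m * cheb Zv n * sandwich b a')
      else 0
    else 0
  end.

Lemma coords_cidx i k : coords cdih (cidx i) (idx_val s1 s2 k) = (k == i)%:R.
Proof.
by rewrite -(cdih_val hS hW) coords_base // (inj_eq (idx_val_inj hW)).
Qed.

Lemma coords_mid a F b k : coords cdih (mid a F b) (idx_val s1 s2 k) =
  if k is Mid c l d then if (c == a) && (d == b) then ucoef l F else 0 else 0.
Proof.
elim/cheb_ind: F k => [k|t F G IHF IHG k|n k].
- rewrite mid0 coords0 //; case: k => [||c l d] //.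
  by rewrite linear0 if_same.
- rewrite mid_linear coords_linear // IHF IHG.
  case: k => [||c l d] /=; rewrite ?mulr0 ?addr0 //.
  by case: ifP => _; rewrite ?linearP ?mulr0 ?addr0.
rewrite -[mid a _ b]/(cidx (Mid a n b)) coords_cidx; case: k => [||c l d] //.
rewrite ucoef_cheb; case: ifPn => [/andP[/eqP -> /eqP ->]|].
  by congr (nat_of_bool _)%:R; apply/eqP/eqP => [[->]|->].
by move=> h; case: eqP => // -[ca _ db]; rewrite ca db !eqxx in h.
Qed.

Lemma hcoefE x y z : hcoef H x y z = idx_h (idx x) (idx y) (idx z).
Proof.
rewrite /hcoef (cb_dihedral hS hW hL1 hL12 H) -[in LHS](idx_ofK hW z) /cdih.
rewrite /idx_h; case: (idx x) => [||a m b]; case: (idx y) => [||a' n b'];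
  rewrite ?mul1r ?mulr1 ?coords_cidx //.
- by rewrite Cgen_sqr coordsZ // -[Cgen false]/(cidx Sgl) coords_cidx.
- rewrite [X in coords _ X _]C1_mid coordsZ //.
  by rewrite -[mid true _ _]/(cidx (Mid true n b')) coords_cidx.
- rewrite [X in coords _ X _]mid_C1 coordsZ //.
  by rewrite -[mid _ _ true]/(cidx (Mid a m true)) coords_cidx.
- by rewrite [X in coords _ X _]midM coords_mid.
Qed.

Lemma ldeg_xi g d : L (sg g) <= d -> 0 <= L (sg g) -> ldeg_le d (xi g).
Proof. by move=> h1 h2; apply: ldeg_leD; apply: ldeg_le_mono; lia. Qed.

Lemma ldeg_nat d n : 0 <= d -> ldeg_le d (n%:R : Zv).
Proof. by move=> d0; rewrite -[n%:R]/((n%:Z)%:~R); apply: ldeg_le_intr. Qed.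

Lemma lcoef_nat n k : lcoef (n%:R : Zv) k = if k == 0 then n%:Z else 0.
Proof. exact: (lcoef_intr n%:Z). Qed.

Lemma ldeg_xi1_pow a : ldeg_le (L s1) (xi1_pow a).
Proof. by case: a; [apply: ldeg_xi => /=; lia | apply: ldeg_le_mono; lia]. Qed.

Local Notation N := (cheb_mult int).

(** Multiplication by X shifts Chebyshev indices and keeps the coefficients integral; every
    nontrivial power of v comes from [zeta]. *)
Lemma ucoef_shift m n l : exists2 r : Zv, ldeg_le 0 r &
  ucoef l (cheb Zv m * cheb Zv n * Y) = r + zeta s1 s2 L * (N m n l)%:~R.
Proof.
pose r : int := N m n l.+1 + (if l is l'.+1 then N m n l' else 0).
exists r%:~R; first exact: ldeg_le_intr.
have NE k : ucoef k (cheb Zv m * cheb Zv n) = (N m n k)%:~R.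
  exact: (cheb_mult_map (intr : {rmorphism int -> Zv})).
rewrite /cheb_shift mulrDr linearD /= mulrC ucoefXM [_ * _%:P]mulrC mul_polyC linearZ /=.
rewrite !NE /r rmorphD /=; congr (_ + _ + _).
by case: l {r} => [|l]; rewrite ?rmorph0 ?NE.
Qed.

Lemma sandwich_lead m n l b a :
  ldeg_le (L s2) (ucoef l (cheb Zv m * cheb Zv n * sandwich b a)) /\
  lcoef (ucoef l (cheb Zv m * cheb Zv n * sandwich b a)) (L s2) =
    if b == a then N m n l else 0.
Proof.
have NE k : ucoef k (cheb Zv m * cheb Zv n) = (N m n k)%:~R.
  exact: (cheb_mult_map (intr : {rmorphism int -> Zv})).
have [r r0 rE] := ucoef_shift m n l.
have intr_lead (p : Zv) (z : int) d : lcoef (p * z%:~R) d = lcoef p d * z.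
  rewrite mulrC -[z%:~R]/(z%:~R : Zv).
  have <- : lconst z = z%:~R by rewrite -[in LHS](intz z) rmorph_int.
  by rewrite lcoef_constM mulrC.
have intr_deg (p : Zv) (z : int) d : ldeg_le d p -> ldeg_le d (p * z%:~R).
  by move=> hp k dk; rewrite intr_lead hp ?mul0r.
have hz : ldeg_le (L s2 - L s1) (zeta s1 s2 L).
  by apply: ldeg_leD; apply: ldeg_le_mono; lia.
have mixed : ldeg_le (L s2 - L s1) (ucoef l (cheb Zv m * cheb Zv n * Y)).
  rewrite rE; apply: ldeg_leD; last exact: intr_deg.
  by apply: ldeg_le_trans r0; lia.
case: b; case: a; rewrite /sandwich /= -?scalerAr ?linearZ /=.
- have hx : ldeg_le (L s1) (xi false) by apply: ldeg_xi => /=; lia.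
  (* [xi false] contributes degree L(s1) and [zeta] the remaining L(s2) - L(s1), each with leading
     coefficient 1. *)
  have -> : L s2 = L s1 + (L s2 - L s1) by rewrite addrC subrK.
  split; first exact: ldeg_leM.
  rewrite lcoefM_lead // rE lcoefDr r0 ?subr_gt0 // add0r intr_lead.
  rewrite /xi /zeta !lcoefDr !lcoef_mono !eqxx.
  have -> : (L s1 == - L s1) = false by apply/eqP; lia.
  have -> : (L s2 - L s1 == L s1 - L s2) = false by apply/eqP; lia.
  by rewrite /= !addr0 !mul1r.
- by split; [apply: ldeg_le_trans mixed; lia | rewrite mixed //; lia].
- by split; [apply: ldeg_le_trans mixed; lia | rewrite mixed //; lia].
rewrite [_ * _%:P]mulrC mul_polyC linearZ /= NE; split.
  by apply: intr_deg; apply: ldeg_xi => /=; lia.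
rewrite intr_lead /xi lcoefDr !lcoef_mono eqxx.
have -> : (L s2 == - L s2) = false by apply/eqP; lia.
by rewrite /= addr0 mul1r.
Qed.

Definition idx_gamma i j k : int :=
  match i, j, k with
  | One, One, One | Sgl, Sgl, Sgl => 1
  | Mid a m b, Mid a' n b', Mid a'' l b'' =>
    if [&& b == a', b' == a'' & b'' == a] then N m n l else 0
  | _, _, _ => 0
  end.

Lemma idx_a_ge0 i : 0 <= idx_a i.
Proof. by case: i => [||a n b] /=; lia. Qed.

Lemma idx_h_lead i j k : ldeg_le (idx_a k) (idx_h i j k) /\
  lcoef (idx_h i j k) (idx_a k) = idx_gamma i j (idx_inv k).
Proof.
have l10 : (L s1 == 0) = false by apply/eqP; lia.
have l20 : (L s2 == 0) = false by apply/eqP; lia.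
have xi1_lt (a : bool) : lcoef (xi1_pow a) (L s2) = 0 by rewrite ldeg_xi1_pow.
have nat_case n i' : ldeg_le (idx_a i') (n%:R : Zv) by apply/ldeg_nat/idx_a_ge0.
case: i => [||a m b]; case: j => [||a' n b']; case: k => [||c l d] /=;
  rewrite ?mulr0 ?mulr1 ?lcoef0r ?lcoef_nat ?l10 ?l20 ?eqxx //=;
  do ?[by split => //; exact: ldeg_le0]; do ?[by split => //; exact: (nat_case _ One)];
  do ?[by split => //; exact: (nat_case _ Sgl)];
  do ?[by split => //; exact: (nat_case _ (Mid true 0 true))].
- split; first by apply: ldeg_xi => /=; lia.
  rewrite /xi lcoefDr !lcoef_mono eqxx.
  by have -> : (L s1 == - L s1) = false by apply/eqP; lia.
- have h (t : bool) : ldeg_le (L s2) (xi1_pow a' * t%:R) /\ lcoef (xi1_pow a' * t%:R) (L s2) = 0.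
    case: t; rewrite ?mulr0 ?mulr1; split; rewrite ?lcoef0r //; last exact: ldeg_le0.
    by apply: ldeg_le_trans (@ldeg_xi1_pow a'); lia.
  exact: h.
- have h (t : bool) : ldeg_le (L s2) (xi1_pow b * t%:R) /\ lcoef (xi1_pow b * t%:R) (L s2) = 0.
    case: t; rewrite ?mulr0 ?mulr1; split; rewrite ?lcoef0r //; last exact: ldeg_le0.
    by apply: ldeg_le_trans (@ldeg_xi1_pow b); lia.
  exact: h.
case: ifPn => [/andP[/eqP -> /eqP ->]|h].
  by rewrite !eqxx !andbT; apply: sandwich_lead.
split; first exact: ldeg_le0.
rewrite lcoef0r; case: ifP => // /and3P[_ /eqP E1 /eqP E2].
by rewrite E1 E2 !eqxx in h.
Qed.

Lemma idx_h_attained k : exists i j, lcoef (idx_h i j k) (idx_a k) = 1.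
Proof.
case: k => [||a n b].
- by exists One, One; rewrite (idx_h_lead _ _ _).2.
- by exists Sgl, Sgl; rewrite (idx_h_lead _ _ _).2.
(* The right factor has middle polynomial U_0 = 1 and matching letters, so it acts as a unit on
   leading coefficients. *)
exists (Mid a n b), (Mid b 0 b); rewrite (idx_h_lead _ _ _).2 /= !eqxx /=.
by rewrite /cheb_mult cheb0 mulr1 ucoef_cheb eqxx.
Qed.

Lemma afunE z : (afun H z)%:Z = idx_a (idx z).
Proof.
have a0 := idx_a_ge0 (idx z).
have aE : (`|idx_a (idx z)|%N)%:Z = idx_a (idx z) by rewrite gez0_abs.
rewrite -[RHS]aE; congr Posz; apply: minnatE => /= [x y|m hm].
  by apply/in_Zvinv_mono; rewrite hcoefE aE; case: (idx_h_lead (idx x) (idx y) (idx z)).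
have [i [j hij]] := idx_h_attained (idx z).
have := hm (idx_val s1 s2 i) (idx_val s1 s2 j).
rewrite hcoefE !(idx_valK hW) => /in_Zvinv_mono hd.
rewrite leqNgt; apply/negP => ma; have := hd (idx_a (idx z)).
by rewrite hij => h; have := h (_ : m%:Z < _); rewrite -{1}aE ltz_nat ma => /(_ isT).
Qed.

Lemma gammaE x y z : gammac H x y z = idx_gamma (idx x) (idx y) (idx z).
Proof.
rewrite /gammac afunE hcoefE (idx_of_inv hW) (idx_h_lead _ _ _).2.
by case: (idx z).
Qed.

(** On the elements containing s2, a is L(s2), while Delta exceeds L(s2) by L(s1) if [a] and [b]
    differ and by L(s1) + L(s2) or L(s2) - L(s1) for each unit of [n]; all of these are positive. *)
Lemma DsetE d : Dset H d <->
  match idx d with One | Sgl => True | Mid a n b => a = b /\ n = 0%N end.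
Proof.
rewrite /Dset /=; have : afun H d = Delta H d <-> idx_a (idx d) = idx_delta s1 s2 L (idx d).
  rewrite -afunE -(DeltaE hS hW hL1 hL12 H).
  by split=> [->//|[]].
move=> ->; case: (idx d) => [||a n b] //=.
have h1 : 0 <= (L s1 + L s2) *+ n by rewrite mulrn_wge0 //; lia.
have h2 : 0 <= (L s2 - L s1) *+ n by rewrite mulrn_wge0 //; lia.
case: n h1 h2 => [|n] h1 h2.
  case: a; case: b => /=; rewrite ?mulr0n ?mulr1n ?addr0; split=> //; lia.
split; last by move=> [].
clear h1 h2.
have h3 : 0 <= (L s1 + L s2) *+ n by rewrite mulrn_wge0 //; lia.
have h4 : 0 <= (L s2 - L s1) *+ n by rewrite mulrn_wge0 //; lia.
by case: a; case: b; rewrite /= ?mulrS; lia.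
Qed.

End DihedralAFunction.

(** * Cells and properties P1-P14 *)

Section DihedralCells.
Variables (W : groupType) (s1 s2 : W) (S : set W) (L : W -> int).
Hypothesis hS : S = [set s1; s2].
Hypothesis hW : infinite_dihedral s1 s2.
Hypothesis hL1 : 0 < L s1.
Hypothesis hL12 : L s1 < L s2.
Variable H : hecke_algebra S L.

Local Notation sg := (sgen s1 s2).
Local Notation idx := (idx_of s1 s2).
Local Notation gS := (gen_of hS).
Local Notation xi := (xi s1 s2 L).
Local Notation Cgen := (Cgen hS H).
Local Notation theta := (theta hS H).
Local Notation mid := (mid hS H).
Local Notation cdih := (cdih hS H).
Local Notation cidx := (cidx hS H).
Local Notation Tb := (@Tb _ _ _ H).

Let noB : no_braid S := dihedral_no_braid hS hW.


Local Notation idx_a := (idx_a s1 s2 L).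
Local Notation idx_h := (idx_h s1 s2 L).
Local Notation V := (idx_val s1 s2).
Local Notation afunE := (afunE hS hW hL1 hL12 H).
Local Notation gammaE := (gammaE hS hW hL1 hL12 H).
Local Notation DsetE := (DsetE hS hW hL1 hL12 H).
Local Notation hcoefE := (hcoefE hS hW hL1 hL12 H).


Definition gen_idx (g : bool) := if g then Mid false 0 false else Sgl.

Lemma idx_sgen g : idx (sg g) = gen_idx g.
Proof.
have -> : sg g = V (gen_idx g); last by rewrite idx_valK.
by case: g; rewrite /= ?expg0 ?mul1g ?mulg1.
Qed.

Lemma arrLE w w' :
  arrL H w w' <-> exists g, idx_h (gen_idx g) (idx w') (idx w) <> 0.
Proof.
split=> [[s hs]|[g hg]].
  have [g sE] := gen_ofP hS s; exists g; move: hs; rewrite sE val_gen_of.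
  by rewrite -/(hcoef H (sg g) w' w) hcoefE idx_sgen.
by exists (gS g); rewrite -/(hcoef H (val (gS g)) w' w) hcoefE val_gen_of idx_sgen.
Qed.

Lemma arrRE w w' :
  arrR H w w' <-> exists g, idx_h (idx w') (gen_idx g) (idx w) <> 0.
Proof.
split=> [[s hs]|[g hg]].
  have [g sE] := gen_ofP hS s; exists g; move: hs; rewrite sE val_gen_of.
  by rewrite -/(hcoef H w' (sg g) w) hcoefE idx_sgen.
by exists (gS g); rewrite -/(hcoef H w' (val (gS g)) w) hcoefE val_gen_of idx_sgen.
Qed.

Lemma idx_invK : involutive idx_inv. Proof. by case. Qed.

(** The trace on structure constants of the anti-automorphism fixing the T_s: it swaps outer
    letters, and [sandwich] is symmetric in them. Right-handed statements are deduced from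
    left-handed ones through it. *)
Lemma idx_h_inv i j k : idx_h (idx_inv i) (idx_inv j) (idx_inv k) = idx_h j i k.
Proof.
have eq_inv c : (idx_inv k == c) = (k == idx_inv c).
  by rewrite -[c in LHS]idx_invK (inj_eq (can_inj idx_invK)).
case: i => [||a m b]; case: j => [||a' n b']; rewrite /= ?eq_inv //.
case: k {eq_inv} => [||c l d] //=; rewrite andbC [cheb Zv m * _]mulrC.
by case: (a); case: (b').
Qed.

Lemma arrR_inv w w' : arrR H w w' <-> arrL H w^-1%g w'^-1%g.
Proof.
rewrite arrRE arrLE !(idx_of_inv hW); split=> -[g hg]; exists g.
  by rewrite -[gen_idx g](_ : idx_inv (gen_idx g) = _) ?idx_h_inv //; case: (g).
by rewrite -idx_h_inv (_ : idx_inv (gen_idx g) = gen_idx g) //; case: (g).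
Qed.

Lemma leR_inv w w' : leR H w w' <-> leL H w^-1%g w'^-1%g.
Proof.
split=> h.
  elim: h => [x y /arrR_inv|x|x y z _ h1 _ h2]; [exact: rt_step|exact: rt_refl|].
  exact: rt_trans h1 h2.
rewrite -[w]invgK -[w']invgK; elim: h => [x y h|x|x y z _ h1 _ h2].
- by apply: rt_step; apply/arrR_inv; rewrite !invgK.
- exact: rt_refl.
- exact: rt_trans h1 h2.
Qed.

Lemma simR_inv w w' : simR H w w' <-> simL H w^-1%g w'^-1%g.
Proof. by rewrite /simR /simL !leR_inv. Qed.

(** The elements containing s2 span an ideal, as they do together with c_{s1}, and left
    multiplication leaves the right end c_{s1}^b untouched. *)
Lemma idx_h_left i j k : idx_h i j k <> 0 -> idx_a j <= idx_a k /\
  forall a n b, j = Mid a n b -> exists c l, k = Mid c l b.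
Proof.
case: i => [||a m b]; case: j => [||a' n b']; case: k => [||c l d] //=;
  rewrite ?mulr0 // => h; split=> //; try lia; move=> a0 n0 b0 // [_ _ <-].
- by move: h; case: eqP => // -[_ _ ->]; exists c, l.
- by move: h; case: eqP => [[_ _ ->]|]; rewrite ?mulr0 //; exists c, l.
by move: h; case: ifP => // /andP[_ /eqP ->]; exists c, l.
Qed.

Lemma leL_left w w' : leL H w w' -> idx_a (idx w') <= idx_a (idx w) /\
  forall a n b, idx w' = Mid a n b -> exists c l, idx w = Mid c l b.
Proof.
elim=> [x y /arrLE[g /idx_h_left] //|x|x y z _ [a1 h1] _ [a2 h2]].
  by split=> // a n b ->; exists a, n.
split=> [|a n b /h2[c [l /h1 //]]]; exact: le_trans a2 a1.
Qed.

(** The left cells will be the classes of this relation: 1, s1, and the elements containing s2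
    sorted by whether they end in s1. *)
Definition same_left i j :=
  match i, j with
  | One, One | Sgl, Sgl => true
  | Mid _ _ b, Mid _ _ b' => b == b'
  | _, _ => false
  end.

Lemma leL_same_left w w' : leL H w w' -> idx_a (idx w) = idx_a (idx w') ->
  same_left (idx w) (idx w').
Proof.
move=> /leL_left[_]; case: (idx w') => [||a' n' b'] h; last first.
  by have [c [l ->]] := h _ _ _ erefl; rewrite /= eqxx.
all: by case: (idx w) => [||a n b] //=; lia.
Qed.

Lemma leL_val g i j : idx_h (gen_idx g) j i <> 0 -> leL H (V i) (V j).
Proof. by move=> h; apply/rt_step/arrLE; exists g; rewrite !(idx_valK hW). Qed.

Lemma natr1_neq0 : (1 : Zv) <> 0.
Proof. by apply/eqP; apply: oner_neq0. Qed.

Lemma zeta_neq0 : zeta s1 s2 L <> 0.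
Proof.
move=> /(congr1 (fun p => lcoef p (L s2 - L s1))).
rewrite /zeta lcoefDr !lcoef_mono eqxx lcoef0r.
by have -> : (L s2 - L s1 == L s1 - L s2) = false by apply/eqP; lia.
Qed.

Lemma leL_mid_up n b : leL H (V (Mid true n b)) (V (Mid false n b)).
Proof.
apply: (@leL_val false); rewrite /= eqxx mulr1; exact: natr1_neq0.
Qed.

Lemma ucoef_one_mid n k : idx_h (gen_idx true) (Mid true n false) (Mid false k false) =
  ucoef k (cheb Zv n.+1) + ucoef k (cheb_pred Zv n) + zeta s1 s2 L * ucoef k (cheb Zv n).
Proof.
rewrite /= cheb0 mul1r /cheb_shift mulrDr linearD /= [_ * 'X]mulrC mulX_cheb linearD /=.
by rewrite [_ * _%:P]mulrC mul_polyC linearZ.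
Qed.

(** c_{s2} c_{s1} U_n(X) c_{s2} is (X + [zeta]) U_n(X) c_{s2}: X reaches the two neighbours of n,
    and [zeta], being nonzero, reaches n itself. *)
Lemma leL_mid_down n k b :
  [\/ k = n, k = n.+1 | n = k.+1] -> leL H (V (Mid false k b)) (V (Mid true n b)).
Proof.
move=> h; apply: (@leL_val true).
have -> : idx_h (gen_idx true) (Mid true n b) (Mid false k b) =
    idx_h (gen_idx true) (Mid true n false) (Mid false k false) by rewrite /= !eqxx.
have neq (m m' : nat) : m <> m' -> (m == m')%N = false by move=> ?; apply/eqP.
rewrite ucoef_one_mid !ucoef_cheb; case: h => [->|->|->].
- rewrite eqxx mulr1 (neq n n.+1); last by lia.
  case: n => [|n]; rewrite /cheb_pred ?linear0 ?ucoef_cheb ?(neq n.+1 n) ?add0r; try lia;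
  exact: zeta_neq0.
- rewrite eqxx (neq n.+1 n) ?mulr0 ?addr0; last by lia.
  case: n => [|n]; rewrite /cheb_pred ?linear0 ?ucoef_cheb ?(neq n.+2 n) ?addr0; try lia;
  exact: natr1_neq0.
rewrite (neq k k.+2) ?(neq k k.+1) ?mulr0 ?addr0 ?add0r; try lia.
by rewrite /= ucoef_cheb eqxx; apply: natr1_neq0.
Qed.

Lemma leL_mid0 n b : leL H (V (Mid false n b)) (V (Mid false 0 b)) /\
  leL H (V (Mid false 0 b)) (V (Mid false n b)).
Proof.
elim: n => [|n [IH1 IH2]]; first by split; apply: rt_refl.
split.
  apply: rt_trans IH1; apply: rt_trans (leL_mid_up n b).
  by apply: leL_mid_down; constructor 2.
apply: rt_trans IH2 _; apply: rt_trans (leL_mid_up n.+1 b).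
by apply: leL_mid_down; constructor 3.
Qed.

Lemma leL_mid a n a' n' b : leL H (V (Mid a n b)) (V (Mid a' n' b)).
Proof.
have to0 c k : leL H (V (Mid c k b)) (V (Mid false k b)).
  by case: c; [apply: leL_mid_up | apply: rt_refl].
have from0 c k : leL H (V (Mid false k b)) (V (Mid c k b)).
  by case: c; [apply: leL_mid_down; constructor 1 | apply: rt_refl].
apply: rt_trans (to0 a n) _; apply: rt_trans (leL_mid0 n b).1 _.
exact: rt_trans (leL_mid0 n' b).2 (from0 a' n').
Qed.

Lemma simL_same_left w w' : simL H w w' <-> same_left (idx w) (idx w').
Proof.
split=> [[h1 h2]|].
  apply: leL_same_left => //; apply: le_anti.
  by rewrite (leL_left h1).1 (leL_left h2).1.
rewrite -{2}(idx_ofK hW w) -{2}(idx_ofK hW w').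
case: (idx w) => [||a n b]; case: (idx w') => [||a' n' b'] //=;
  do ?[by move=> _; split; apply: rt_refl].
by move=> /eqP ->; split; apply: leL_mid.
Qed.

Lemma idx_a_inv i : idx_a (idx_inv i) = idx_a i. Proof. by case: i. Qed.

Lemma leLR_a w w' : leLR H w w' -> idx_a (idx w') <= idx_a (idx w).
Proof.
elim=> [x y [/arrLE[g /idx_h_left[]]//|]|//|x y z _ h1 _ h2]; last exact: le_trans h2 h1.
by move=> /arrR_inv/arrLE[g /idx_h_left[]]; rewrite !(idx_of_inv hW) !idx_a_inv.
Qed.

Lemma leL_leLR w w' : leL H w w' -> leLR H w w'.
Proof.
elim=> [x y h|x|x y z _ h1 _ h2]; [by apply: rt_step; left|exact: rt_refl|].
exact: rt_trans h1 h2.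
Qed.

Lemma leR_leLR w w' : leR H w w' -> leLR H w w'.
Proof.
elim=> [x y h|x|x y z _ h1 _ h2]; [by apply: rt_step; right|exact: rt_refl|].
exact: rt_trans h1 h2.
Qed.

(** The values 0 < L(s1) < L(s2) separate 1, s1 and the remaining elements. Among the latter a left
    move adjusts the left letter and the middle index, and a right move the right letter. *)
Lemma leLR_mid i j : idx_a i = idx_a j -> leLR H (V i) (V j).
Proof.
case: i => [||a n b]; case: j => [||a' n' b'] h; do ?[exact: rt_refl];
  do ?[by move: h => /=; lia].
apply: (@rt_trans _ _ _ (V (Mid a' n' b))); first exact/leL_leLR/leL_mid.
apply: leR_leLR; apply/leR_inv; rewrite -!(idx_val_inv hW).
exact: (leL_mid b n' b' n' a').
Qed.

Lemma simLR_of_a w w' : idx_a (idx w) = idx_a (idx w') -> simLR H w w'.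
Proof.
move=> h; split; rewrite -(idx_ofK hW w) -(idx_ofK hW w');
  by apply: leLR_mid.
Qed.

Lemma afun_eq z z' : afun H z = afun H z' <-> idx_a (idx z) = idx_a (idx z').
Proof. by rewrite -!afunE; split=> [->|[]]. Qed.

Lemma gamma_neq0 x y z : gammac H x y z <> 0 ->
  [\/ [/\ idx x = One, idx y = One & idx z = One],
      [/\ idx x = Sgl, idx y = Sgl & idx z = Sgl] |
      exists a m b n c l, [/\ idx x = Mid a m b, idx y = Mid b n c,
        idx z = Mid c l a & gammac H x y z = cheb_mult int m n l]].
Proof.
rewrite gammaE; case: (idx x) => [||a m b]; case: (idx y) => [||b' n c];
  case: (idx z) => [||c' l a'] //= h.
- by constructor 1.
- by constructor 2.
move: h; case: ifP => // /and3P[/eqP <- /eqP <- /eqP ->] _.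
by constructor 3; exists a, m, b, n, c, l.
Qed.

Lemma P1_dihedral : P1 H.
Proof.
move=> z; rewrite -lez_nat afunE (DeltaE hS hW hL1 hL12 H).
case: (idx z) => [||a n b] //=.
have h1 : 0 <= (L s1 + L s2) *+ n by rewrite mulrn_wge0 //; lia.
have h2 : 0 <= (L s2 - L s1) *+ n by rewrite mulrn_wge0 //; lia.
by rewrite mulrS; case: a; case: b => /=; lia.
Qed.

Lemma idx_inj : injective idx.
Proof. by move=> x y E; rewrite -(idx_ofK hW x) E idx_ofK. Qed.

Lemma mid_Dset d c l a : idx d = Mid c l a -> Dset H d -> c = a /\ l = 0%N.
Proof. by move=> dE /DsetE; rewrite dE. Qed.

(** An element of D containing s2 has middle index 0, and the multiplicity of U_0 in U_m U_n is
    nonzero only for m = n. *)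
Lemma P2_dihedral : P2 H.
Proof.
move=> d x y dD h; apply: idx_inj; rewrite (idx_of_inv hW).
have [[-> -> _]|[-> -> _]|[a [m [b [n [c [l [-> -> dE g]]]]]]]] := gamma_neq0 h; try by [].
have [-> l0] := mid_Dset dE dD.
by move: h; rewrite g l0 cheb_mult0 /=; case: eqP => // ->.
Qed.

(** The element of D in the left cell: 1, s1, s2 or s1 s2 s1. *)
Definition idx_d i := if i is Mid a n b then Mid b 0 b else i.

Lemma Dset_idx_d i : Dset H (V (idx_d i)).
Proof. by apply/DsetE; rewrite (idx_valK hW); case: i. Qed.

Lemma gamma_idx_d y : gammac H y^-1%g y (V (idx_d (idx y))) = 1.
Proof.
rewrite gammaE (idx_of_inv hW) (idx_valK hW); case: (idx y) => [||a n b] //=.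
by rewrite !eqxx cheb_mult0 eqxx.
Qed.

Lemma gamma_Dset_unique y d : Dset H d -> gammac H y^-1%g y d <> 0 ->
  d = V (idx_d (idx y)).
Proof.
move=> dD h; apply: idx_inj; rewrite (idx_valK hW).
have [[_ -> ->]|[_ -> ->]|[a [m [b [n [c [l [_ -> dE _]]]]]]]] := gamma_neq0 h; try by [].
by have [ca l0] := mid_Dset dE dD; rewrite dE ca l0; have [<- _] := mid_Dset dE dD; rewrite ca.
Qed.

Lemma P3_dihedral : P3 H.
Proof.
move=> y; exists (V (idx_d (idx y))); split; first split.
- exact: Dset_idx_d.
- by rewrite gamma_idx_d.
by move=> d [dD h]; rewrite (gamma_Dset_unique dD h).
Qed.

Lemma P4_dihedral : P4 H.
Proof.
have h z' z : leLR H z' z -> (afun H z <= afun H z')%N.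
  by move=> /leLR_a; rewrite -lez_nat !afunE.
split=> [|z' z [h1 h2]]; first exact: h.
by apply/eqP; rewrite eqn_leq !h.
Qed.

Lemma P5_dihedral : P5 H.
Proof.
move=> d y dD h; have dE := gamma_Dset_unique dD h.
(* A sign (-1)^n occurs only on the [Mid false n false], and n = 0 for elements of D. *)
suff -> : ncoef H d = 1 by rewrite dE gamma_idx_d; split=> //; left.
rewrite (ncoefE hS hW hL1 hL12 H) dE (idx_valK hW).
by case: (idx y) => [||a n []].
Qed.

Lemma P6_dihedral : P6 H.
Proof.
move=> d /DsetE dD; rewrite expg2 -{2}[d]invgK; apply/eqP; rewrite mulg_eq1 invgK.
apply/eqP/idx_inj; rewrite (idx_of_inv hW).
by case: (idx d) dD => [||a n b] //= [-> ->].
Qed.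

(** The Chebyshev multiplicities and the matching of adjacent outer letters are both invariant under
    rotation. *)
Lemma P7_dihedral : P7 H.
Proof.
move=> x y z; rewrite !gammaE.
case: (idx x) => [||a m b]; case: (idx y) => [||b' n c];
  case: (idx z) => [||c' l a'] //=.
rewrite cheb_mult_rot; congr (if _ then _ else _).
by rewrite andbC -andbA.
Qed.

Lemma P8_dihedral : P8 H.
Proof.
move=> x y z h; split; apply/simL_same_left; rewrite (idx_of_inv hW).
all: by have [[xE yE zE]|[xE yE zE]|[a [m [b [n [c [l [xE yE zE _]]]]]]]] :=
  gamma_neq0 h; rewrite ?xE ?yE ?zE /= ?eqxx.
Qed.

Lemma P9_dihedral : P9 H.
Proof. by move=> z' z h /afun_eq e; apply/simL_same_left/leL_same_left. Qed.

Lemma P10_dihedral : P10 H.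
Proof.
move=> z' z /leR_inv h /afun_eq e; apply/simR_inv/simL_same_left/leL_same_left => //.
by rewrite !(idx_of_inv hW) !idx_a_inv.
Qed.

Lemma P11_dihedral : P11 H.
Proof. by move=> z' z _ /afun_eq; apply: simLR_of_a. Qed.

Lemma P13_dihedral : P13 H.
Proof.
move=> G [w ->]; have cell x : simL H x w -> idx_d (idx x) = idx_d (idx w).
  move/simL_same_left; case: (idx x) => [||a n b]; case: (idx w) => [||a' n' b'] //=.
  by move=> /eqP ->.
exists (V (idx_d (idx w))); split.
- split; last exact: Dset_idx_d.
  by apply/simL_same_left; rewrite (idx_valK hW); case: (idx w) => [||a n b] /=.
- move=> d /cell <- /DsetE dD; apply: idx_inj; rewrite (idx_valK hW).
  by case: (idx d) dD => [||a n b] //= [-> ->].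
- by move=> x /cell <-; rewrite gamma_idx_d.
Qed.

Lemma P14_dihedral : P14 H.
Proof. by move=> z; apply: simLR_of_a; rewrite (idx_of_inv hW) idx_a_inv. Qed.

(** L(s2), the largest value of a, bounds the degree of every [hcoef]. *)
Lemma bounded_dihedral : bounded H.
Proof.
apply: (bounded_of_hcoef noB (cdih_is_basis hS hW H) (cdih_bar hS hW H)
  (cdih_tri hS hW hL1 hL12 H) (N := `|L s2|%N)).
move=> x y z; rewrite hcoefE gez0_abs; last by lia.
by apply: ldeg_le_trans (idx_h_lead hL1 hL12 _ _ _).1; case: (idx z) => [||a n b] /=; lia.
Qed.

End DihedralCells.

(** * Property P15 *)

Section DihedralP15.
Variables (W : groupType) (s1 s2 : W) (S : set W) (L : W -> int).
Hypothesis hS : S = [set s1; s2].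
Hypothesis hW : infinite_dihedral s1 s2.
Hypothesis hL1 : 0 < L s1.
Hypothesis hL12 : L s1 < L s2.
Variable H : hecke_algebra S L.

Local Notation idx := (idx_of s1 s2).
Local Notation gS := (gen_of hS).
Local Notation xi := (xi s1 s2 L).
Local Notation Cgen := (Cgen hS H).
Local Notation theta := (theta hS H).
Local Notation mid := (mid hS H).
Local Notation cdih := (cdih hS H).
Local Notation cidx := (cidx hS H).
Local Notation Tb := (@Tb _ _ _ H).



Local Notation idx_a := (idx_a s1 s2 L).
Local Notation idx_h := (idx_h s1 s2 L).
Local Notation V := (idx_val s1 s2).
Local Notation afunE := (afunE hS hW hL1 hL12 H).
Local Notation gammaE := (gammaE hS hW hL1 hL12 H).
Local Notation DsetE := (DsetE hS hW hL1 hL12 H).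
Local Notation hcoefE := (hcoefE hS hW hL1 hL12 H).


Lemma sum_idx_supp (A : nmodType) (F : W -> A) (r : seq dihedral_index) :
  uniq r -> (forall i, i \notin r -> F (V i) = 0) ->
  \sum_(w \in [set: W]) F w = \sum_(i <- r) F (V i).
Proof.
move=> ru hF; rewrite (fsbigE [seq V i | i <- r]) //=.
- by rewrite big_map; apply: eq_bigl => i; rewrite in_setT.
- by rewrite map_inj_uniq //; apply: idx_val_inj.
move=> w _ wr; rewrite -(idx_ofK hW w); apply: hF; apply: contra wr => ir.
by apply/mapP; exists (idx w); rewrite ?(idx_ofK hW).
Qed.

(* Matrix coefficients of the left action of c_i on the span of the [mid a _ b],
   b being fixed. *)
Definition left_coef i (c a : bool) : {poly Zv} :=
  match i with
  | One => (c == a)%:R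
  | Sgl => if c then (xi1_pow s1 s2 L a)%:P else 0
  | Mid a0 m b0 => if c == a0 then cheb Zv m * sandwich s1 s2 L b0 a else 0
  end.

Lemma idx_h_left_mid i a n b c k d : idx_h i (Mid a n b) (Mid c k d) =
  if b == d then ucoef k (cheb Zv n * left_coef i c a) else 0.
Proof.
have eqM x y (z : bool) x' y' z' : (Mid x y z == Mid x' y' z') = [&& x == x', y == y' & z == z'].
  by apply/eqP/and3P => [[-> -> ->]|[/eqP -> /eqP -> /eqP ->]].
case: i => [||a0 m b0] /=; rewrite ?eqM.
- rewrite [d == b]eq_sym; case: (b == d); rewrite ?andbF // andbT.
  by case: (c == a); rewrite ?mulr0 ?linear0 ?mulr1 ?ucoef_cheb.
- rewrite [d == b]eq_sym; case: (b == d); rewrite ?andbF ?mulr0 // andbT.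
  case: c; rewrite /= ?mulr0 ?linear0 // mulrC -[X in ucoef _ X]mulrC mul_polyC.
  by rewrite linearZ /= ucoef_cheb mulrC.
rewrite [d == b]eq_sym; case: (b == d); rewrite ?andbF // andbT.
by case: (c == a0); rewrite ?mulr0 ?linear0 // [cheb Zv m * _]mulrC -mulrA.
Qed.

Lemma idx_h_right_mid j a n b c k d : idx_h (Mid a n b) j (Mid c k d) =
  if a == c then ucoef k (cheb Zv n * left_coef (idx_inv j) d b) else 0.
Proof.
rewrite -idx_h_left_mid.
by have := idx_h_inv s1 s2 L (Mid b n a) (idx_inv j) (Mid d k c); rewrite idx_invK => <-.
Qed.

Lemma idx_h_right i j k : idx_h i j k <> 0 -> idx_a i <= idx_a k /\
  forall a n b, i = Mid a n b -> exists l d, k = Mid a l d.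
Proof.
rewrite -idx_h_inv => /(idx_h_left hL1 hL12)[h1 h2]; split; first by rewrite !idx_a_inv in h1.
move=> a n b iE; have [c [l kE]] := h2 b n a (congr1 idx_inv iE).
by exists l, c; rewrite -(idx_invK k) kE.
Qed.

Section TwoVariables.
Let R2 : comNzRingType := laurent Zv.
Let iv : {rmorphism Zv -> R2} := @lconst Zv.
Let iv' : {rmorphism Zv -> R2} := lmap (@lconst int).

(* The operators p |-> ucoef k (cheb j * p) are multiplication matrices on
   polynomials, hence commute even with coefficients in different variables. *)
Lemma ucoef_two_variables (P Q : {poly Zv}) n k :
  exists M, forall M', (M <= M')%N ->
  [/\ (forall j, (M' <= j)%N -> ucoef j (cheb Zv n * P) = 0),
      (forall j, (M' <= j)%N -> ucoef j (cheb Zv n * Q) = 0) &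
   \sum_(j < M') iv' (ucoef j (cheb Zv n * P)) * iv (ucoef k (cheb Zv j * Q)) =
   \sum_(j < M') iv (ucoef j (cheb Zv n * Q)) * iv' (ucoef k (cheb Zv j * P))].
Proof.
have vanish (p : {poly Zv}) M : (forall N, (M <= N)%N -> p = \sum_(i < N) ucoef i p *: cheb Zv i) ->
    forall j, (M <= j)%N -> ucoef j p = 0.
  move=> hp j Mj; rewrite [in LHS](hp M) // linear_sum big1 // => i _.
  rewrite linearZ /= ucoef_cheb (_ : (j == i)%N = false) ?mulr0 //.
  by apply/negbTE; rewrite neq_ltn (leq_trans (ltn_ord i) Mj) orbT.
have [M1 h1] := cheb_expansion (cheb Zv n * P).
have [M2 h2] := cheb_expansion (cheb Zv n * Q).
exists (maxn M1 M2) => M'; rewrite geq_max => /andP[m1 m2]; split.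
- by move=> j /(leq_trans m1); apply: vanish.
- by move=> j /(leq_trans m2); apply: vanish.
have expand (f : {rmorphism Zv -> R2}) (p : {poly Zv}) M : p = \sum_(i < M) ucoef i p *: cheb Zv i ->
    map_poly f p = \sum_(i < M) ucoef i (map_poly f p) *: cheb R2 i.
  move=> hp; rewrite [in LHS]hp rmorph_sum; apply: eq_bigr => i _.
  by rewrite /= map_polyZ map_cheb ucoef_map.
have E (f g : {rmorphism Zv -> R2}) (p q : {poly Zv}) :
    cheb Zv n * p = \sum_(i < M') ucoef i (cheb Zv n * p) *: cheb Zv i ->
    \sum_(j < M') f (ucoef j (cheb Zv n * p)) * g (ucoef k (cheb Zv j * q)) =
    ucoef k (cheb R2 n * map_poly f p * map_poly g q).
  move=> /(expand f); rewrite rmorphM /= map_cheb => hp.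
  rewrite [in RHS]hp mulr_suml linear_sum; apply: eq_bigr => j _.
  rewrite -scalerAl linearZ /= -!ucoef_map !rmorphM /= !map_cheb.
  by [].
rewrite E; last exact: h1.
rewrite E; last exact: h2.
by congr ucoef; rewrite mulrAC.
Qed.

End TwoVariables.

Lemma idx_h_One i j : idx_h i j One = ((i == One) && (j == One))%:R.
Proof. by case: i => [||a m b]; case: j => [||a' n b'] //=; rewrite ?mulr0. Qed.

Lemma P15_dihedral : P15 H.
Proof.
move=> x x' y w /(afun_eq hS hW hL1 hL12 H) aE.
pose F y' := lmap (@lconst int) (hcoef H w x' y') * lconst (hcoef H x y' y).
pose G y' := lconst (hcoef H x w y') * lmap (@lconst int) (hcoef H y' x' y).
change (\sum_(y' \in [set: W]) F y' = \sum_(y' \in [set: W]) G y').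
have FE i : F (V i) =
    lmap (@lconst int) (idx_h (idx w) (idx x') i) * lconst (idx_h (idx x) i (idx y)).
  by rewrite /F !hcoefE (idx_valK hW).
have GE i : G (V i) =
    lconst (idx_h (idx x) (idx w) i) * lmap (@lconst int) (idx_h i (idx x') (idx y)).
  by rewrite /G !hcoefE (idx_valK hW).
move: F G FE GE => F G FE GE.
move: (idx x) (idx x') (idx y) (idx w) aE FE GE => i i' k l.
have Fnz j : F (V j) = lmap (@lconst int) (idx_h l i' j) * lconst (idx_h i j k) ->
    F (V j) <> 0 -> idx_h l i' j <> 0 /\ idx_h i j k <> 0.
  by move=> -> h; split=> e; apply: h; rewrite e rmorph0 ?mul0r ?mulr0.
have Gnz j : G (V j) = lconst (idx_h i l j) * lmap (@lconst int) (idx_h j i' k) ->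
    G (V j) <> 0 -> idx_h i l j <> 0 /\ idx_h j i' k <> 0.
  by move=> -> h; split=> e; apply: h; rewrite e rmorph0 ?mul0r ?mulr0.
move=> aE FE GE.
have F0 (r : seq dihedral_index) : (forall j, idx_h l i' j <> 0 -> idx_h i j k <> 0 -> j \in r) ->
    forall j, j \notin r -> F (V j) = 0.
  move=> hr j jr; apply: contrapT => /(Fnz j (FE j))[h1 h2].
  by rewrite (hr j h1 h2) in jr.
have G0 (r : seq dihedral_index) : (forall j, idx_h i l j <> 0 -> idx_h j i' k <> 0 -> j \in r) ->
    forall j, j \notin r -> G (V j) = 0.
  move=> hr j jr; apply: contrapT => /(Gnz j (GE j))[h1 h2].
  by rewrite (hr j h1 h2) in jr.
case: l k aE FE GE F0 G0 {Fnz Gnz} => [||a n b] [||c m d] aE FE GE F0 G0;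
  try by move: aE => /=; lia.
(* Here w = y = 1. The intermediate element is x' on one side and x on the other, and both sums
   vanish unless x = x' = 1. *)
- rewrite (@sum_idx_supp _ F [:: i']) // ?(@sum_idx_supp _ G [:: i]) //.
  + rewrite !big_seq1 FE GE !idx_h_One.
    have -> : idx_h i One i = 1 by case: (i) => [||? ? ?]; rewrite /= ?eqxx.
    by rewrite /= eqxx !rmorph_nat.
  + apply: G0 => j; case: i {FE GE F0} => [||? ? ?] /=; case: eqP => // -> _ _;
    by rewrite inE.
  + by apply: F0 => j /=; case: eqP => // -> _ _; rewrite inE.
(* Here w = y = s1. The intermediate element has a at most L(s1), and it is not 1, which arises only
   from 1 times 1; so it is s1 in both sums. *)
- have sgl j i0 : idx_h i0 j Sgl <> 0 -> idx_a j <= L s1.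
    by move=> /(idx_h_left hL1 hL12)[].
  rewrite (@sum_idx_supp _ F [:: Sgl]) // ?(@sum_idx_supp _ G [:: Sgl]) //.
  + by rewrite !big_seq1 FE GE mulrC.
  + apply: G0 => -[||a n b]; rewrite ?inE //.
      by rewrite idx_h_One /= andbF.
    by move=> _ /idx_h_right[] /=; lia.
  + apply: F0 => -[||a n b]; rewrite ?inE //.
      by rewrite idx_h_One.
    by move=> _ /(idx_h_left hL1 hL12)[] /=; lia.
(* The right action of x' turns the letter [b] into [d], the left action of x turns [a] into [c].
   The intermediate elements are the [Mid a j d] on one side and the [Mid c j b] on the other; [M]
   bounds [j] in both sums. *)
have [M /(_ M (leqnn M))[vP vQ E]] :=
  ucoef_two_variables (left_coef (idx_inv i') d b) (left_coef i c a) n m.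
rewrite (@sum_idx_supp _ F [seq Mid a j d | j <- iota 0 M]); last 2 first.
- by rewrite map_inj_uniq ?iota_uniq // => j j' [].
- apply: F0 => j h1 h2.
  have [_ /(_ a n b erefl)[j1 [d1 jE]]] := idx_h_right h1.
  have [_ /(_ _ _ _ jE)[c2 [l2 [_ _ dE]]]] := idx_h_left hL1 hL12 h2.
  rewrite jE -dE map_f // mem_iota /= add0n ltnNge; apply/negP => Mj; case: h1.
  by rewrite jE idx_h_right_mid eqxx -dE vP.
rewrite (@sum_idx_supp _ G [seq Mid c j b | j <- iota 0 M]); last 2 first.
- by rewrite map_inj_uniq ?iota_uniq // => j j' [].
- apply: G0 => j h1 h2.
  have [_ /(_ a n b erefl)[c1 [j1 jE]]] := idx_h_left hL1 hL12 h1.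
  have [_ /(_ _ _ _ jE)[l2 [d2 [cE _ _]]]] := idx_h_right h2.
  rewrite jE -cE map_f // mem_iota /= add0n ltnNge; apply/negP => Mj; case: h1.
  by rewrite jE idx_h_left_mid eqxx -cE vQ.
rewrite !big_map -[M in iota 0 M]subn0 -/(index_iota 0 M) !big_mkord.
transitivity (\sum_(j < M) lmap (@lconst int) (ucoef j (cheb Zv n * left_coef (idx_inv i') d b))
   * lconst (ucoef m (cheb Zv j * left_coef i c a))).
  by apply: eq_bigr => j _; rewrite FE idx_h_right_mid idx_h_left_mid !eqxx.
rewrite [LHS]E; apply: eq_bigr => j _.
by rewrite GE idx_h_right_mid idx_h_left_mid !eqxx.
Qed.

End DihedralP15.

(** * Parabolic subgroups *)

Lemma afun_eq_of_lead (W : groupType) (S : set W) (L : W -> int)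
    (H : hecke_algebra S L) (z : W) (n : nat) :
  (forall x y, ldeg_le n (hcoef H x y z)) ->
  (exists x y, lcoef (hcoef H x y z) n <> 0) -> afun H z = n.
Proof.
move=> hd [x [y hxy]]; apply: minnatE => [x' y'|m hm]; first exact/in_Zvinv_mono.
rewrite leqNgt; apply/negP => mn; apply: hxy.
by have /in_Zvinv_mono := hm x y; apply; rewrite ltz_nat.
Qed.

(** * The trivial parabolic subgroup *)

Section RankZero.
Variables (W : groupType) (S : set W) (L : W -> int) (H : hecke_algebra S L).
Hypothesis S0 : S = set0.
Hypothesis W1 : forall w : W, w = 1%g.

Let noS (s : S) : False. Proof. by have := set_mem (valP s); rewrite [X in X _ -> _]S0. Qed.

Lemma rank0_basis : is_basis (fun _ : W => 1 : H).
Proof.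
have rel : @hecke_relations W S L Zv^o (fun _ => 0).
  by split=> [s|s]; case: (noS s).
have [f _] := hecke_lift H rel.
apply: (@dual_is_basis _ _ _ _ (fun _ x => f x : Zv)) => [w a x y|x|w u].
- by rewrite linearP.
- elim/hecke_ind: x => [|a x y|x y [g ->] [h ->]|s]; last by case: (noS s).
  + exact: (in_span_base (fun _ : W => 1 : H) 1%g).
  + exact: in_span_linear.
  rewrite mulr_suml; apply: in_span_sum => w _; rewrite -scalerAl mul1r.
  by apply: in_spanZ; exists h.
by rewrite rmorph1 (W1 w) (W1 u) eqxx.
Qed.

Lemma rank0_afun w : afun H w = 0%N.
Proof.
have bP := rank0_basis.
have noB : no_braid S by move=> s; case: (noS s).
have TbE : @Tb _ _ _ H = fun=> 1.
  by apply: (@Tb_charact _ _ (fun=> 0%N)) => // u; rewrite (W1 u).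
have cE : @cb _ _ _ H = fun=> 1.
  apply: (@cbE _ _ _ _ (fun=> 0%N) _ noB bP) => u.
    by have [_ _ f1 _ _] := barP H noB.
  by rewrite TbE subrr; apply: tri0.
have h x y z : hcoef H x y z = 1.
  rewrite /hcoef cE mulr1; have := coords_base bP 1%g z.
  by rewrite (W1 z) eqxx.
apply: afun_eq_of_lead => [x y|]; first by rewrite h; apply: ldeg_le_mono.
by exists 1%g, 1%g; rewrite h lcoef1r.
Qed.

End RankZero.

(** * Parabolic subgroups of order two *)

Section RankOne.
Variables (W : groupType) (s : W) (S : set W) (L : W -> int).
Hypothesis hS : S = [set s].
Hypothesis hW : forall w : W, w = 1%g \/ w = s.
Hypothesis s1 : s <> 1%g.
Hypothesis ss : (s * s = 1)%g.
Hypothesis Ls : 0 < L s.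
Variable H : hecke_algebra S L.

Lemma rank1_gen : S s. Proof. by rewrite hS. Qed.
Let g : S := SigSub (mem_set rank1_gen).

Let gP (s' : S) : s' = g.
Proof.
apply: val_inj; have := set_mem (valP s').
by rewrite [X in X _ -> _]hS.
Qed.

Let noB : no_braid S.
Proof. by move=> s' s''; rewrite (gP s') (gP s''). Qed.

Let xi : Zv := 'v^(L s) + 'v^(- L s).
Let C : H := hecke_gen H g + ('v^(- L s))%:A.

Let sN1 : (1%g == s) = false. Proof. by apply/eqP => e; case: s1. Qed.

Lemma rank1_sqr : C * C = xi *: C.
Proof.
have /eqP := (hecke_gen_rel H).1 g; rewrite mulrBl subr_eq0 => /eqP E.
by rewrite {1}/C mulrDl E -!scalerAl !mul1r -scalerDl.
Qed.

Definition rank1_cb (w : W) : H := if w == s then C else 1.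
Definition rank1_Tb (w : W) : H := if w == s then hecke_gen H g else 1.

(** Left multiplication by c_s in the basis formed by 1 and c_s. *)
Let M : 'M[Zv]_2 := \matrix_(i, j) if i == 0 then 0 else if j == 0 then 1 else xi.

Lemma rank1_basis : is_basis rank1_cb.
Proof.
have MM : M * M = xi *: M.
  apply/matrixP => i j; rewrite !mxE !big_ord_recl big_ord0 !mxE.
  by case: i => [[|[|i]] hi] //; case: j => [[|[|j]] hj] //=; ring.
have rel : @hecke_relations W S L 'M[Zv]_2 (fun _ => M - ('v^(- L s))%:A).
  split=> [s'|s' s'' m ss' om]; last by case: (noB ss' om).
  by rewrite (gP s'); apply: shifted_quadratic.
have [f fT] := hecke_lift H rel.
have fC : f C = M by rewrite /C rmorphD /= fT rmorph_alg subrK.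
pose phi w x : Zv := if w == s then f x 1 0 else f x 0 0.
apply: (@dual_is_basis _ _ _ _ phi) => [w a x y|x|w u].
- by rewrite /phi; case: ifP => _; rewrite linearP !mxE.
- suff h : forall y, in_span rank1_cb y -> in_span rank1_cb (x * y).
    rewrite -[x]mulr1; apply: h; have := in_span_base rank1_cb 1%g.
    by rewrite /rank1_cb sN1.
  elim/hecke_ind: x => [|a x x' hx hx'|x x' hx hx'|s'] y hy.
  + by rewrite mul1r.
  + by rewrite mulrDl -scalerAl; apply: in_span_linear; [apply: hx|apply: hx'].
  + by rewrite -mulrA; apply/hx/hx'.
  rewrite (gP s') -[hecke_gen H g](addrK ('v^(- L s))%:A) -/C.
  rewrite mulrBl addrC -scalerAl mul1r -scaleNr; apply: in_span_linear => //.
  have [k ->] := hy; rewrite mulr_sumr; apply: in_span_sum => w _.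
  rewrite -scalerAr; apply: in_spanZ.
  have hC : in_span rank1_cb C.
    by have := in_span_base rank1_cb s; rewrite /rank1_cb eqxx.
  by rewrite /rank1_cb; case: eqP => _; rewrite ?mulr1 // rank1_sqr; apply: in_spanZ.
have [->|->] := hW w; have [->|->] := hW u; rewrite /phi /rank1_cb ?eqxx ?sN1 ?fC ?rmorph1 ?mxE //=.
by rewrite eq_sym sN1.
Qed.

Lemma rank1_TbE : @Tb _ _ _ H = rank1_Tb.
Proof.
have sN : (s == 1%g) = false by rewrite eq_sym sN1.
apply: (@Tb_charact _ _ (fun w => (w == s) : nat)).
- by rewrite sN1.
- by move=> s' w; case: (_ == s); case: (_ == s).
- move=> w w1; exists g, 1%g; rewrite mulg1 sN1.
  by have [e|e] := hW w; [case: w1 | rewrite e eqxx].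
- by rewrite /rank1_Tb sN1.
move=> s' w; rewrite (gP s') /rank1_Tb -[val g]/s.
by have [->|->] := hW w; rewrite ?mulg1 ?ss ?eqxx ?sN1 ?mulr1.
Qed.

Lemma rank1_cbE : @cb _ _ _ H = rank1_cb.
Proof.
have [fD _ f1 _ [fZ _]] := barP H noB.
apply: (@cbE _ _ _ _ (fun w => (w == s) : nat) _ noB rank1_basis) => w.
  rewrite /rank1_cb; case: eqP => _ //.
  rewrite /C fD fZ f1 bar_gen // lbar_mono opprK scalerBl opprB.
  by rewrite -addrA subrK.
have E : rank1_cb w - rank1_Tb w = if w == s then 'v^(- L s) *: rank1_Tb 1%g else 0.
  rewrite /rank1_cb /rank1_Tb sN1; case: eqP => _; last exact: subrr.
  by rewrite /C addrC addKr.
rewrite rank1_TbE E; case: eqP => _; last exact: tri0.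
by apply: tri_term; [apply: ldeg_le_mono; lia | rewrite sN1].
Qed.

Lemma rank1_hcoef x y z : hcoef H x y z =
  if (x == s) && (y == s) then xi * (z == s)%:R
  else (z == if (x == s) || (y == s) then s else 1%g)%:R.
Proof.
rewrite /hcoef rank1_cbE; have bP := rank1_basis.
have coordC w : coords rank1_cb C w = (w == s)%:R.
  by have := coords_base bP s w; rewrite {2}/rank1_cb eqxx.
have coord1 w : coords rank1_cb 1 w = (w == 1%g)%:R.
  by have := coords_base bP 1%g w; rewrite {2}/rank1_cb sN1.
rewrite /rank1_cb; case: (x == s); case: (y == s) => /=;
  rewrite ?mulr1 ?mul1r ?coordC ?coord1 //.
by rewrite rank1_sqr coordsZ // coordC.
Qed.

Lemma rank1_afun w : (afun H w)%:Z = if w == s then L s else 0.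
Proof.
have [->|->] := hW w.
  rewrite sN1; congr Posz; apply: afun_eq_of_lead => [x y|].
    rewrite rank1_hcoef sN1 mulr0; case: ifP => _; first exact: ldeg_le0.
    exact: ldeg_nat.
  by exists 1%g, 1%g; rewrite rank1_hcoef sN1 /= eqxx lcoef1r.
rewrite eqxx -[L s](gez0_abs (ltW Ls)); congr Posz.
apply: afun_eq_of_lead => [x y|].
  rewrite rank1_hcoef eqxx mulr1 gez0_abs; last exact: ltW.
  case: ifP => _; last by apply: ldeg_nat; exact: ltW.
  by apply: ldeg_leD; apply: ldeg_le_mono; lia.
exists s, s; rewrite rank1_hcoef eqxx mulr1 gez0_abs; last exact: ltW.
rewrite lcoefDr !lcoef_mono eqxx.
by have -> : (L s == - L s) = false by apply/eqP; lia.
Qed.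

End RankOne.

(** * Property P12 *)

Section ParabolicSubgroups.
Variables (W : groupType) (s1 s2 : W) (S : set W) (L : W -> int).
Hypothesis hS : S = [set s1; s2].
Hypothesis hW : infinite_dihedral s1 s2.
Hypothesis hL1 : 0 < L s1.
Hypothesis hL12 : L s1 < L s2.
Variable H : hecke_algebra S L.

Let s11 : (s1 * s1 = 1)%g. Proof. by case: hW. Qed.
Let s22 : (s2 * s2 = 1)%g. Proof. by case: hW. Qed.

Lemma mem_gen_subgroup (I : set W) s : I s -> s \in gen_subgroup I.
Proof. by move=> Is; apply/asboolP => P _; apply. Qed.

Lemma val_parabolic_mul (I : set W) (x y : parabolic I) :
  val (x * y)%g = (val x * val y)%g.
Proof. by []. Qed.

Lemma val_parabolicX (I : set W) (x : parabolic I) n : val (x ^+ n)%g = (val x ^+ n)%g.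
Proof. by elim: n => [|n IH]; rewrite ?expg0 // !expgS val_parabolic_mul IH. Qed.

(** W_I is again infinite dihedral, on the copies of s1 and s2, with the same normal forms; [afunE]
    then gives the same value on both sides. *)
Lemma P12_full (I : set W) (HI : hecke_algebra (parabolic_gens I) (fun y => L (val y)))
  (y : parabolic I) : I `<=` S -> I s1 -> I s2 -> afun HI y = afun H (val y).
Proof.
move=> IS I1 I2; pose t1 := Parabolic (mem_gen_subgroup I1).
pose t2 := Parabolic (mem_gen_subgroup I2).
have valI i : val (idx_val t1 t2 i) = idx_val s1 s2 i.
  by case: i => [||a n b] //=; rewrite !(val_parabolic_mul, val_parabolicX).
have hS' : parabolic_gens I = [set t1; t2].
  apply/seteqP; split=> x /=.
    rewrite /parabolic_gens /= => /IS; rewrite hS => -[e|e]; [left|right]; exact: val_inj.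
  by case=> ->.
have hW' : infinite_dihedral t1 t2.
  split; [exact: val_inj|exact: val_inj| |].
    move=> w; apply/asboolP => P Pg Pt; have [i iE] := idx_val_surj hW (val w).
    have PM := group_closedM Pg.
    have PX x n : x \in P -> (x ^+ n)%g \in P.
      by move=> xP; elim: n => [|n IH]; rewrite ?expg0 ?expgS; [exact: Pg.1 | apply: PM].
    have P1 : t1 \in P by apply: Pt; left.
    have P2 : t2 \in P by apply: Pt; right.
    have -> : w = idx_val t1 t2 i by apply: val_inj; rewrite valI iE.
    case: i {iE} => [||a n b] //=; first exact: Pg.1.
    have P21 : (t2 * t1)%g \in P by apply: (PM).
    by do 2![apply: (PM); first exact: (PX)]; apply: (PM) => //; apply: (PX).
  move=> m [m0 tm hm]; have [_ _ _ /(_ m)] := hW; apply; split=> //.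
    by have := congr1 val tm; rewrite val_parabolicX.
  by move=> k km h; apply: (hm k km); apply: val_inj; rewrite val_parabolicX.
apply/eqP; rewrite -eqz_nat; apply/eqP.
rewrite (@afunE _ t1 t2 _ _ hS' hW' hL1 hL12 HI) (afunE hS hW hL1 hL12 H).
have -> : idx_of s1 s2 (val y) = idx_of t1 t2 y.
  by rewrite -{1}(idx_ofK hW' y) valI (idx_valK hW).
by [].
Qed.

Lemma P12_rank1 (I : set W) (HI : hecke_algebra (parabolic_gens I) (fun y => L (val y)))
  (y : parabolic I) s : I = [set s] -> (s * s = 1)%g -> s <> 1%g -> 0 < L s ->
  (afun HI y)%:Z = if val y == s then L s else 0.
Proof.
move=> hI ss s1' Ls; have Is : I s by rewrite hI.
pose t := Parabolic (mem_gen_subgroup Is).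
have yP (w : parabolic I) : w = 1%g \/ w = t.
  suff [e|e] : val w = 1%g \/ val w = s by [left; apply: val_inj|right; apply: val_inj|].
  have /asboolP h := valP w.
  have := h (fun x => `[< x = 1%g \/ x = s >]); rewrite unfold_in => {}h.
  apply/asboolP/h; last by rewrite hI => x ->; apply/asboolP; right.
  split; first by apply/asboolP; left.
  have sV : (s^-1 = s)%g by apply: mulg1_eq.
  move=> x z /asboolP[->|->] /asboolP[->|->]; apply/asboolP;
    rewrite ?invg1 ?sV ?mulg1 ?mul1g ?ss; by [left|right].
have gI : parabolic_gens I = [set t].
  have memI u : I u <-> u = s by rewrite hI.
  apply/seteqP; split=> x /=; first by move=> /memI e; apply: val_inj.
  by move=> ->.
have t1 : t <> 1%g by move=> /(congr1 val).
have tt : (t * t = 1)%g by apply: val_inj.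
rewrite (@rank1_afun _ t _ _ gI yP t1 tt Ls HI).
by rewrite -(inj_eq val_inj).
Qed.

(** For a proper subset I the group W_I has at most one nontrivial element, and the comparison only
    involves the values 0, L(s1) and L(s2) of a at 1, s1 and s2. *)
Lemma P12_dihedral : P12 H.
Proof.
move=> I IS HI y.
have i1 : idx_of s1 s2 s1 = Sgl by exact: (idx_valK hW Sgl).
have i2 : idx_of s1 s2 s2 = Mid false 0 false by exact: (idx_sgen hW true).
have i0 : idx_of s1 s2 1%g = One by exact: idx_of1.
have s1N : s1 <> 1%g by move=> e; move: i1; rewrite [X in idx_of _ _ X]e i0.
have s2N : s2 <> 1%g by move=> e; move: i2; rewrite [X in idx_of _ _ X]e i0.
have mem1 (s : W) (ss : (s * s = 1)%g) (hI : I = [set s]) : val y = 1%g \/ val y = s.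
  have /asboolP h := valP y.
  have := h (fun x => `[< x = 1%g \/ x = s >]); rewrite unfold_in => {}h.
  apply/asboolP/h; last by rewrite hI => x ->; apply/asboolP; right.
  split; first by apply/asboolP; left.
  have sV : (s^-1 = s)%g by apply: mulg1_eq.
  move=> x z /asboolP[->|->] /asboolP[->|->]; apply/asboolP;
    rewrite ?invg1 ?sV ?mulg1 ?mul1g ?ss; by [left|right].
have sub s : I s -> s = s1 \/ s = s2 by move=> /IS; rewrite hS.
have rank1 s : I = [set s] -> (s * s = 1)%g -> s <> 1%g -> 0 < L s ->
    idx_a s1 s2 L (idx_of s1 s2 s) = L s -> afun HI y = afun H (val y).
  move=> hI ss sN Ls aE; apply/eqP; rewrite -eqz_nat; apply/eqP.
  rewrite (P12_rank1 HI y hI ss sN Ls) (afunE hS hW hL1 hL12 H).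
  have [e|e] := mem1 s ss hI; rewrite e ?eqxx ?aE //.
  by rewrite (_ : (1%g == s) = false) ?i0 //; apply/eqP => e'; case: sN.
have [I1|I1] := pselect (I s1); have [I2|I2] := pselect (I s2).
- exact: P12_full.
- apply: (rank1 s1) => //; last by rewrite i1.
  apply/seteqP; split=> x /=; last by move=> ->.
  by move=> Ix; case: (sub x Ix) => // e; rewrite e in Ix.
- apply: (rank1 s2) => //; [|exact: lt_trans hL12|by rewrite i2].
  apply/seteqP; split=> x /=; last by move=> ->.
  by move=> Ix; case: (sub x Ix) => // e; rewrite e in Ix.
have I0 : I = set0.
  apply/seteqP; split=> x //= Ix.
  by case: (sub x Ix) => e; rewrite e in Ix.
have only1 (w : parabolic I) : w = 1%g.
  apply: val_inj; have /asboolP h := valP w.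
  have := h (fun x => `[< x = 1%g >]); rewrite unfold_in => {}h.
  apply/asboolP/h; last by rewrite I0.
  split; first exact/asboolP.
  by move=> x z /asboolP -> /asboolP ->; apply/asboolP; rewrite invg1 mulg1.
have noI u : ~ I u by rewrite I0.
rewrite rank0_afun //; last by apply/seteqP; split=> x //= /noI.
apply/eqP; rewrite -eqz_nat (afunE hS hW hL1 hL12 H) (only1 y).
by rewrite (_ : idx_of s1 s2 (val _) = One).
Qed.

End ParabolicSubgroups.


Theorem mainTheorem4 (W : groupType) (s1 s2 : W)
    (hW : infinite_dihedral s1 s2)
    (L : W -> int) (hL : weight_function [set s1; s2] L)
    (hL1 : 0 < L s1) (hL12 : L s1 < L s2)
    (H : hecke_algebra [set s1; s2] L) :
  bounded H /\
  [/\ P1 H, P2 H, P3 H, P4 H & P5 H] /\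
  [/\ P6 H, P7 H, P8 H, P9 H & P10 H] /\
  [/\ P11 H, P12 H, P13 H, P14 H & P15 H].
Proof.
have hS := erefl [set s1; s2].
split; first exact: bounded_dihedral.
split; first by split; [apply: P1_dihedral | apply: P2_dihedral | apply: P3_dihedral
  | apply: P4_dihedral | apply: P5_dihedral].
split; first by split; [apply: P6_dihedral | apply: P7_dihedral | apply: P8_dihedral
  | apply: P9_dihedral | apply: P10_dihedral].
by split; [apply: P11_dihedral | apply: P12_dihedral | apply: P13_dihedral
  | apply: P14_dihedral | apply: P15_dihedral].
Qed.
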